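(* Let $d\ge3$ be odd, $n>d^2$, let $V$ be a $d$-dimensional complex vector space, and let $\sigma$ be a $d$-admissible signature of size $n$. Then all cluster and frozen variables in the cluster algebra $\mathcal A_\sigma$ are multi-homogeneous, i.e. homogeneous in each of the $n$ arguments $u_1,\dots,u_n$ (with respect to the multigrading of $R_\sigma(V)=\mathbb C[V^\sigma]^{\mathrm{SL}(V)}$ by the $n$-dimensional torus rescaling the $n$ factors of $V^\sigma$).
   Context: **Signatures.** A signature of size $n$ and type $(a,b)$, $a+b=n\ge3$, is a map $\sigma:\mathbb Z\to\{1,-1\}$ with $\sigma(j+n)=\sigma(j)$, taking the value $1$ (''black'') $a$ times and $-1$ (''white'') $b$ times on $\{1,\dots,n\}$. It is $d$-admissible if for all $j\in\mathbb Z$ and $k\in\{0,\dots,d-1\}$ there is $j'\ge j$ with $\sum_{i=j}^{j'}\sigma(i)\equiv k \pmod d$. **Mixed wedge.** Fix a volume form $e\in\bigwedge^dV$ (defining $\det$) and identify $\bigwedge^dV$ with $\bigwedge^0V=\mathbb C$ via $e$. For $u=u_1\wedge\cdots\wedge u_p$ and $v\in\bigwedge^qV$ with $p+q\ge d$ put $u\cap v=\sum_\tau \mathrm{sgn}(\tau)\det(u_{\tau(1)}\wedge\cdots\wedge u_{\tau(d-q)}\wedge v)\,u_{\tau(d-q+1)}\wedge\cdots\wedge u_{\tau(p)}$, the sum over permutations $\tau$ of $\{1,\dots,p\}$ increasing on the first $d-q$ and on the last $p+q-d$ positions (extended bilinearly). The mixed wedge of $u\in\bigwedge^pV$, $v\in\bigwedge^qV$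 is $u\curlywedge v=u\wedge v$ if $p+q\le d$ and $u\cap v$ if $p+q\ge d$ (these agree if $p+q=d$). A covector $u^*\in V^*$ is identified with the element $\psi(u^* )\in\bigwedge^{d-1}V$ such that $v\wedge\psi(u^* )=u^*(v)e$ for all $v\in V$. Iterated mixed wedges are evaluated from right to left. **Rings.** $V^\sigma$ is the product of $n$ factors, the $j$-th being $V$ if $\sigma(j)=1$ and $V^*$ if $\sigma(j)=-1$; its points are $\mathbf u=(u_1,\dots,u_n)$, and $u_{j+n}=u_j$. $\mathrm{SL}(V)$ acts naturally; $R_\sigma(V)=\mathbb C[V^\sigma]^{\mathrm{SL}(V)}$ and $K_\sigma$ is its fraction field. **Flags.** A decorated flag is $\mathcal G=(\mathcal G^1,\dots,\mathcal G^{d-1})$ with $0\ne\mathcal G^k\in\bigwedge^kV$ and $\mathcal G^{k+1}=\mathcal G^k\wedge v$ for some $v\in V$ ($1\le k<d-1$). Convention: $\mathcal G^0=1$, $\mathcal G^d=e$. Flags $\mathcal G,\mathcal H$ are in relative position $s_k$ if $\mathcal G^i=\mathcal H^i$ for $i\ne k$ and $\mathcal H^k$ is not proportional to $\mathcal G^k$; the crossing value $\langle\mathcal G,\mathcal H\rangle_k\in\mathbb C\setminus\{0\}$ is then defined by $\mathcal H^k=\mathcal G^{k-1}\wedge y$, $\mathcal G^k\wedge y=\langle\mathcal G,\mathcal H\rangle_k\,\mathcal G^{k+1}$ ($y\in V$). For generic $\mathbf u\in V^\sigma$, $j\in\mathbb Z$, $1\le k\le d-1$, let $j'\ge j$ be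 smallest with $\sum_{i=j}^{j'}\sigma(i)\equiv k\pmod d$ and $\mathcal F_j^k=u_j\curlywedge u_{j+1}\curlywedge\cdots\curlywedge u_{j'}$; then $\mathcal F_j=(\mathcal F_j^1,\dots,\mathcal F_j^{d-1})$ is a decorated flag, $\mathcal F_{j+n}=\mathcal F_j$. **Words.** Letters are in $\{1,\dots,d-1\}$; a marked word has some letters marked. Let $\rho_j=12\cdots(d-1)$ if $\sigma(j)=1$, $\rho_j=(d-1)\cdots21$ if $\sigma(j)=-1$, with only the last letter marked. For $p<q$ let $\beta(p,q)=\rho_p\rho_{p+1}\cdots\rho_{q-1}$. It is decorated by placing flags in the gaps between letters and at the ends: to the left of the $k$-th letter of $\rho_j$ stands $\mathcal F_{j,k}$, where, if $\sigma(j)=1$, $\mathcal F_{j,k}^i=\mathcal F_j^i$ for $i\ge k$ and $\mathcal F_{j+1}^i$ for $i<k$; if $\sigma(j)=-1$, $\mathcal F_{j,k}^i=\mathcal F_j^i$ for $i\le d-k$ and $\mathcal F_{j+1}^i$ for $i>d-k$; at the right end stands $\mathcal F_q$. Flags on the two sides of a letter $k$ are in relative position $s_k$, with crossing value $1$ if the letter is unmarked. **Demazure weaves.** A Demazure weave $\mathfrak w:\beta\rightrightarrows\beta'$ is a planar graph in a rectangle, read from top to bottom, given by a sequence of moves transforming the (marked) top word $\beta$ into the bottom word $\beta'$: $ii\to i$ (trivalent vertex), $ij\to ji$ with $|i-j|>1$ (4-valent vertex), $iji\to jij$ with $|i-j|=1$ (6-valent vertex). Edges are colored by letters. It is reduced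 if $\beta'$ is a reduced word in the symmetric group $S_d$. **Cycles.** Each marked top letter and each trivalent vertex $v$ defines a cycle $\gamma=\gamma_v$, a function from edges to $\mathbb Z_{\ge0}$: $\gamma=0$ on edges starting above $v$ and on other edges starting at the same level (in particular other top edges), $\gamma=1$ on the edge going down from $v$, and below $v$: at a trivalent vertex with incoming $a$ (left), $c$ (right), outgoing $b$: $\gamma(b)=\min(\gamma(a),\gamma(c))$; at a 4-valent vertex weights are carried along straight strands; at a 6-valent vertex with incoming $a,f,e$ (left to right) and outgoing $b,c,d$ (left to right): $\gamma(c)=\min(\gamma(a),\gamma(e))$, $\gamma(b)=\gamma(f)+\gamma(e)-\gamma(c)$, $\gamma(d)=\gamma(a)+\gamma(f)-\gamma(c)$. A cycle is frozen if it comes from a marked top letter or is nonzero on some bottom edge; otherwise mutable. **Quiver.** For numbers put $D(x,y,z;x',y',z')=\det\begin{pmatrix}1&1&1\\ x&y&z\\ x'&y'&z'\end{pmatrix}$. The intersection pairing is $\langle\gamma,\gamma'\rangle=\sum_v\langle\gamma,\gamma'\rangle_v$ over internal vertices, with $\langle\gamma,\gamma'\rangle_v=D(\gamma(a),\gamma(b),\gamma(c);\gamma'(a),\gamma'(b),\gamma'(c))$ at trivalent vertices, $\frac12\big[D(\gamma(a),\gamma(c),\gamma(e);\gamma'(a),\gamma'(c),\gamma'(e))+D(\gamma(b),\gamma(d),\gamma(f);\gamma'(b),\gamma'(d),\gamma'(f))\big]$ at 6-valent vertices, $0$ at 4-valent vertices (here, at a trivalent vertex, $a$ and $c$ are the left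 and right incoming edges and $b$ is the outgoing edge; at a 6-valent vertex, $a,f,e$ are the incoming edges and $b,c,d$ the outgoing edges, each listed from left to right). The quiver $Q(\mathfrak w)$ has the cycles as vertices (frozen/mutable accordingly) and $\langle\gamma,\gamma'\rangle$ arrows from $\gamma$ to $\gamma'$ (negative means reversed); arrows between frozen vertices are kept. **Cluster variables.** For generic $\mathbf u$ the decoration of the top word extends uniquely to an assignment of decorated flags to all regions of $\mathfrak w$, with unique numbers $\Delta_\gamma\ne0$ (one per cycle), such that for each edge $e$ of color $k$ with left region $U$ and right region $W$, the flags are in relative position $s_k$ and $\langle\mathcal F_U,\mathcal F_W\rangle_k=\prod_\gamma\Delta_\gamma^{\gamma(e)}$. The $\Delta_\gamma$ are $\mathrm{SL}(V)$-invariant rational functions of $\mathbf u$, i.e. elements of $K_\sigma$. The seed of $\mathfrak w$ is $\Sigma(\mathfrak w)=(Q(\mathfrak w),\{\Delta_\gamma\})$. **The cluster algebra.** A valid cut is a pair $1\le p\le q\le n$ with $\min(q-p,\,n-(q-p))\ge d+1$. Choose reduced Demazure weaves $\mathfrak w_1:\beta(p,q)\rightrightarrows\beta_1'$ and $\mathfrak w_2:\beta(q,p+n)\rightrightarrows\beta_2'$ with $\beta_2'$ the reverse of $\beta_1'$ (both are reduced words for the longest element of $S_d$). The seeds $\Sigma(\mathfrak w_1),\Sigma(\mathfrak w_2)$ share the frozen variables $\mathbf z_0=\{\mathcal F_p^k\wedge\mathcal F_q^{d-k}:1\le k\le d-1\}$. The seed $\Sigma_\sigma(p,q)$ is their amalgamation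 along $\mathbf z_0$: take the union of both quivers, identify vertices carrying the same element of $\mathbf z_0$, add the arrow numbers between identified vertices, and declare the identified vertices mutable; the extended cluster is the union of the two. $\mathcal A_\sigma$ is the cluster algebra (over $\mathbb C$, generated by all cluster and frozen variables in all seeds mutation equivalent to $\Sigma_\sigma(p,q)$; frozen variables are not inverted). It does not depend on the choices of $\mathfrak w_1,\mathfrak w_2$ nor on the valid cut, and its cluster and frozen variables are those appearing in these mutation equivalent seeds. *)

(* Defs.v *)
From HB Require Import structures.
From mathcomp Require Import all_boot all_order all_fingroup all_algebra.
From mathcomp Require Import boolp mpoly ring.

Set Implicit Arguments.
Unset Strict Implicit.
Unset Printing Implicit Defensive.

Import Order.TTheory GRing.Theory Num.Theory.
Local Open Scope ring_scope.

Notation "x %:F" := (@FracField.tofrac _ x) : ring_scope.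

(** * Signatures *)

(* The type (a, b) of a signature is determined by sigma and is not recorded. *)
Definition signature (n : nat) (sigma : int -> int) : Prop :=
  [/\ (3 <= n)%N,
      forall j, sigma j = 1 \/ sigma j = -1 &
      forall j, sigma (j + n%:Z) = sigma j].

(* sigma(j) + ... + sigma(j + t) = k modulo d *)
Definition hits (d : nat) (sigma : int -> int) (j : int) (k t : nat) : bool :=
  (\sum_(i < t.+1) sigma (j + i%:Z) == k %[mod d])%Z.

Definition admissible (d : nat) (sigma : int -> int) : Prop :=
  forall (j : int) (k : nat), (k < d)%N -> exists t, hits d sigma j k t.

(* The least t with hits d sigma j k t, i.e. j' - j. *)
Definition first_hit (d : nat) (sigma : int -> int) (j : int) (k : nat) : nat :=
  if pselect (exists t, hits d sigma j k t) is left h then ex_minn h else 0%N.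

(** * The exterior algebra of V and the mixed wedge *)

(* V is F^d, where the basis e_0, ..., e_(d-1) is chosen so that the volume
   form is e = e_0 /\ ... /\ e_(d-1). An element of the exterior algebra is
   given by its coordinates in the basis e_A = e_(a_1) /\ ... /\ e_(a_p),
   A = {a_1 < ... < a_p}. Covectors are given in the dual basis. *)
Section Exterior.
Variables (F : fieldType) (d : nat).

Definition ext := {ffun {set 'I_d} -> F^o}.

Definition ebase (A : {set 'I_d}) : ext := [ffun B => (B == A)%:R].

Definition in_ext (k : nat) (x : ext) : Prop :=
  forall A, x A != 0 -> #|A| = k.

(* e_A /\ e_B = sgn A B e_(A u B) for disjoint A and B *)
Definition sgn (A B : {set 'I_d}) : F :=
  (-1) ^+ #|[set ab : 'I_d * 'I_d |
              [&& ab.1 \in A, ab.2 \in B & (ab.2 < ab.1)%N]]|.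

Definition wedge (x y : ext) : ext :=
  [ffun S : {set 'I_d} =>
     \sum_(A : {set 'I_d} | A \subset S) sgn A (S :\: A) * x A * y (S :\: A)].

Definition vol : ext := ebase setT.

Definition det (x : ext) : F := x setT.

(* For u = e_A with A = {a_1 < ... < a_p}, a permutation tau in the definition
   of the cap product amounts to the subset B of A of its first d - q values,
   and its sign is sgn B (A :\: B). *)
Definition cap (q : nat) (u v : ext) : ext :=
  \sum_(A : {set 'I_d})
    \sum_(B : {set 'I_d} | (B \subset A) && (#|B| == d - q)%N)
      (u A * sgn B (A :\: B) * det (wedge (ebase B) v)) *: ebase (A :\: B).

(* Homogeneous elements are paired with their degree. If p + q = d, the two
   formulas agree via vol = 1; the second one gives the result in degree 0. *)
Definition mwedge (x y : nat * ext) : nat * ext :=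
  if (x.1 + y.1 < d)%N then ((x.1 + y.1)%N, wedge x.2 y.2)
  else ((x.1 + y.1 - d)%N, cap y.1 x.2 y.2).

(* x j mixed-wedge (x (j+1) mixed-wedge ( ... mixed-wedge x (j+t))) *)
Fixpoint iter_mwedge (x : int -> nat * ext) (j : int) (t : nat) : nat * ext :=
  if t is t'.+1 then mwedge (x j) (iter_mwedge x (j + 1) t') else x j.

Definition vec (v : 'rV[F]_d) : ext := \sum_i v 0 i *: ebase [set i].

Definition psi (c : 'rV[F]_d) : ext :=
  \sum_i (c 0 i * sgn [set i] (~: [set i])) *: ebase (~: [set i]).

Lemma wedge_sum (I J : finType) (f : I -> F) (g : J -> F)
    (A : I -> {set 'I_d}) (B : J -> {set 'I_d}) :
  wedge (\sum_i f i *: ebase (A i)) (\sum_j g j *: ebase (B j)) =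
  \sum_i \sum_j (f i * g j) *: wedge (ebase (A i)) (ebase (B j)).
Proof.
apply/ffunP=> S; rewrite ffunE sum_ffunE.
under eq_bigr => X _.
  rewrite !sum_ffunE -mulrA mulr_suml mulr_sumr.
  under eq_bigr => i _ do rewrite mulr_sumr mulr_sumr.
  over.
rewrite exchange_big; apply: eq_bigr => i _; rewrite sum_ffunE exchange_big.
apply: eq_bigr => j _; rewrite !ffunE /GRing.scale /= mulr_sumr.
by apply: eq_bigr => X _; rewrite !ffunE /GRing.scale /=; ring.
Qed.

Lemma wedge_ebase (A B : {set 'I_d}) :
  wedge (ebase A) (ebase B) =
  if [disjoint A & B] then sgn A B *: ebase (A :|: B) else 0.
Proof.
apply/ffunP=> S; rewrite ffunE.
have [sAS|nAS] := boolP (A \subset S); last first.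
  rewrite big1 => [|X sX]; last first.
    rewrite !ffunE; case: eqP => [XA|]; last by rewrite mulr0 mul0r.
    by rewrite -XA sX in nAS.
  case: ifP => _; rewrite !ffunE //.
  case: eqP => [SE|]; last by rewrite scaler0.
  by rewrite SE subsetUl in nAS.
rewrite (bigD1 A) //= [X in _ + X]big1 => [|X /andP[_ /negPf XA]]; last first.
  by rewrite !ffunE XA mulr0 mul0r.
rewrite !ffunE eqxx mulr1 addr0; case: ifP => [dAB|dAB]; rewrite !ffunE.
  case: (S =P A :|: B) => [->|SE].
    rewrite setDUl setDv set0U.
    suff -> : B :\: A = B by rewrite eqxx.
    by apply/setDidPl; rewrite disjoint_sym.
  case: eqP => [BE|]; last by rewrite mulr0 scaler0.
  by case: SE; rewrite -BE setDE setUIr setUCr setIT; apply/esym/setUidPr.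
case: eqP => [BE|]; last by rewrite mulr0.
move: dAB; rewrite -BE -setI_eq0 setDE setICA setICr setI0.
by rewrite eqxx.
Qed.

(* The property that defines psi. *)
Lemma wedge_psi (v c : 'rV[F]_d) :
  wedge (vec v) (psi c) = (\sum_i c 0 i * v 0 i) *: vol.
Proof.
rewrite wedge_sum scaler_suml; apply: eq_bigr => i _.
rewrite (bigD1 i) //= big1 ?addr0 => [|j ji]; rewrite wedge_ebase.
  rewrite disjoints_subset setCK subxx setUCr scalerA; congr (_ *: _).
  rewrite mulrA -mulrA -expr2 /sgn -exprM mulnC exprM sqrrN !expr1n mulr1.
  exact: mulrC.
case: ifP; last by rewrite scaler0.
by rewrite disjoints_subset setCK sub1set inE eq_sym (negPf ji).
Qed.

(** * Decorated flags *)

(* Only the values at 1, ..., d-1 are meaningful. *)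
Definition flag := nat -> ext.

Definition fl (G : flag) (k : nat) : ext :=
  if k == 0%N then ebase set0 else if k == d then vol else G k.

Definition is_flag (G : flag) : Prop :=
  (forall k, (0 < k < d)%N -> in_ext k (G k) /\ G k != 0) /\
  (forall k, (0 < k < d.-1)%N -> exists v, G k.+1 = wedge (G k) (vec v)).

Definition flag_eq (G H : flag) : Prop :=
  forall k, (0 < k < d)%N -> G k = H k.

Definition rel_pos (k : nat) (G H : flag) : Prop :=
  (forall i, (0 < i < d)%N -> i <> k -> G i = H i) /\
  (forall c, H k <> c *: G k).

(* G and H are in relative position s_k with crossing value c *)
Definition crossing (k : nat) (G H : flag) (c : F) : Prop :=
  [/\ (0 < k < d)%N, rel_pos k G H &
      exists y, fl H k = wedge (fl G k.-1) (vec y) /\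
                wedge (fl G k) (vec y) = c *: fl G k.+1].

End Exterior.

(** * The space V^sigma, its functions and its flags *)

(* A point u of V^sigma is the matrix of the coordinates of u_1, ..., u_n;
   u_j is the row of index j mod n, hence u_n is the row of index 0. *)
Section Functions.
Variables (F : fieldType) (n d : nat) (sigma : int -> int).

Definition polyfun := {mpoly F[n * d]}.
Definition ratfun := {fraction {mpoly F[n * d]}}.

Definition peval (P : polyfun) (u : 'M[F]_(n, d)) : F := P.@[mxvec u 0].

(* f is defined at u, with value c *)
Definition has_value (f : ratfun) (u : 'M[F]_(n, d)) (c : F) : Prop :=
  exists P Q : polyfun,
    [/\ f = P%:F / Q%:F, peval Q u != 0 & c = peval P u / peval Q u].

Definition generically (A : 'M[F]_(n, d) -> Prop) : Prop :=
  exists2 G : polyfun, G != 0 & forall u, peval G u != 0 -> A u.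

(* g acts on V by v |-> g v, and on V^* by c |-> c o g^-1 *)
Definition SLact (g : 'M[F]_d) (u : 'M[F]_(n, d)) : 'M[F]_(n, d) :=
  \matrix_(r < n) (if sigma r%:Z == 1 then row r u *m g^T
                   else row r u *m invmx g).

(* membership in R_sigma(V) *)
Definition in_R (P : polyfun) : Prop :=
  forall g : 'M[F]_d, \det g = 1 -> forall u, peval P (SLact g u) = peval P u.

(* membership in K_sigma *)
Definition in_K (f : ratfun) : Prop :=
  exists P Q : polyfun, [/\ in_R P, in_R Q, Q != 0 & f = P%:F / Q%:F].

(* P has degree a r in the r-th argument, for all r *)
Definition has_multidegree (a : 'I_n -> nat) (P : polyfun) : Prop :=
  forall t : 'rV[F]_n, (forall r, t 0 r != 0) ->
  forall u, peval P (diag_mx t *m u) = (\prod_r t 0 r ^+ a r) * peval P u.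

(* The multigrading of R_sigma(V), extended to its fraction field: an element
   of R_sigma(V) is homogeneous as an element of K_sigma if and only if it is
   homogeneous in R_sigma(V). *)
Definition multihomogeneous (f : ratfun) : Prop :=
  exists P Q : polyfun,
    [/\ in_R P, in_R Q, Q != 0, f = P%:F / Q%:F &
        exists a b, has_multidegree a P /\ has_multidegree b Q].

Definition arg (u : 'M[F]_(n, d)) (j : int) : 'rV[F]_d :=
  if insub `|(j %% n%:Z)%Z|%N is Some r then row r u else 0.

Definition arg_ext (u : 'M[F]_(n, d)) (j : int) : nat * ext F d :=
  if sigma j == 1 then (1%N, vec (arg u j)) else (d.-1, psi (arg u j)).

(* F_j *)
Definition Fflag (u : 'M[F]_(n, d)) (j : int) : flag F d :=
  fun k => (iter_mwedge (arg_ext u) j (first_hit d sigma j k)).2.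

(* F_(j,k) *)
Definition Fgap (u : 'M[F]_(n, d)) (j : int) (k : nat) : flag F d :=
  fun i => if sigma j == 1
           then (if (k <= i)%N then Fflag u j i else Fflag u (j + 1) i)
           else (if (i <= d - k)%N then Fflag u j i else Fflag u (j + 1) i).

Definition in_z0 (p q : nat) (f : ratfun) : Prop :=
  exists2 k, (0 < k < d)%N &
    generically (fun u =>
      has_value f u (det (wedge (Fflag u p%:Z k) (Fflag u q%:Z (d - k)%N)))).

End Functions.

(** * Words *)

Definition word := seq nat.

Definition rho (d : nat) (sigma : int -> int) (j : int) : word :=
  if sigma j == 1 then iota 1 d.-1 else rev (iota 1 d.-1).

Definition beta (d : nat) (sigma : int -> int) (p q : nat) : word :=
  flatten [seq rho d sigma j%:Z | j <- iota p (q - p)].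

(* Positions are counted from 0; the last letter of each rho_j is marked. *)
Definition marked (d : nat) : pred nat := fun m => (d.-1 %| m.+1)%N.

(* the transposition of k-1 and k in 'S_d, for 0 < k < d *)
Definition simple_refl (d k : nat) : 'S_d :=
  if (insub k.-1, insub k) is (Some i, Some j) then tperm i j else 1%g.

Definition word_perm (d : nat) (w : word) : 'S_d :=
  (\prod_(k <- w) simple_refl d k)%g.

Definition reduced_word (d : nat) (w : word) : Prop :=
  forall w', word_perm d w' = word_perm d w -> (size w <= size w')%N.

(** * Demazure weaves *)

Inductive vertex := Trivalent | Fourvalent | Sixvalent.

(* A move is given by its vertex and the position of the leftmost incoming
   edge. *)
Definition move := (vertex * nat)%type.

Definition arity_in (v : vertex) : nat :=
  match v with Trivalent => 2 | Fourvalent => 2 | Sixvalent => 3 end.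
Definition arity_out (v : vertex) : nat :=
  match v with Trivalent => 1 | Fourvalent => 2 | Sixvalent => 3 end.
Definition is_trivalent (v : vertex) : bool :=
  if v is Trivalent then true else false.

Definition replace (m k : nat) (s' s : seq nat) : seq nat :=
  take m s ++ s' ++ drop (m + k) s.

Definition move_ok (mv : move) (w : word) : bool :=
  let m := mv.2 in
  let i := nth 0%N w m in let j := nth 0%N w m.+1 in let k := nth 0%N w m.+2 in
  (m + arity_in mv.1 <= size w)%N &&
  match mv.1 with
  | Trivalent => i == j
  | Fourvalent => ((i.+1 < j) || (j.+1 < i))%N
  | Sixvalent => (k == i) && ((i.+1 == j) || (j.+1 == i))
  end.

Definition move_word (mv : move) (w : word) : word :=
  let m := mv.2 in let i := nth 0%N w m in let j := nth 0%N w m.+1 in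
  replace m (arity_in mv.1)
    match mv.1 with
    | Trivalent => [:: i]
    | Fourvalent => [:: j; i]
    | Sixvalent => [:: j; i; j]
    end w.

(* The weights of a cycle on the edges below a vertex, from the weights g on
   the edges above it. *)
Definition move_weights (mv : move) (g : seq nat) : seq nat :=
  let m := mv.2 in
  let x := nth 0%N g m in let y := nth 0%N g m.+1 in let z := nth 0%N g m.+2 in
  replace m (arity_in mv.1)
    match mv.1 with
    | Trivalent => [:: minn x y]
    | Fourvalent => [:: y; x]
    | Sixvalent => [:: y + z - minn x z; minn x z; x + y - minn x z]%N
    end g.

(* w : b => b' *)
Fixpoint is_weave (b : word) (w : seq move) (b' : word) : bool :=
  if w is mv :: w' then move_ok mv b && is_weave (move_word mv b) w' b'
  else b == b'.

Definition is_reduced_weave (d : nat) (b : word) (w : seq move) (b' : word) :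
    Prop :=
  is_weave b w b' /\ reduced_word d b'.

(* the three-by-three determinant of the definition of the quiver *)
Definition D (x y z x' y' z' : int) : int :=
  \det (\matrix_(i < 3, j < 3)
          nth 0 (nth [::] [:: [:: 1; 1; 1]; [:: x; y; z]; [:: x'; y'; z']] i) j).

Lemma DE (x y z x' y' z' : int) :
  D x y z x' y' z' = (y - x) * (z' - x') - (z - x) * (y' - x').
Proof.
rewrite /D (expand_det_row _ 0) !big_ord_recl big_ord0 /cofactor.
rewrite !(expand_det_row (_ : 'M_2) 0) !big_ord_recl !big_ord0 /cofactor.
rewrite !det_mx11 !mxE /=; ring.
Qed.

(* At a 6-valent vertex the two determinants are equal, so that halving their
   sum in int is exact. *)
Lemma D_sixvalent (a f e c a' f' e' c' : int) :
  D (f + e - c) (a + f - c) f (f' + e' - c') (a' + f' - c') f' =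
  D a c e a' c' e'.
Proof. by rewrite !DE; ring. Qed.

Section Weave.
Variables (b : word) (mk : pred nat) (w : seq move).

(* Level t lies between the moves of indices t-1 and t; level 0 is the top of
   the weave, level (size w) its bottom. *)
Definition word_at (t : nat) : word :=
  foldl (fun x mv => move_word mv x) b (take t w).

Definition move_at (t : nat) : move := nth (Trivalent, 0%N) w t.

Definition bottom : nat := size w.

(* A cycle is either a marked top letter (inl) or a trivalent vertex (inr). *)
Definition is_cycle (c : 'I_(size b) + 'I_(size w)) : bool :=
  match c with
  | inl m => mk m
  | inr t => is_trivalent (move_at t).1
  end.

Definition cycle := {c : 'I_(size b) + 'I_(size w) | is_cycle c}.

Definition unit_weights (m k : nat) : seq nat :=
  mkseq (fun i => (i == m) : nat) k.

(* from the weights g at level s to those at level t >= s *)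
Definition propagate (s t : nat) (g : seq nat) : seq nat :=
  foldl (fun x mv => move_weights mv x) g (drop s (take t w)).

Definition weights (c : cycle) (t : nat) : seq nat :=
  match val c with
  | inl m => propagate 0 t (unit_weights m (size b))
  | inr s =>
      if (t <= s)%N then nseq (size (word_at t)) 0%N
      else propagate s.+1 t (unit_weights (move_at s).2 (size (word_at s.+1)))
  end.

(* the weight of c on the m-th edge at level t *)
Definition weight (c : cycle) (t m : nat) : nat := nth 0%N (weights c t) m.

Definition frozen (c : cycle) : bool :=
  match val c with inl _ => true | inr _ => false end
  || has (fun x => x != 0%N) (weights c bottom).

(* the contribution to the intersection pairing of the vertex of index t *)
Definition local_pairing (c c' : cycle) (t : nat) : int :=
  let: (v, m) := move_at t in
  let up k := (weight c t (m + k))%:Z in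
  let up' k := (weight c' t (m + k))%:Z in
  let dn k := (weight c t.+1 (m + k))%:Z in
  let dn' k := (weight c' t.+1 (m + k))%:Z in
  match v with
  | Trivalent => D (up 0%N) (dn 0%N) (up 1%N) (up' 0%N) (dn' 0%N) (up' 1%N)
  | Fourvalent => 0
  | Sixvalent =>
      ((D (up 0%N) (dn 1%N) (up 2%N) (up' 0%N) (dn' 1%N) (up' 2%N) +
        D (dn 0%N) (dn 2%N) (up 1%N) (dn' 0%N) (dn' 2%N) (up' 1%N)) %/ 2)%Z
  end.

Definition pairing (c c' : cycle) : int :=
  \sum_(t < size w) local_pairing c c' t.

Section Decoration.
Variables (F : fieldType) (d : nat).

(* Fl t g is the flag in the region that contains the g-th gap of level t. A
   gap and the corresponding gap of the next level lie in the same region,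
   unless the gap is between two incoming or two outgoing edges of the vertex. *)
Definition is_decoration (Fl : nat -> nat -> flag F d) (delta : cycle -> F) :
    Prop :=
  [/\ forall t g, (t <= bottom)%N -> (g <= size (word_at t))%N ->
        is_flag (Fl t g),
      forall t g, (t < bottom)%N -> (g <= (move_at t).2)%N ->
        flag_eq (Fl t.+1 g) (Fl t g),
      forall t g, (t < bottom)%N ->
        let: (v, m) := move_at t in
        (m + arity_in v <= g <= size (word_at t))%N ->
        flag_eq (Fl t.+1 (g - arity_in v + arity_out v)%N) (Fl t g) &
      forall t m, (t <= bottom)%N -> (m < size (word_at t))%N ->
        crossing (nth 0%N (word_at t) m) (Fl t m) (Fl t m.+1)
          (\prod_(c : cycle) delta c ^+ weight c t m)].

End Decoration.
End Weave.

(** * Seeds and mutations *)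

Section Seeds.
Variable K : fieldType.

(* arrows v w is the number of arrows from v to w minus the number of arrows
   from w to v *)
Record seed (I : finType) := Seed {
  mutable : pred I;
  arrows : I -> I -> int;
  var : I -> K }.

Definition pos (x : int) : nat := `|Num.max x 0|%N.

Definition mutate (I : finType) (S : seed I) (k : I) : seed I :=
  {| mutable := mutable S;
     arrows := fun v w =>
       if (v == k) || (w == k) then - arrows S v w
       else arrows S v w + (pos (arrows S v k) * pos (arrows S k w))%:Z
                         - (pos (arrows S w k) * pos (arrows S k v))%:Z;
     var := fun v =>
       if v == k then (\prod_w var S w ^+ pos (arrows S w k) +
                       \prod_w var S w ^+ pos (arrows S k w)) / var S k
       else var S v |}.

Inductive mutation_equiv (I : finType) (S0 : seed I) : seed I -> Prop :=
| mutation_refl : mutation_equiv S0 S0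
| mutation_step S k : mutation_equiv S0 S -> mutable S k ->
    mutation_equiv S0 (mutate S k).

(* S is the amalgamation of S1 and S2 along the elements of z *)
Definition is_amalgam (z : K -> Prop) (I1 I2 I : finType)
    (S1 : seed I1) (S2 : seed I2) (S : seed I) : Prop :=
  exists (f1 : I1 -> I) (f2 : I2 -> I),
    [/\ injective f1, injective f2,
        forall v, (exists i, v = f1 i) \/ (exists j, v = f2 j) &
        forall i j, f1 i = f2 j <-> var S1 i = var S2 j /\ z (var S1 i)] /\
    [/\ forall i, var S (f1 i) = var S1 i,
        forall j, var S (f2 j) = var S2 j,
        forall v w, arrows S v w =
          \sum_(i | f1 i == v) \sum_(i' | f1 i' == w) arrows S1 i i' +
          \sum_(j | f2 j == v) \sum_(j' | f2 j' == w) arrows S2 j j' &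
        forall v, mutable S v =
          [|| [exists i, (f1 i == v) && mutable S1 i],
              [exists j, (f2 j == v) && mutable S2 j] |
              [exists i, f1 i == v] && [exists j, f2 j == v]]].

End Seeds.

(** * The cluster algebra A_sigma *)

Section ClusterAlgebra.
Variables (F : fieldType) (n d : nat) (sigma : int -> int).

Definition top_cycle (p q : nat) (w : seq move) :=
  cycle (beta d sigma p q) (marked d) w.

(* Delta is the family of the cluster variables of w : beta(p,q) => _; the
   gap g of the top word stands to the left of the k-th letter of rho_j for
   j = p + g %/ (d-1) and k = g %% (d-1) + 1, and F_(q,1) = F_q. *)
Definition cluster_variables (p q : nat) (w : seq move)
    (Delta : top_cycle p q w -> ratfun F n d) : Prop :=
  (forall c, in_K sigma (Delta c)) /\
  generically (fun u =>
    exists (delta : top_cycle p q w -> F) (Fl : nat -> nat -> flag F d),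
      [/\ forall c, delta c != 0 /\ has_value (Delta c) u (delta c),
          forall g, (g <= size (beta d sigma p q))%N ->
            flag_eq (Fl 0%N g)
              (Fgap sigma u (p + g %/ d.-1)%N%:Z (g %% d.-1).+1) &
          is_decoration Fl delta]).

Definition weave_seed (p q : nat) (w : seq move)
    (Delta : top_cycle p q w -> ratfun F n d) : seed (ratfun F n d) _ :=
  {| mutable := fun c => ~~ frozen c;
     arrows := fun c c' => pairing c c';
     var := Delta |}.

Definition valid_cut (p q : nat) : Prop :=
  [/\ (1 <= p)%N, (p <= q)%N, (q <= n)%N & (d < minn (q - p) (n - (q - p)))%N].

(* S is the seed Sigma_sigma(p,q), for some choice of the two weaves *)
Definition initial_seed (p q : nat) (I : finType) (S : seed (ratfun F n d) I) :
    Prop :=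
  exists (w1 w2 : seq move) (b' : word),
    [/\ is_reduced_weave d (beta d sigma p q) w1 b',
        is_reduced_weave d (beta d sigma q (p + n)) w2 (rev b') &
        exists (Delta1 : top_cycle p q w1 -> ratfun F n d)
               (Delta2 : top_cycle q (p + n) w2 -> ratfun F n d),
          [/\ cluster_variables Delta1, cluster_variables Delta2 &
              is_amalgam (in_z0 sigma p q)
                (weave_seed Delta1) (weave_seed Delta2) S]].

(* the cluster and frozen variables of A_sigma *)
Definition cluster_or_frozen_variable (z : ratfun F n d) : Prop :=
  exists (p q : nat) (I : finType) (S0 S : seed (ratfun F n d) I) (v : I),
    [/\ valid_cut p q, initial_seed p q S0, mutation_equiv S0 S & z = var S v].

End ClusterAlgebra.

(* Main.v *)
From mathcomp Require Import all_boot all_order all_fingroup all_algebra.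
From mathcomp Require Import boolp mpoly zify ring reals complex.
Require Import Defs.

(* Fix a row r and let the r-th argument be rescaled by x. The flags at the top
   of a weave are rescaled by powers of x, and since the decoration below is
   determined by the top, every flag and every cluster variable is rescaled by
   a power of x as well. Writing A(U, k) for the exponent of the k-th component
   of the flag of the region U, an edge of color k between the regions U and W
   carries a product of variables of total degree
     A(U, k) + A(W, k) - A(U, k-1) - A(U, k+1).
   It follows that the pairing of a cycle with the degrees of all cycles is the
   difference of its fluxes through the top and the bottom of the weave, where
   the flux is the sum of weight(e) (A(U, k) - A(W, k)) over the edges e of a
   horizontal line. Hence the degrees are balanced at the mutable cycles of one
   weave.

   The frozen bottom cycles are found by tropical path counting: the sum of the
   weights of a cycle over the bottom edges that exchange a value at most k with
   a value above k is the cost of the cheapest way of sorting, and it is 1 if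
   deleting the letter of the cycle spoils the sorting of the word and 0
   otherwise. Since each half of the cut has more than d blocks, exactly one
   cycle gamma(k) is nonzero at the bottom for each k; its variable is
   F_p^k /\ F_q^(d-k), and gamma(k) passes only through bottom edges joining k
   and k+1. In the amalgamation gamma(k) is glued to the cycle gamma(d-k) of the
   other weave; the bottom regions of the two weaves have opposite order and
   equal degrees, so the fluxes of the glued cycles cancel. Balance at all
   mutable vertices is preserved by mutation, and makes both monomials of every
   exchange relation of the same degree. *)

Set Implicit Arguments.
Unset Strict Implicit.
Unset Printing Implicit Defensive.

(** The weaves are arbitrary, so no cycle can be located by looking at a diagram; everything rests
    on quantities that survive each move. For the weights of one cycle this is the least cost of a
    sorting path: the rule at a 6-valent vertex is the tropical form of the braid relation. For the
    number of cycles it is [cnt], which braid moves preserve and which a trivalent vertex lowers by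
    one exactly when deleting its letters spoils the sorting; hence it can be computed on the top
    word alone. The size of a valid cut comes from here: d - 1 blocks sort every threshold, a swap
    against the order spoils its own block, and it may undo one more, which makes d + 1. The degrees
    are first produced combinatorially ([graded_exists]), without flags, and only then recognised as
    exponents ([decoration_scaled]); the flux identity needs the integers alone. Oddness of d enters
    through a sign: the two weaves see a shared variable as F_p^k /\ F_q^(d-k) and as F_q^(d-k) /\
    F_p^k, which differ by (-1)^(k(d-k)). *)

Section Sorting.
Local Open Scope nat_scope.

(** * Words acting on sequences: swaps, sorting, thresholds, tropical paths *)

Definition swp (T : Type) (i : nat) (v : nat -> T) : nat -> T :=
  fun x => if x == i then v i.+1 else if x == i.+1 then v i else v x.

Ltac swp_tac :=
  apply: funext => ?; rewrite /swp;
  repeat (case: eqP => ?; try lia); try reflexivity; try (congr (_ _); lia).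

Section Swap.
Variable T : Type.
Implicit Types (v : nat -> T) (i j : nat).

Lemma swpl i v : swp i v i = v i.+1.
Proof. by rewrite /swp eqxx. Qed.

Lemma swpr i v : swp i v i.+1 = v i.
Proof. by rewrite /swp eqxx; case: eqP => //; lia. Qed.

Lemma swpD i v x : x != i -> x != i.+1 -> swp i v x = v x.
Proof. by rewrite /swp => /negPf -> /negPf ->. Qed.

Lemma swpK i v : swp i (swp i v) = v.
Proof. swp_tac. Qed.

Lemma swpC i j v : (i.+1 < j) || (j.+1 < i) ->
  swp i (swp j v) = swp j (swp i v).
Proof. move=> h; swp_tac. Qed.

Lemma swp_braid i v :
  swp i (swp i.+1 (swp i v)) = swp i.+1 (swp i (swp i.+1 v)).
Proof. swp_tac. Qed.

Lemma swp_inj i v : injective v -> injective (swp i v).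
Proof.
move=> vi x y; rewrite /swp.
by repeat case: eqP => ?; move=> // /vi; lia.
Qed.

End Swap.

Implicit Types (v : nat -> nat) (S T : nat -> bool) (w : seq nat).
Implicit Types (g : seq nat) (i j k t c : nat).

(** The 0-1 principle: sorting commutes with this reduction ([thr_srt]), so the sorting is studied
    one threshold at a time. *)
Definition thr k v : nat -> bool := fun x => v x <= k.

Lemma thr_swp k i v : thr k (swp i v) = swp i (thr k v).
Proof. by apply: funext => x; rewrite /thr /swp; case: eqP => // _; case: eqP. Qed.

(** * Sorting *)

(** One step of the Demazure (0-Hecke) product. Pairs are put in decreasing order, so the longest
    element is the fully sorted state. Meaningful positions and values run from 1 to d. *)
Definition srt i v := if v i < v i.+1 then swp i v else v.

Definition run w v := foldl (fun u i => srt i u) v w.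

Definition pure w v := foldl (fun u i => swp i u) v w.

Lemma run_cat x y v : run (x ++ y) v = run y (run x v).
Proof. exact: foldl_cat. Qed.

Lemma srt_inj i v : injective v -> injective (srt i v).
Proof. by rewrite /srt; case: ifP => // _; exact: swp_inj. Qed.

Lemma run_inj w v : injective v -> injective (run w v).
Proof. by elim: w v => //= i w IH v vi; apply: IH; exact: srt_inj. Qed.

Lemma srt_idem i v : srt i (srt i v) = srt i v.
Proof.
by rewrite {2 3}/srt; case: ifP => h; rewrite /srt ?h // swpl swpr; case: ifP => //; lia.
Qed.

Lemma srtC i j v : (i.+1 < j) || (j.+1 < i) -> srt i (srt j v) = srt j (srt i v).
Proof.
move=> h.
have a1 u : swp i u j = u j by rewrite swpD //; lia.
have a2 u : swp i u j.+1 = u j.+1 by rewrite swpD //; lia.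
have a3 u : swp j u i = u i by rewrite swpD //; lia.
have a4 u : swp j u i.+1 = u i.+1 by rewrite swpD //; lia.
rewrite /srt; case hj: (v j < v j.+1); case hi: (v i < v i.+1);
  rewrite ?(a1, a2, a3, a4) ?hi ?hj //.
exact: swpC.
Qed.

Lemma srt_braid i v :
  srt i (srt i.+1 (srt i v)) = srt i.+1 (srt i (srt i.+1 v)).
Proof.
have a1 (u : nat -> nat) : swp i u i.+2 = u i.+2 by rewrite swpD //; lia.
have a2 (u : nat -> nat) : swp i.+1 u i = u i by rewrite swpD //; lia.
rewrite /srt.
case h12: (v i < v i.+1); case h23: (v i.+1 < v i.+2); case h13: (v i < v i.+2);
  try lia;
  repeat (rewrite ?(a1, a2, swpl, swpr) ?h12 ?h23 ?h13;
     try (case: ifP; rewrite ?(a1, a2, swpl, swpr) => ?; try lia));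
  rewrite ?(swpK, swp_braid) //; lia.
Qed.

(** * Drops *)

(* The number of letters of w that do not change v when they sort, and such that
   replacing the sorting step by a swap leads to a result satisfying Phi. *)
Fixpoint cnt (Phi : (nat -> nat) -> bool) w v : nat :=
  if w is i :: w' then
    if v i < v i.+1 then cnt Phi w' (swp i v)
    else Phi (run w' (swp i v)) + cnt Phi w' v
  else 0.

Lemma cnt_cat Phi (a b : seq nat) v :
  cnt Phi (a ++ b) v = cnt (Phi \o run b) a v + cnt Phi b (run a v).
Proof.
elim: a v => //= i a IH v; rewrite /srt; case: ifP => h; rewrite IH //.
by rewrite addnA run_cat.
Qed.

(** If the first [i] sorts, the second one is a drop and swapping there restores [v]; if it does
    not, swapping and then sorting gives back [v]. In both cases the extra letter contributes
    [Phi v], the outcome with both letters deleted. Injectivity excludes ties. *)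
Lemma cnt_tri Phi i v : injective v ->
  cnt Phi [:: i; i] v = Phi v + cnt Phi [:: i] v.
Proof.
move=> vi; have h0 := vi i i.+1.
rewrite /= swpl swpr /srt swpl swpr swpK.
case: (ltngtP (v i) (v i.+1)) => h; rewrite ?h ?ltnn //=; lia.
Qed.

Lemma cntC Phi i j v : (i.+1 < j) || (j.+1 < i) ->
  cnt Phi [:: i; j] v = cnt Phi [:: j; i] v.
Proof.
move=> h.
have a1 u : swp i u j = u j by rewrite swpD //; lia.
have a2 u : swp i u j.+1 = u j.+1 by rewrite swpD //; lia.
have a3 u : swp j u i = u i by rewrite swpD //; lia.
have a4 u : swp j u i.+1 = u i.+1 by rewrite swpD //; lia.
rewrite /= /srt ?(a1, a2, a3, a4); case hj: (v j < v j.+1);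
case hi: (v i < v i.+1); rewrite ?(a1, a2, a3, a4) ?hi ?hj ?(swpC _ h) //; lia.
Qed.

(** A finite check over the relative orders of three values, distinct by injectivity. *)
Lemma cnt_braid Phi i v : injective v ->
  cnt Phi [:: i; i.+1; i] v = cnt Phi [:: i.+1; i; i.+1] v.
Proof.
move=> vi; have h1 := vi i i.+1; have h2 := vi i.+1 i.+2; have h3 := vi i i.+2.
have a1 (u : nat -> nat) : swp i u i.+2 = u i.+2 by rewrite swpD //; lia.
have a2 (u : nat -> nat) : swp i.+1 u i = u i by rewrite swpD //; lia.
rewrite /= /srt.
case h12: (v i < v i.+1); case h23: (v i.+1 < v i.+2); case h13: (v i < v i.+2);
  try lia;
  repeat (rewrite ?(a1, a2, swpl, swpr) ?h12 ?h23 ?h13; 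
     try (case: ifP; rewrite ?(a1, a2, swpl, swpr) => ?; try lia));
  rewrite ?(swpK, swp_braid) ?addn0; try lia.
Qed.

(** * Thresholds and prefix counts *)

Definition gr i S := if S i && ~~ S i.+1 then swp i S else S.

Lemma swp_const (T' : Type) i (S : nat -> T') : S i = S i.+1 -> swp i S = S.
Proof. by move=> h; apply: funext => z; rewrite /swp; case: eqP => [->//|_]; case: eqP => [->|]. Qed.

Lemma thr_srt k i v : thr k (srt i v) = gr i (thr k v).
Proof.
rewrite /srt /gr; case: ifP => h.
  rewrite thr_swp; case: ifP => // h'; apply: swp_const.
  by move: h'; rewrite /thr; lia.
by case: ifP => //; rewrite /thr; lia.
Qed.

(** The height function of a threshold. A sorting step acts on it by a max-plus rule ([N_gr]), a
    swap at a drop by a min-plus rule ([N_drop]). *)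
Definition N S t := \sum_(1 <= z < t.+1) (S z : nat).

Lemma N0 S : N S 0 = 0. Proof. by rewrite /N big_geq. Qed.

Lemma NS S t : N S t.+1 = N S t + S t.+1.
Proof. by rewrite /N big_nat_recr. Qed.

Lemma N_swp i S t : 0 < i ->
  N (swp i S) t = if t == i then N S i.-1 + S i.+1 else N S t.
Proof.
move=> i0; have lo u : u < i -> N (swp i S) u = N S u.
  by move=> ui; apply: eq_big_nat => z /andP[_ zu]; rewrite swpD //; lia.
have mid : N (swp i S) i = N S i.-1 + S i.+1.
  by case: i i0 lo => // i _ lo; rewrite NS lo // swpl.
have hi e : N (swp i S) (i.+1 + e) = N S (i.+1 + e).
  elim: e => [|e IH]; rewrite ?addn0 ?addnS NS.
    rewrite mid swpr NS; case: i i0 {lo mid} => // i _ /=; rewrite NS; lia.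
  by rewrite IH NS swpD //; lia.
case: eqP => [->//|ne]; case: (ltnP t i) => ti; first exact: lo.
have -> : t = i.+1 + (t - i.+1) by lia.
exact: hi.
Qed.

(** Sorting makes the height at [i] as small as its neighbours permit: heights are monotone, and
    they grow by at most 1 per position. *)
Lemma N_gr i S t : 0 < i ->
  N (gr i S) t = if t == i then maxn (N S i.-1) (N S i.+1).-1 else N S t.
Proof.
case: i => // i _; rewrite /gr NS [N S i.+1]NS /=; case: ifP => h.
  rewrite N_swp //=; case: eqP => // _; move: h.
  by case: (S i.+1); case: (S i.+2) => //= _; lia.
case: eqP => // ->; rewrite NS; move: h.
by case: (S i.+1); case: (S i.+2) => //= _; lia.
Qed.

(** The mirror image of [N_gr]: undoing a sorted pair makes the height at [i] as large as its
    neighbours permit. *)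
Lemma N_drop k i v t : 0 < i -> v i.+1 <= v i ->
  N (thr k (swp i v)) t = if t == i
    then minn (N (thr k v) i.-1).+1 (N (thr k v) i.+1) else N (thr k v) t.
Proof.
case: i => // i _ h; rewrite thr_swp N_swp //= !NS; case: eqP => // _.
by have : v i.+1 <= k -> v i.+2 <= k; rewrite /thr; lia.
Qed.

Lemma N_id k t : N (thr k id) t = minn k t.
Proof. by elim: t => [|t IH]; rewrite ?N0 ?NS ?IH /thr; lia. Qed.

(** * Budgeted paths *)

(* At each letter i of w one may either stay, or, if S i holds and S i.+1 does
   not, swap them and pay the weight of the letter; reach holds if T can be
   attained from S at a total cost of at most c. These are the tropical paths that
   the propagation of weights minimizes over. *)
Fixpoint reach T w g S c : Prop :=
  if w is i :: w' then
    reach T w' (behead g) S c \/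
    S i && ~~ S i.+1 /\ head 0 g <= c /\
    reach T w' (behead g) (swp i S) (c - head 0 g)
  else S = T.

Lemma reach_mono T w g S c c' : c <= c' -> reach T w g S c -> reach T w g S c'.
Proof.
elim: w g S c c' => //= i w IH g S c c' cc [h|[h1 [h2 h]]].
  by left; apply: IH h.
by right; split=> //; split; [lia | apply: IH h; lia].
Qed.

Ltac reach_hyp :=
  repeat match goal with
  | H : _ \/ _ |- _ => destruct H as [H|H]
  | H : _ /\ _ |- _ => let H1 := fresh in let H2 := fresh in destruct H as [H1 H2]
  | H : is_true false |- _ => discriminate H
  end.

Ltac reach_goal :=
  solve [ (match goal with H : reach _ _ _ _ _ |- _ => apply: reach_mono H; lia end)
        | left; reach_goal
        | right; split; [done | split; [lia | reach_goal]] ].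

(** Either letter may carry the swap, and not both, since after one swap the condition on [S] fails;
    so only the cheaper weight matters. *)
Lemma reach_tri T i a b w g S c :
  reach T (i :: i :: w) (a :: b :: g) S c <->
  reach T (i :: w) (minn a b :: g) S c.
Proof.
rewrite /= !swpl !swpr; case s1: (S i); case s2: (S i.+1) => /=; 
  case: (leqP a b) => ab; split=> h; reach_hyp; reach_goal.
Qed.

Lemma reachC T i j a b w g S c : (i.+1 < j) || (j.+1 < i) ->
  reach T (i :: j :: w) (a :: b :: g) S c <->
  reach T (j :: i :: w) (b :: a :: g) S c.
Proof.
move=> h.
have a1 (u : nat -> bool) : swp i u j = u j by rewrite swpD //; lia.
have a2 (u : nat -> bool) : swp i u j.+1 = u j.+1 by rewrite swpD //; lia.
have a3 (u : nat -> bool) : swp j u i = u i by rewrite swpD //; lia.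
have a4 (u : nat -> bool) : swp j u i.+1 = u i.+1 by rewrite swpD //; lia.
rewrite /= !(a1, a2, a3, a4) (swpC _ h).
case s1: (S i); case s2: (S i.+1); case s3: (S j); case s4: (S j.+1) => /=;
  split=> h'; reach_hyp; reach_goal.
Qed.

(** The tropical braid relation. From the pattern 1 0 0 the two other patterns cost [min(a, e)] and
    [a + f], from 1 1 0 they cost [f] and [f + e], through either word. These equations determine
    the new weights. *)
Lemma reach_braid1 T i a f e w g S c :
  reach T (i :: i.+1 :: i :: w) [:: a, f, e & g] S c <->
  reach T (i.+1 :: i :: i.+1 :: w)
    [:: f + e - minn a e, minn a e, a + f - minn a e & g] S c.
Proof.
have a1 (u : nat -> bool) : swp i u i.+2 = u i.+2 by rewrite swpD //; lia.
have a2 (u : nat -> bool) : swp i.+1 u i = u i by rewrite swpD //; lia.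
rewrite /= !(a1, a2, swpl, swpr).
case s1: (S i); case s2: (S i.+1); case s3: (S i.+2) => /=;
  case: (leqP a e) => ab; split=> h; reach_hyp; reach_goal.
Qed.

Lemma reach_braid2 T i a f e w g S c :
  reach T (i.+1 :: i :: i.+1 :: w) [:: a, f, e & g] S c <->
  reach T (i :: i.+1 :: i :: w)
    [:: f + e - minn a e, minn a e, a + f - minn a e & g] S c.
Proof.
have a1 (u : nat -> bool) : swp i u i.+2 = u i.+2 by rewrite swpD //; lia.
have a2 (u : nat -> bool) : swp i.+1 u i = u i by rewrite swpD //; lia.
rewrite /= !(a1, a2, swpl, swpr).
case s1: (S i); case s2: (S i.+1); case s3: (S i.+2) => /=;
  case: (leqP a e) => ab; split=> h; reach_hyp; reach_goal.
Qed.

Lemma reach_prefix T (x y y' gx gy gy' : seq nat) S c : size gx = size x ->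
  (forall S' c', reach T y gy S' c' <-> reach T y' gy' S' c') ->
  reach T (x ++ y) (gx ++ gy) S c <-> reach T (x ++ y') (gx ++ gy') S c.
Proof.
move=> + h; elim: x gx S c => [|i x IH] [|a gx] S c //= [e].
by rewrite !IH.
Qed.

(** * Moves *)

Lemma split2 (w : seq nat) m : m + 2 <= size w ->
  w = take m w ++ [:: nth 0 w m; nth 0 w m.+1] ++ drop (m + 2) w.
Proof.
move=> h; rewrite -[LHS](cat_take_drop m); congr (_ ++ _).
rewrite (drop_nth 0); last lia.
by rewrite (drop_nth 0 (_ : m.+1 < _)) ?addn2 //; lia.
Qed.

Lemma split3 (w : seq nat) m : m + 3 <= size w ->
  w = take m w ++ [:: nth 0 w m; nth 0 w m.+1; nth 0 w m.+2] ++ drop (m + 3) w.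
Proof.
move=> h; rewrite -[LHS](cat_take_drop m); congr (_ ++ _).
rewrite (drop_nth 0); last lia.
rewrite (drop_nth 0 (_ : m.+1 < _)); last lia.
by rewrite (drop_nth 0 (_ : m.+2 < _)) ?addn3 //; lia.
Qed.

Lemma move_run mv w v : move_ok mv w -> run (move_word mv w) v = run w v.
Proof.
case: mv => -[] m; rewrite /move_ok /move_word /replace /= => /andP[h hw].
- rewrite [in RHS](split2 h) !run_cat /=; congr run.
  by rewrite -(eqP hw) srt_idem.
- rewrite [in RHS](split2 h) !run_cat /=; congr run.
  by rewrite srtC //; lia.
rewrite [in RHS](split3 h) !run_cat /=; congr run.
case/andP: hw => /eqP -> /orP[] /eqP <-; by rewrite srt_braid.
Qed.

Lemma move_reach mv w T g S c : move_ok mv w -> size g = size w ->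
  reach T (move_word mv w) (move_weights mv g) S c <-> reach T w g S c.
Proof.
case: mv => -[] m; rewrite /move_ok /move_word /move_weights /replace /=;
  move=> /andP[h hw] gw; have hg : size (take m g) = size (take m w)
    by rewrite !size_take gw.
- have h' : m + 2 <= size g by rewrite gw.
  rewrite [in X in _ <-> X](split2 h) [in X in _ <-> X](split2 h').
  apply: reach_prefix => // S' c'.
  by rewrite -(eqP hw); symmetry; exact: reach_tri.
- have h' : m + 2 <= size g by rewrite gw.
  rewrite [in X in _ <-> X](split2 h) [in X in _ <-> X](split2 h').
  by apply: reach_prefix => // S' c'; apply: reachC; lia.
have h' : m + 3 <= size g by rewrite gw.
rewrite [in X in _ <-> X](split3 h) [in X in _ <-> X](split3 h').
apply: reach_prefix => // S' c'; symmetry.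
case/andP: hw => /eqP -> /orP[] /eqP <-.
  exact: reach_braid1.
exact: reach_braid2.
Qed.

(** By [cnt_cat] only the letters at the vertex matter, with the suffix absorbed into the predicate
    as [Phi \o run y]. The term left over by [cnt_tri] is the word with both letters deleted. *)
Lemma move_cnt Phi mv w v : injective v -> move_ok mv w ->
  cnt Phi w v = cnt Phi (move_word mv w) v +
    is_trivalent mv.1 * Phi (run (take mv.2 w ++ drop mv.2.+2 w) v).
Proof.
move=> vi; have ri x : injective (run x v) by exact: run_inj.
case: mv => -[] m; rewrite /move_ok /move_word /replace => /= /andP[h hw].
- rewrite [in LHS](split2 h) -(eqP hw) mul1n addn2.
  move: (nth 0 w m) (take m w) (drop m.+2 w) => i a y {hw h w}.
  have E : run ([:: i; i] ++ y) = run ([:: i] ++ y).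
    by apply: funext => u /=; rewrite srt_idem.
  rewrite !(cnt_cat _ a) E (cnt_cat _ [:: i; i]) cnt_tri //.
  rewrite -[i :: y]cat1s (cnt_cat _ [:: i] y).
  have -> : run [:: i; i] (run a v) = run [:: i] (run a v).
    by rewrite /= srt_idem.
  rewrite [run (a ++ y) v]run_cat -[(_ \o _) (run a v)]/(Phi (run y (run a v))).
  by rewrite -!addnA; congr (_ + _); rewrite addnC -addnA.
- rewrite mul0n addn0 [in LHS](split2 h).
  move: (nth 0 w m) (nth 0 w m.+1) hw (take m w) (drop (m + 2) w) => i j ij a y.
  have ij' : (i.+1 < j) || (j.+1 < i) by lia.
  have E : run ([:: i; j] ++ y) = run ([:: j; i] ++ y).
    by apply: funext => u /=; rewrite (srtC _ ij').
  rewrite !(cnt_cat _ a) E (cnt_cat _ [:: i; j]) cntC //.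
  rewrite -[[:: j, i & y]]/([:: j; i] ++ y) (cnt_cat _ [:: j; i] y).
  have -> : run [:: i; j] (run a v) = run [:: j; i] (run a v).
    by rewrite /= (srtC _ ij').
  by [].
rewrite mul0n addn0 [in LHS](split3 h).
have [e ij] := andP hw; rewrite (eqP e).
move: (nth 0 w m) (nth 0 w m.+1) ij (take m w) (drop (m + 3) w) => i j ij a y.
have B u : run [:: i; j; i] u = run [:: j; i; j] u.
  by case/orP: ij => /eqP <-; rewrite /= srt_braid.
have C Q u : injective u -> cnt Q [:: i; j; i] u = cnt Q [:: j; i; j] u.
  by move=> ui; case/orP: ij => /eqP <-; rewrite cnt_braid.
have E : run ([:: i; j; i] ++ y) = run ([:: j; i; j] ++ y).
  by apply: funext => u; rewrite !run_cat B.
by rewrite !(cnt_cat _ a) E (cnt_cat _ [:: i; j; i]) C //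
  -[[:: j, i, j & y]]/([:: j; i; j] ++ y) (cnt_cat _ [:: j; i; j] y) B.
Qed.

(** * Reduced words *)

(** Satisfied by reduced words ([reduced_asc]). Such a word has no drops, and its only path to the
    sorted end is the sorting itself. *)
Fixpoint asc w v : bool :=
  if w is i :: w' then (v i < v i.+1) && asc w' (swp i v) else true.

(* The total weight of the letters that exchange a value at most k with a value
   above k. *)
Fixpoint lsum k w g v : nat :=
  if w is i :: w' then
    (v i <= k < v i.+1) * head 0 g + lsum k w' (behead g) (swp i v)
  else 0.

Lemma asc_run w v : asc w v -> run w v = pure w v.
Proof. by elim: w v => //= i w IH v /andP[h /IH]; rewrite /srt h. Qed.

Lemma asc_cnt Phi w v : asc w v -> cnt Phi w v = 0.
Proof. by elim: w v => //= i w IH v /andP[h /IH]; rewrite h. Qed.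

(** Heights dominate those of [v] along the path, while the end has the least heights; so by
    induction the path agrees with the sorting after the first letter. Had it skipped a letter that
    lowers the height of [v], it would have been below [v] before that letter. *)
Lemma asc_reach k w g v S c : all (ltn 0) w -> asc w v ->
  (forall t, N (thr k v) t <= N S t) ->
  reach (thr k (run w v)) w g S c -> S = thr k v /\ lsum k w g v <= c.
Proof.
elim: w g v S c => [|i w IH] g v S c //= /andP[i0 w0] /andP[h a] NN.
rewrite {1 2}/srt h.
have Nv' t : N (thr k (swp i v)) t = N (gr i (thr k v)) t.
  by rewrite -thr_srt /srt h.
case=> [r|[/andP[s1 s2] [cg r]]].
  have [|SE le] := IH _ _ _ _ w0 a _ r.
    move=> t; apply: leq_trans (NN t); rewrite Nv' N_gr //.
    case: eqP => // ->; case: i i0 {h a r Nv' NN} => // i _.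
    by rewrite !NS /=; lia.
  have nk : (v i <= k < v i.+1) = false.
    apply/negP => hk; have := NN i; rewrite SE Nv' N_gr // eqxx.
    case: i i0 h a r Nv' NN SE hk {le} => // i _ h a r _ _ _ hk.
    by rewrite !NS /= /thr; lia.
  rewrite nk mul0n; split=> //; rewrite SE thr_swp; apply: swp_const.
  by move: nk; rewrite /thr; lia.
have [|SE le] := IH _ _ _ _ w0 a _ r.
  move=> t; rewrite Nv' N_gr //.
  have -> : N (swp i S) t = N (gr i S) t by rewrite /gr s1 s2.
  rewrite N_gr //; case: eqP => // _; have := NN i.-1; have := NN i.+1; lia.
have : thr k (swp i v) i = S i.+1 by rewrite -SE swpl.
have : thr k (swp i v) i.+1 = S i by rewrite -SE swpr.
rewrite thr_swp swpl swpr s1 (negPf s2) /thr => k1 k2.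
split; last by move: (negbT k2) k1 cg le; lia.
by rewrite -[S](swpK i) SE thr_swp swpK.
Qed.

Lemma reach_asc k w g v c : asc w v -> lsum k w g v <= c ->
  reach (thr k (run w v)) w g (thr k v) c.
Proof.
elim: w g v c => [|i w IH] g v c //= /andP[h a]; rewrite /srt h.
case: (boolP (v i <= k < v i.+1)) => hk /=; rewrite ?mul1n ?mul0n => le.
  right; rewrite /thr; split; first lia.
  split; first lia.
  by have := IH (behead g) _ (c - head 0 g) a; rewrite thr_swp; apply; lia.
left; have <- : thr k (swp i v) = thr k v; last exact: IH.
by rewrite thr_swp; apply: swp_const; move: hk; rewrite /thr; lia.
Qed.

Definition letters d : pred nat := fun i => 0 < i < d.

Lemma N_step S t : N S t <= N S t.+1 <= (N S t).+1.
Proof. by rewrite NS; case: (S t.+1) => /=; lia. Qed.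

Lemma N_mono S t u : t <= u -> N S t <= N S u <= N S t + (u - t).
Proof.
move=> h; rewrite -(subnKC h) addKn.
by elim: (u - t) => [|e IH]; [rewrite !addn0 leqnn|have := N_step S (t + e); rewrite !addnS; lia].
Qed.

Lemma N_srt k i v t : 0 < i ->
  N (thr k (srt i v)) t = if t == i
    then maxn (N (thr k v) i.-1) (N (thr k v) i.+1).-1 else N (thr k v) t.
Proof. by move=> i0; rewrite thr_srt N_gr. Qed.

Lemma N_run d k w v : all (letters d) w ->
  N (thr k (run w v)) d = N (thr k v) d /\
  forall t, N (thr k (run w v)) t <= N (thr k v) t.
Proof.
elim: w v => //= i w IH v /andP[hi /IH{}IH]; have i0 : 0 < i by case/andP: hi.
have [e le] := IH (srt i v); split.
  by rewrite e N_srt //; case: eqP => // di; move: hi; rewrite /letters di ltnn andbF.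
move=> t; apply: leq_trans (le t) _; rewrite N_srt //; case: eqP => // ->.
case: i i0 {hi e le} => // i _ /=.
by have := N_step (thr k v) i; have := N_step (thr k v) i.+1; lia.
Qed.

(** * How many blocks are needed to sort a threshold *)

Definition rho_word d (b : bool) := if b then iota 1 d.-1 else rev (iota 1 d.-1).

Definition blocks d (bs : seq bool) := flatten [seq rho_word d b | b <- bs].

Lemma letters_rho d b : all (letters d) (rho_word d b).
Proof.
rewrite /rho_word; have h : all (letters d) (iota 1 d.-1).
  by apply/allP => i; rewrite mem_iota /letters; lia.
by case: b; rewrite ?all_rev.
Qed.

Lemma letters_blocks d bs : all (letters d) (blocks d bs).
Proof. by elim: bs => //= b bs IH; rewrite /blocks /= all_cat letters_rho. Qed.

(** When the letter [t] is read, the height at [t + 1] is still the old one, and the height at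
    [t - 1] is already at most the old height at [t] minus 1; so the second term of the maximum in
    [N_srt] wins. *)
Lemma N_asc_pass k n v t : t <= n ->
  N (thr k (run (iota 1 n) v)) t <= (N (thr k v) t.+1).-1.
Proof.
have out m u : m < u -> N (thr k (run (iota 1 m) v)) u = N (thr k v) u.
  elim: m => // m IH mu; rewrite -[m.+1]addn1 iotaD run_cat /= N_srt; last lia.
  by case: eqP; [lia|rewrite IH //; lia].
elim: n t => [|n IH] t tn.
  by rewrite (_ : t = 0) ?N0 //; lia.
rewrite -[X in iota _ X]addn1 iotaD run_cat /= N_srt; last lia.
case: eqP => [->|ne]; last by apply: IH; lia.
rewrite add1n (out n n.+2) //=; have := IH n (leqnn n); have := N_step (thr k v) n.+1.
lia.
Qed.

(** Here the height at [t - 1] is still the old one and the height at [t + 1] is already updated.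
    The term [t - (d - k)] is the height of the sorted state, which no pass can undercut. *)
Lemma N_desc_pass d k v : k <= d -> N (thr k v) d = k ->
  forall n t, n < d -> d - n <= t < d ->
  N (thr k (run (rev (iota (d - n) n)) v)) t <=
  maxn (N (thr k v) t.-1) (t - (d - k)).
Proof.
move=> kd Nd.
have out n u : n < d -> (u < d - n) || (d <= u) ->
    N (thr k (run (rev (iota (d - n) n)) v)) u = N (thr k v) u.
  elim: n => // n IH nd hu.
  rewrite /= rev_cons -cats1 run_cat /= N_srt; last lia.
  rewrite (_ : (d - n.+1).+1 = d - n); last lia.
  by case: eqP; [lia|rewrite IH //; lia].
elim=> [|n IH] t nd ht; first lia.
rewrite /= rev_cons -cats1 run_cat /= N_srt; last lia.
rewrite (_ : (d - n.+1).+1 = d - n); last lia.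
case: eqP => [->|ne]; last by apply: IH; lia.
rewrite out; [|lia|lia].
case: n IH nd {ht} => [|n] IH nd.
  rewrite out; [|lia|lia].
  by rewrite subn0 Nd; lia.
have := IH (d - n.+1); rewrite (_ : d - n.+2 = (d - n.+1).-1); last lia.
have := N_step (thr k v) (d - n.+1).-2; rewrite prednK; lia.
Qed.

(* a and b count the increasing and the decreasing blocks read so far. *)
Definition bound d k a b t := maxn (minn (t - b) (k - a)) (t - (d - k)).

(** [m] counts the blocks still credited. The split into [a] and [b] is existential because a drop
    may cancel a block of either kind. *)
Definition bounded d k m v :=
  exists a b, [/\ m <= a + b, N (thr k v) d = k &
    forall t, t <= d -> N (thr k v) t <= bound d k a b t].

Lemma bound_asc d k a b t : (bound d k a b t.+1).-1 <= bound d k a.+1 b t.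
Proof.
rewrite /bound -subn1 leq_subLR add1n geq_max; apply/andP; split; last first.
  by apply: leq_trans (_ : (t - (d - k)).+1 <= _); [lia|rewrite ltnS leq_maxr].
apply: leq_trans (_ : (minn (t - b) (k - a.+1)).+1 <= _); last by rewrite ltnS leq_maxl.
by rewrite -minnSS leq_min !geq_min; apply/andP; split; apply/orP; [left|right]; lia.
Qed.

Lemma bound_desc d k a b t : bound d k a b t.-1 <= bound d k a b.+1 t.
Proof.
rewrite /bound geq_max (_ : t.-1 - b = t - b.+1) ?leq_maxl; last lia.
by rewrite leq_max; apply/orP; right; lia.
Qed.

Lemma bounded_rho d k m b v : 0 < k < d -> bounded d k m v ->
  bounded d k m.+1 (run (rho_word d b) v).
Proof.
move=> kd [a [a' [le Nd h]]].
have [Nd' _] := N_run k v (letters_rho d b).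
have top x x' t : t <= d -> d <= t -> N (thr k v) d <= bound d k x x' t.
  by move=> td dt; rewrite Nd /bound leq_max; apply/orP; right; lia.
case: b Nd' => Nd'; [exists a.+1, a'|exists a, a'.+1]; split; rewrite ?Nd' //; try lia.
  move=> t td; case: (ltnP t d) => td'; last first.
    by rewrite (_ : N _ t = N (thr k v) d) ?top // -Nd'; congr N; lia.
  apply: leq_trans (bound_asc d k a a' t); have tp : t <= d.-1 by lia.
  apply: leq_trans (N_asc_pass k v tp) _; move: (h _ td').
  by move: (N _ _) (bound _ _ _ _ _) => x y; lia.
move=> t td; case: (ltnP t d) => td'; last first.
  by rewrite (_ : N _ t = N (thr k v) d) ?top // -Nd'; congr N; lia.
case: (posnP t) => [->|t0]; first by rewrite N0.
have kd' : k <= d by lia.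
have n1 : d.-1 < d by lia.
have t1 : d - d.-1 <= t < d by lia.
have := N_desc_pass kd' Nd n1 t1; rewrite (_ : d - d.-1 = 1); last lia.
move=> le'; apply: leq_trans le' _; rewrite geq_max {2}/bound leq_maxr andbT.
by apply: leq_trans (bound_desc d k a a' t); apply: h; lia.
Qed.

Lemma bounded_run d k m w v : all (letters d) w -> bounded d k m v ->
  bounded d k m (run w v).
Proof.
move=> lw [a [b [le Nd h]]]; have [Nd' le'] := N_run k v lw.
by exists a, b; split; rewrite ?Nd' // => t td; apply: leq_trans (le' t) (h t td).
Qed.

Lemma bounded_blocks d k m bs v : 0 < k < d -> bounded d k m v ->
  bounded d k (m + size bs) (run (blocks d bs) v).
Proof.
move=> kd; elim: bs m v => [|b bs IH] m v h; first by rewrite addn0.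
by rewrite /blocks /= run_cat addnS -addSn; apply: IH; exact: bounded_rho.
Qed.

Definition sortd d k v := all (fun t => N (thr k v) t <= t - (d - k)) (iota 0 d.+1).

Lemma sortdP d k v :
  reflect (forall t, t <= d -> N (thr k v) t <= t - (d - k)) (sortd d k v).
Proof.
by apply: (iffP allP) => h t ht; apply: h; move: ht; rewrite mem_iota; lia.
Qed.

(** As a + b >= d - 1 = k + (d - k) - 1, either a >= k or b >= d - k, and either one makes the first
    term of [bound] harmless. *)
Lemma bounded_sortd d k m v : 0 < k < d -> d.-1 <= m -> bounded d k m v ->
  sortd d k v.
Proof.
move=> kd dm [a [b [le _ h]]]; apply/sortdP => t td.
by apply: leq_trans (h t td) _; rewrite /bound; lia.
Qed.

Lemma bounded_id d k : 0 < k < d -> bounded d k 0 id.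
Proof.
move=> kd; exists 0, 0; split=> // [|t td]; rewrite N_id /bound; lia.
Qed.

Lemma sortd_run d k w v : all (letters d) w -> sortd d k v -> sortd d k (run w v).
Proof.
move=> lw /sortdP h; apply/sortdP => t td.
by apply: leq_trans (h t td); case: (N_run k v lw).
Qed.

Lemma bound_drop1 d k a b i : a < k -> b < d - k -> 0 < i <= b ->
  bound d k a b i.+1 <= bound d k a b.-1 i.
Proof.
rewrite /bound => ak bk ib.
have [-> ->] : i.+1 - (d - k) = 0 /\ i - (d - k) = 0 by lia.
by rewrite !maxn0 (_ : i.+1 - b = i - b.-1) //; lia.
Qed.

Lemma bound_drop2 d k a b i : a < k -> b < d - k -> b < i -> i < d -> k <= d ->
  minn (bound d k a b i.-1).+1 (bound d k a b i.+1) <= bound d k a.-1 b i.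
Proof.
rewrite /bound => ak bk bi id kd; case: (leqP i (d - k)) => ik.
  have [-> ->] : i.-1 - (d - k) = 0 /\ i - (d - k) = 0 by lia.
  rewrite !maxn0 geq_min; apply/orP.
  by case: (leqP (k - a) (i.-1 - b)) => h'; [right|left]; lia.
have -> : i.+1 - (d - k) = (i.-1 - (d - k)).+2 by lia.
have -> : i - (d - k) = (i.-1 - (d - k)).+1 by lia.
rewrite geq_min; apply/orP; case: (leqP (k - a) (i.-1 - (d - k))) => h.
  left; lia.
case: (leqP (k - a) (i.-1 - b)) => h'; [right|left]; lia.
Qed.

Lemma bound_mono d k a b a' b' t : a' <= a -> b' <= b ->
  bound d k a b t <= bound d k a' b' t.
Proof.
move=> aa bb; rewrite /bound geq_max !leq_max leqnn orbT andbT; apply/orP; left.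
by rewrite leq_min !geq_min !leq_sub2l // orbT.
Qed.

(** By [N_drop] a swap against the order raises a single height, and only as far as its neighbours
    allow. For i <= b this is absorbed by lowering [b] by one, for i > b by lowering [a]. That the
    threshold is unsorted gives a < k and b < d - k. *)
Lemma bounded_drop d k m i v : 0 < k < d -> letters d i -> v i.+1 <= v i ->
  bounded d k m v -> ~~ sortd d k v -> bounded d k m.-1 (swp i v).
Proof.
move=> kd /andP[i0 id] dr [a [b [le Nd h]]] ns.
have ak : a < k.
  rewrite ltnNge; apply/negP => hk; case/negP: ns; apply/sortdP => t td.
  by apply: leq_trans (h t td) _; rewrite /bound; lia.
have bk : b < d - k.
  rewrite ltnNge; apply/negP => hk; case/negP: ns; apply/sortdP => t td.
  by apply: leq_trans (h t td) _; rewrite /bound; lia.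
have Nd' : N (thr k (swp i v)) d = k by rewrite N_drop //; case: eqP; lia.
have h1 : N (thr k v) i.-1 <= bound d k a b i.-1 by apply: h; lia.
have h2 : N (thr k v) i.+1 <= bound d k a b i.+1 by apply: h.
case: (leqP i b) => ib.
  exists a, b.-1; split=> // [|t td]; first lia.
  rewrite N_drop //; case: eqP => [->|_]; last first.
    by apply: leq_trans (h t td) _; apply: bound_mono => //; lia.
  rewrite geq_min; apply/orP; right; apply: leq_trans h2 _.
  by apply: bound_drop1 => //; lia.
exists a.-1, b; split=> // [|t td]; first lia.
rewrite N_drop //; case: eqP => [->|_]; last first.
  by apply: leq_trans (h t td) _; apply: bound_mono => //; lia.
apply: leq_trans (_ : minn (bound d k a b i.-1).+1 (bound d k a b i.+1) <= _).
  by rewrite leq_min !geq_min h2 ltnS h1 orbT.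
by apply: bound_drop2 => //; lia.
Qed.

Lemma flatten_split (T : eqType) (ss : seq (seq T)) (x y : seq T) (i : T) :
  flatten ss = x ++ i :: y ->
  exists ss1 s ss2 r1 r2, [/\ ss = ss1 ++ s :: ss2, s = r1 ++ i :: r2,
    x = flatten ss1 ++ r1 & y = r2 ++ flatten ss2].
Proof.
elim: ss x => [|s ss IH] x /=; first by case: x.
case: (ltnP (size x) (size s)) => h e.
  exists [::], s, ss, x, (drop (size x).+1 s).
  have tx : take (size x) s = x.
    by rewrite -(takel_cat (flatten ss)) ?e ?take_size_cat //; lia.
  have dx : drop (size x) s ++ flatten ss = i :: y.
    by have := drop_cat (size x) s (flatten ss); rewrite h e drop_size_cat.
  move: dx; case E: (drop (size x) s) => [|i' r].
    by move: (congr1 size E); rewrite size_drop /=; lia.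
  case=> <- <-; have -> : drop (size x).+1 s = r.
    by rewrite -add1n -drop_drop E /= drop0.
  by split=> //; rewrite -{1}(cat_take_drop (size x) s) tx E.
have [x' xE] : exists x', x = s ++ x'.
  exists (drop (size s) x); rewrite -{1}(cat_take_drop (size s) x); congr (_ ++ _).
  have := congr1 (take (size s)) e; rewrite take_size_cat // takel_cat //.
move: e; rewrite xE -catA => /eqP; rewrite eqseq_cat // eqxx /= => /eqP /IH.
move=> [ss1 [s' [ss2 [r1 [r2 [-> -> -> ->]]]]]].
by exists (s :: ss1), (r1 ++ i :: r2), ss2, r1, r2; rewrite /= -catA.
Qed.

Lemma sortd_N d k v t : k <= d -> N (thr k v) d = k -> sortd d k v -> t <= d ->
  N (thr k v) t = t - (d - k).
Proof.
by move=> kd Nd /sortdP h td; have := h t td; have := N_mono (thr k v) td; lia.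
Qed.

Lemma N_run_id d k w : k <= d -> all (letters d) w -> N (thr k (run w id)) d = k.
Proof. by move=> kd lw; case: (N_run k id lw) => -> _; rewrite N_id; lia. Qed.

(** A defect of 1 in the height at [d - k] is invisible to all other letters: the maxima in [N_srt]
    at these letters equal the sorted heights. The letter [d - k] itself repairs it
    ([almost_sortd]). *)
Lemma swp_notin d k y v : all (letters d) y -> d - k \notin y -> letters d (d - k) ->
  k <= d -> (forall t, t <= d -> N (thr k v) t = t - (d - k) + (t == d - k)) ->
  forall t, t <= d -> N (thr k (run y v)) t = t - (d - k) + (t == d - k).
Proof.
elim: y v => //= i y IH v /andP[/andP[i0 id] ly] + dk kd h.
rewrite inE negb_or => /andP[ne ny]; apply: IH => // t td.
rewrite N_srt //; case: (t =P i) => [->|_]; last exact: h.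
by rewrite !h; [move: dk ne; rewrite /letters; lia|lia|lia].
Qed.

Lemma almost_sortd d k y v : all (letters d) y -> d - k \in y -> letters d (d - k) ->
  k <= d -> (forall t, t <= d -> N (thr k v) t = t - (d - k) + (t == d - k)) ->
  sortd d k (run y v).
Proof.
elim: y v => //= i y IH v /andP[/andP[i0 id] ly] + dk kd h; rewrite inE.
case: (eqVneq (d - k) i) => [e _|ne /= iy].
  apply: sortd_run => //; apply/sortdP => t td; rewrite N_srt //.
  case: eqP => [->|ne]; last by rewrite h //; lia.
  by rewrite !h; lia.
apply: IH => // t td.
rewrite N_srt //; case: (t =P i) => [->|_]; last exact: h.
by rewrite !h; [move: dk ne; rewrite /letters; lia|lia|lia].
Qed.

Section Top.
Variables (d : nat) (bs : seq bool).
Hypothesis size_bs : d < size bs.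

Lemma blocks_mem k b : 0 < k < d -> d - k \in rho_word d b.
Proof.
by move=> kd; rewrite /rho_word; case: b; rewrite ?mem_rev mem_iota; lia.
Qed.

Lemma blocks_split (x y : seq nat) i : blocks d bs = x ++ i :: y ->
  exists bs1 b bs2 r1 r2, [/\ bs = bs1 ++ b :: bs2, rho_word d b = r1 ++ i :: r2,
    x = blocks d bs1 ++ r1 & y = r2 ++ blocks d bs2].
Proof.
move=> /flatten_split[ss1 [s [ss2 [r1 [r2 [e sE -> ->]]]]]].
rewrite {s}sE in e; have [bs1 [b [bs2 [-> e1 e2 e3]]]] : exists bs1 b bs2,
    [/\ bs = bs1 ++ b :: bs2, [seq rho_word d b | b <- bs1] = ss1,
        rho_word d b = r1 ++ i :: r2 & [seq rho_word d b | b <- bs2] = ss2].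
  elim: (bs) ss1 e => [|b0 bs0 IH] [|s1 ss1] //= [].
    by move=> <- <-; exists [::], b0, bs0.
  move=> <- /IH[bs1 [b [bs2 [-> <- ? <-]]]].
  by exists (b0 :: bs1), b, bs2.
by exists bs1, b, bs2, r1, r2; rewrite /blocks e1 e3.
Qed.

Lemma sortd_blocks k : 0 < k < d -> sortd d k (run (blocks d bs) id).
Proof.
move=> kd; apply: (@bounded_sortd _ _ (0 + size bs)) => //; first lia.
by apply: bounded_blocks => //; exact: bounded_id.
Qed.

(** At least [d] whole blocks remain and suffice; what is left of the mutilated block cannot raise
    any height. *)
Lemma sortd_delete (x y : seq nat) i k : blocks d bs = x ++ i :: y -> 0 < k < d ->
  sortd d k (run (x ++ y) id).
Proof.
move=> e kd; have [bs1 [b [bs2 [r1 [r2 [bE rE -> ->]]]]]] := blocks_split e.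
have := letters_rho d b; rewrite rE all_cat /= => /and3P[l1 _ l2].
apply: (@bounded_sortd _ _ (0 + size bs1 + size bs2)) => //.
  by move: size_bs; rewrite bE size_cat /=; lia.
rewrite -catA !run_cat; apply: bounded_blocks => //.
apply: bounded_run => //; apply: bounded_run => //.
by apply: bounded_blocks => //; exact: bounded_id.
Qed.

(** Two regimes. If the threshold is sorted before the drop, only a swap at [d - k] creates a
    defect, and a later letter [d - k] repairs it. If it is not, fewer than [d - 1] blocks have been
    read, so a whole block follows; the drop loses its own block and at most one earlier, which
    leaves at least [d - 1]. *)
Lemma sortd_drop (x y : seq nat) i k : blocks d bs = x ++ i :: y -> 0 < k < d ->
  run x id i.+1 <= run x id i ->
  ~~ sortd d k (run y (swp i (run x id))) = (i == d - k) && (d - k \notin y).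
Proof.
move=> e kd; have := letters_blocks d bs; rewrite e all_cat /=.
case/and3P=> lx li ly dr; set v := run x id.
have dk : letters d (d - k) by rewrite /letters; lia.
have Nd : N (thr k v) d = k by apply: N_run_id => //; lia.
have [i0 _] := andP li.
have [bs1 [b [bs2 [r1 [r2 [bE rE xE yE]]]]]] := blocks_split e.
case: (boolP (sortd d k v)) => sv.
  have Nv t : t <= d -> N (thr k v) t = t - (d - k) by apply: sortd_N => //; lia.
  have Ns t : N (thr k (swp i v)) t = if t == i
      then minn (N (thr k v) i.-1).+1 (N (thr k v) i.+1) else N (thr k v) t.
    exact: N_drop.
  case: eqP => [ik|ik] /=; last first.
    apply: negbTE; rewrite negbK; apply: sortd_run => //; apply/sortdP => t td.
    rewrite Ns; case: eqP => [->|_]; last by rewrite Nv.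
    by rewrite !Nv; move: li; rewrite /letters; lia.
  have Nw t : t <= d -> N (thr k (swp i v)) t = t - (d - k) + (t == d - k).
    move=> td; rewrite Ns; case: eqP => [ti|ti]; rewrite !Nv; move: li;
    by rewrite /letters; lia.
  case: (boolP (_ \in y)) => iy /=.
    by apply: negbTE; rewrite negbK; apply: almost_sortd iy _ _ _ => //; lia.
  apply/negP => /sortdP /(_ (d - k)).
  by rewrite (swp_notin ly iy) //; lia.
have bv : bounded d k (size bs1) v.
  rewrite /v xE run_cat; have := letters_rho d b; rewrite rE all_cat => /andP[l1 _].
  apply: bounded_run => //; rewrite -[size bs1]add0n.
  by apply: bounded_blocks => //; exact: bounded_id.
have m1 : size bs1 < d.-1.
  by rewrite ltnNge; apply/negP => h; case/negP: sv; exact: bounded_sortd h bv.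
have sE : size bs = size bs1 + (size bs2).+1 by rewrite bE size_cat.
have -> : (d - k \notin y) = false.
  apply/negbTE; rewrite negbK yE mem_cat; apply/orP; right.
  case: (bs2) sE => [|b' bs'] /=; first lia.
  by rewrite /blocks /= mem_cat blocks_mem.
rewrite andbF; apply: negbTE; rewrite negbK yE run_cat.
apply: (@bounded_sortd _ _ ((size bs1).-1 + size bs2)) => //; first lia.
apply: bounded_blocks => //; apply: bounded_run.
  by have := letters_rho d b; rewrite rE all_cat /= => /and3P[].
exact: bounded_drop.
Qed.

Lemma cnt0 Phi w v :
  (forall x i y, w = x ++ i :: y -> run x v i.+1 <= run x v i ->
     Phi (run y (swp i (run x v))) = false) -> cnt Phi w v = 0.
Proof.
elim: w v => //= i w IH v h; have h0 := h [::] i w erefl.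
have h1 : cnt Phi w (srt i v) = 0.
  by apply: IH => x j y wE; apply: (h (i :: x) j y); rewrite wE.
move: h1; rewrite /srt; case: ltnP => // vi h1.
by rewrite h0 //= h1.
Qed.

Lemma last_split c w : c \in w -> exists x y, w = x ++ c :: y /\ c \notin y.
Proof.
elim: w => // i w IH; rewrite inE; case: (boolP (c \in w)) => [/IH[x [y [-> h]]] _|h].
  by exists (i :: x), y.
by rewrite orbF => /eqP ci; exists [::], w; rewrite -ci.
Qed.

(** By [sortd_drop] only the last letter [d - k] can count. It lies in the last block, so the
    threshold is sorted before it: the value in position [d - k] exceeds [k] and the next one does
    not, and the letter is indeed a drop. *)
Lemma cnt_top k : 0 < k < d ->
  cnt (fun v => ~~ sortd d k v) (blocks d bs) id = 1.
Proof.
move=> kd.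
have : d - k \in blocks d bs.
  by case: (bs) size_bs => // b bs' _; rewrite /blocks /= mem_cat blocks_mem.
move=> /last_split[x [y [e ny]]].
have H := fun x' y' i e' => @sortd_drop x' y' i k e' kd.
have [bs1 [b [bs2 [r1 [r2 [bE rE xE yE]]]]]] := blocks_split e.
have b2 : bs2 = [::].
  case: bs2 bE yE => // b' bs' _ yE; case/negP: ny.
  by rewrite yE mem_cat /blocks /= mem_cat blocks_mem ?orbT.
have sv : sortd d k (run x id).
  apply: (@bounded_sortd _ _ (size bs1)) => //.
    by move: size_bs; rewrite bE b2 size_cat /=; lia.
  rewrite xE run_cat; have := letters_rho d b; rewrite rE all_cat => /andP[l1 _].
  apply: bounded_run => //; rewrite -[size bs1]add0n.
  by apply: bounded_blocks => //; exact: bounded_id.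
have := letters_blocks d bs; rewrite e all_cat => /andP[lx _].
have Nv t : t <= d -> N (thr k (run x id)) t = t - (d - k).
  by apply: sortd_N => //; [lia | apply: N_run_id => //; lia].
have dr : run x id (d - k).+1 <= run x id (d - k).
  have := Nv (d - k).+1; rewrite NS Nv /thr; last lia.
  have := Nv (d - k).-1; have := Nv (d - k).
  have := NS (thr k (run x id)) (d - k).-1; rewrite prednK /thr; lia.
rewrite cnt_cat cnt0 /= => [|x' i y' xE' dr'].
  rewrite ltnNge dr /= H // eqxx ny /= cnt0 // => x' i y' yE' dr'.
  apply: negbTE; have := H (x ++ d - k :: x') y' i.
  have -> : run (x ++ d - k :: x') id = run x' (run x id).
    by rewrite run_cat /= {1}/srt ltnNge dr.
  move=> -> //; last by rewrite e yE' -catA.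
  rewrite negb_and; apply/orP; left; apply/eqP => ii; case/negP: ny.
  by rewrite yE' ii mem_cat mem_head orbT.
have := H x' (y' ++ d - k :: y) i; rewrite run_cat /= => -> //.
  by rewrite mem_cat mem_head orbT andbF.
by rewrite e xE' -catA.
Qed.

Lemma cnt_top2 k l : 0 < k < d -> 0 < l < d -> k != l ->
  cnt (fun v => ~~ sortd d k v && ~~ sortd d l v) (blocks d bs) id = 0.
Proof.
move=> kd ld kl; apply: cnt0 => x i y e dr.
rewrite (sortd_drop e) // (sortd_drop e) //.
by apply: negbTE; apply/negP; case/andP=> /andP[/eqP i1 _] /andP[/eqP i2 _]; lia.
Qed.

End Top.

(** * The exchange property *)

Lemma pure_cat (x y : seq nat) v : pure (x ++ y) v = pure y (pure x v).
Proof. exact: foldl_cat. Qed.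

Lemma asc_cat (x y : seq nat) v : asc (x ++ y) v = asc x v && asc y (pure x v).
Proof. by elim: x v => //= i x IH v; rewrite IH andbA. Qed.

Definition tr a b (x : nat) := if x == a then b else if x == b then a else x.

Lemma tr_conj (t : nat -> nat) a b c : injective t ->
  tr (t a) (t b) (t c) = t (tr a b c).
Proof. by move=> ti; rewrite /tr !(inj_eq ti); case: ifP => // _; case: ifP. Qed.

Lemma tr_inj a b : injective (tr a b).
Proof. by move=> x y; rewrite /tr; repeat case: eqP; move=> *; lia. Qed.

Lemma swpE (T : Type) j (u : nat -> T) c : swp j u c = u (tr j j.+1 c).
Proof. by rewrite /swp /tr; case: eqP => // _; case: eqP. Qed.

(** The exchange condition, by induction on the last letter [j]: either the inversion is already
    present before [j], or [j] creates it and is itself the letter to delete. *)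
Lemma exchange w a b : asc w id -> a < b -> pure w id b < pure w id a ->
  exists x y i, w = x ++ i :: y /\ pure (x ++ y) id = pure w id \o tr a b.
Proof.
elim/last_ind: w a b => [|w j IH] a b; first by rewrite /=; lia.
rewrite -cats1 asc_cat pure_cat /= andbT => /andP[aw aj] ab h.
set a' := tr j j.+1 a; set b' := tr j j.+1 b.
have E c : swp j (pure w id) c = pure w id (tr j j.+1 c) by exact: swpE.
case: (ltnP a' b') => ab'.
  have [|x [y [i [wE pE]]]] := IH a' b' aw ab'; first by rewrite -!E.
  exists x, (rcons y j), i; rewrite wE -!cats1 -!catA /=; split=> //.
  rewrite catA pure_cat pE -wE; apply: funext => c /=.
  by rewrite !swpE /= tr_conj //; exact: tr_inj.
have [aj' bj'] : a = j /\ b = j.+1.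
  by move: ab' ab; rewrite /a' /b' /tr; repeat (case: eqP => ?; try lia).
exists w, [::], j; rewrite cats0; split=> //.
apply: funext => c; rewrite /= E aj' bj'; congr (pure w id _).
rewrite /tr; case: (c =P j) => [->|h1]; first by rewrite eqxx; case: eqP => //; lia.
by case: (c =P j.+1) => [->|h2]; rewrite ?eqxx //; case: eqP => // _; case: eqP.
Qed.

Lemma pure_inj w v : injective v -> injective (pure w v).
Proof. by elim: w v => //= i w IH v vi; apply: IH; exact: swp_inj. Qed.

Lemma run_out d w v : all (letters d) w -> forall x, (x == 0) || (d < x) ->
  run w v x = v x.
Proof.
elim: w v => //= i w IH v /andP[/andP[i0 id] lw] x hx.
by rewrite IH // /srt; case: ifP => // _; rewrite swpD //; apply/eqP; lia.
Qed.

(** Each new letter precomposes [pure] with a transposition of positions, whence the inverse.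
    Positions start at 1 here and at 0 in ['I_d]. *)
Lemma perm_pure d w : all (letters d) w ->
  forall x : 'I_d, pure w id x.+1 = ((word_perm d w)^-1%g x).+1.
Proof.
elim/last_ind: w => [|w j IH] lw x; first by rewrite /word_perm big_nil invg1 perm1.
move: lw; rewrite all_rcons => /andP[lj lw].
rewrite -cats1 pure_cat /= swpE /word_perm big_cat /= big_seq1 invMg permM.
have [j0 jd] := andP lj.
have j1d : j.-1 < d by lia.
have -> : (simple_refl d j)^-1%g = tperm (Ordinal j1d) (Ordinal jd).
  by rewrite /simple_refl !insubT tpermV.
rewrite -/(word_perm d w) -IH //; congr (pure w id _).
case: tpermP => [->|->|]; rewrite /tr /=.
- by rewrite prednK ?eqxx.
- by case: eqP => [|_]; [lia|rewrite eqxx prednK].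
move=> /eqP; rewrite -val_eqE /= => h1 /eqP; rewrite -val_eqE /= => h2.
by repeat (case: eqP => ?; try lia).
Qed.

Lemma asc_fail w v : ~~ asc w v ->
  exists x j y, [/\ w = x ++ j :: y, asc x v & pure x v j.+1 <= pure x v j].
Proof.
elim: w v => //= i w IH v; rewrite negb_and -leqNgt; case/orP.
  by move=> h; exists [::], i, w.
case: (leqP (v i.+1) (v i)) => [h _|h /IH[x [j [y [-> ax px]]]]].
  by exists [::], i, w.
by exists (i :: x), j, y; rewrite /= h.
Qed.

(** At the first letter that meets a descent, [exchange] finds an earlier letter whose deletion has
    the same effect as this letter; removing both gives the same permutation by a word shorter by
    two. *)
Lemma reduced_asc d w : all (letters d) w -> reduced_word d w -> asc w id.
Proof.
move=> lw rw; apply/negPn/negP => /asc_fail[x [j [y [wE ax px]]]].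
have lt : pure x id j.+1 < pure x id j.
  rewrite ltn_neqAle px andbT; apply/negP => /eqP /pure_inj.
  by move=> /(_ (fun _ _ => id)); lia.
have [x1 [x2 [i [xE pE]]]] := exchange ax (ltnSn j) lt.
have pe : pure (x1 ++ x2 ++ y) id = pure w id.
  rewrite catA pure_cat pE wE pure_cat /=; congr (pure y _).
  by apply: funext => c; rewrite swpE.
have lw' : all (letters d) (x1 ++ x2 ++ y).
  by move: lw; rewrite wE xE !all_cat /= => /and3P[/and3P[-> _ ->] _ ->].
have sz : size (x1 ++ x2 ++ y) < size w by rewrite wE xE !size_cat /=; lia.
suff pp : word_perm d (x1 ++ x2 ++ y) = word_perm d w.
  by have := rw _ pp; lia.
apply: invg_inj; apply/permP => z; apply/val_inj/succn_inj.
by rewrite -!perm_pure // pe.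
Qed.

(** * Values exchanged along a reduced word *)

(* The e-th letter of a reduced word exchanges the values va < vb. *)
Definition va w e := pure (take e w) id (nth 0 w e).
Definition vb w e := pure (take e w) id (nth 0 w e).+1.

Lemma lsumE k w g v :
  lsum k w g v = \sum_(e < size w)
    (pure (take e w) v (nth 0 w e) <= k < pure (take e w) v (nth 0 w e).+1)
      * nth 0 g e.
Proof.
elim: w g v => [|i w IH] g v /=; first by rewrite big_ord0.
rewrite big_ord_recl /= nth0 IH; congr (_ + _); apply: eq_bigr => e _.
by rewrite /bump /= add1n; case: g => //=; rewrite !nth_nil.
Qed.

Lemma asc_nth w e : asc w id -> e < size w -> va w e < vb w e.
Proof.
move=> aw ew; move: aw; rewrite -{1}(cat_take_drop e w) (drop_nth 0 ew) asc_cat.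
by case/andP=> _ /= /andP[].
Qed.

Lemma pure_range d w x : all (letters d) w -> 0 < x <= d -> 0 < pure w id x <= d.
Proof.
move=> lw; case: x => // x xd; rewrite (perm_pure lw (Ordinal xd : 'I_d)).
by case: ((word_perm d w)^-1%g _).
Qed.

Lemma va_gt0 d w e : all (letters d) w -> e < size w -> 0 < va w e.
Proof.
move=> lw ew; have /andP[h1 h2] : letters d (nth 0 w e).
  by move/allP: lw; apply; rewrite mem_nth.
have lt : all (letters d) (take e w).
  by apply/allP => z /mem_take; move/allP: lw; apply.
by case/andP: (@pure_range d (take e w) (nth 0 w e) lt (ltac:(lia))).
Qed.

Lemma vb_le d w e : all (letters d) w -> e < size w -> vb w e <= d.
Proof.
move=> lw ew; have /andP[h1 h2] : letters d (nth 0 w e).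
  by move/allP: lw; apply; rewrite mem_nth.
have lt : all (letters d) (take e w).
  by apply/allP => z /mem_take; move/allP: lw; apply.
by case/andP: (@pure_range d (take e w) (nth 0 w e).+1 lt (ltac:(lia))).
Qed.

(** Two values in decreasing order can only be reordered when they are adjacent, and a letter there
    would meet a descent. *)
Lemma asc_persist y v a b : asc y v -> a < b -> v b < v a ->
  exists a' b', [/\ a' < b', pure y v a' = v a & pure y v b' = v b].
Proof.
elim: y v a b => [|j y IH] v a b /=; first by move=> _ ab _; exists a, b.
move=> /andP[h ay] ab vv; have := IH (swp j v) (tr j j.+1 a) (tr j j.+1 b) ay.
rewrite !swpE.
have trK x : tr j j.+1 (tr j j.+1 x) = x.
  rewrite /tr; case: (x =P j) => [->|h1]; first by rewrite eqxx; case: eqP => //; lia.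
  by case: (x =P j.+1) => [->|h2]; rewrite ?eqxx //; case: eqP => // _; case: eqP.
rewrite !trK; apply=> //; rewrite /tr.
by repeat (case: eqP => ?; subst; try lia).
Qed.

Lemma asc_uniq w e e' : asc w id -> e < e' -> e' < size w ->
  va w e = va w e' -> vb w e = vb w e' -> False.
Proof.
move=> aw ee ew; have lt := asc_nth aw (ltn_trans ee ew).
have E : take e' w = take e w ++ nth 0 w e :: drop e.+1 (take e' w).
  rewrite -{1}(cat_take_drop e (take e' w)) take_takel; last lia.
  by rewrite (drop_nth 0) ?nth_take // size_take; case: ifP; lia.
have aw' : asc (take e' w) id.
  by move: aw; rewrite -{1}(cat_take_drop e' w) asc_cat => /andP[].
move: aw'; rewrite {1}E asc_cat /= => /and3P[_ h ay].
rewrite /va /vb E !pure_cat /=.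
have [||a [b [ab pa pb]]] := asc_persist (a := nth 0 w e) (b := (nth 0 w e).+1) ay.
- by [].
- by rewrite swpl swpr.
move: pa pb; rewrite swpl swpr => <- <- /pure_inj pE1 /pure_inj pE2.
have i1 : injective (swp (nth 0 w e) (pure (take e w) id)).
  by apply: swp_inj; apply: pure_inj => ? ?.
by have := pE1 i1; have := pE2 i1; lia.
Qed.

(** * Unit weights *)

Lemma reach_greedy k w g v c : sumn g <= c ->
  reach (thr k (run w v)) w g (thr k v) c.
Proof.
elim: w g v c => [|i w IH] g v c //= gc.
have gE : sumn g = head 0 g + sumn (behead g) by case: (g).
have := IH (behead g) (srt i v); rewrite thr_srt /gr.
case: ifP => h r; [right|left; apply: r; lia].
by split=> //; split; [|apply: r]; lia.
Qed.

(** No step of a path lowers the heights more than sorting does, by the max-plus rule; so sorting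
    stays below every path. *)
Lemma reach_dom T k w g v S c : all (ltn 0) w ->
  (forall t, N (thr k v) t <= N S t) -> reach T w g S c ->
  forall t, N (thr k (run w v)) t <= N T t.
Proof.
elim: w g v S c => [|i w IH] g v S c /=; first by move=> _ h <-.
move=> /andP[i0 w0] NN [r|[h [cg r]]]; apply: (IH _ _ _ _ w0 _ r) => t.
  apply: leq_trans (NN t); rewrite N_srt //; case: eqP => // ->.
  case: i i0 {NN r} => // i _.
  by have := N_step (thr k v) i; have := N_step (thr k v) i.+1; rewrite /=; lia.
have -> : N (swp i S) t = N (gr i S) t by rewrite /gr h.
rewrite N_gr // N_srt //; case: eqP => // _.
by have := NN i.-1; have := NN i.+1; lia.
Qed.

Lemma unit_weightsE m n : m < n ->
  unit_weights m n = nseq m 0 ++ 1 :: nseq (n - m.+1) 0.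
Proof.
move=> mn; apply: (@eq_from_nth _ 0).
  by rewrite size_mkseq size_cat /= !size_nseq; lia.
move=> i; rewrite size_mkseq => i_n; rewrite nth_mkseq // nth_cat size_nseq nth_nseq.
case: ltnP => h; first by rewrite ?if_same; case: eqP => //; lia.
case: eqP => [->|ne]; first by rewrite subnn.
case E: (i - m) => [|j] /=; first lia.
by rewrite nth_nseq if_same.
Qed.

Lemma reach_unit0 T (x y : seq nat) i S :
  reach T (x ++ i :: y) (nseq (size x) 0 ++ 1 :: nseq (size y) 0) S 0 <->
  reach T (x ++ y) (nseq (size (x ++ y)) 0) S 0.
Proof.
elim: x S => [|j x IH] S /=; last by rewrite subnn !IH.
by split=> [[//|[_ [//]]]|]; left.
Qed.

Lemma sortd_eq d k w w' : 0 < k < d -> all (letters d) w -> all (letters d) w' ->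
  sortd d k (run w id) -> sortd d k (run w' id) ->
  thr k (run w id) = thr k (run w' id).
Proof.
move=> kd lw lw' s s'; apply: funext => x.
case: (boolP ((x == 0) || (d < x))) => hx; first by rewrite /thr !(@run_out d).
case: x hx => // x hx.
have E u : u <= d -> N (thr k (run w id)) u = N (thr k (run w' id)) u.
  have kd' : k <= d by lia.
  move=> ud; rewrite (sortd_N kd' (N_run_id kd' lw) s ud).
  by rewrite (sortd_N kd' (N_run_id kd' lw') s' ud).
have := E x.+1; rewrite !NS E; last lia.
by do 2 case: (thr _ _ _); lia.
Qed.

Section UnitPath.
Variables (d k : nat) (x y : seq nat) (i : nat).
Hypotheses (kd : 0 < k < d) (lw : all (letters d) (x ++ i :: y)).
Hypothesis (sw : sortd d k (run (x ++ i :: y) id)).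

(** A path of cost 0 must skip the letter of weight 1, so it is a path of the shorter word, and
    [reach_dom] then shows that this word sorts. With a budget of 1 the greedy path is always
    affordable. *)
Lemma unit_path c :
  reach (thr k (run (x ++ i :: y) id)) (x ++ i :: y)
    (unit_weights (size x) (size (x ++ i :: y))) (thr k id) c <->
  ~~ sortd d k (run (x ++ y) id) <= c.
Proof.
have lxy : all (letters d) (x ++ y).
  by move: lw; rewrite !all_cat /= => /and3P[-> _ ->].
have pxy : all (ltn 0) (x ++ y).
  by apply/allP => z /(allP lxy) /andP[].
have sx : size x < size (x ++ i :: y) by rewrite size_cat /=; lia.
have E : unit_weights (size x) (size (x ++ i :: y)) =
    nseq (size x) 0 ++ 1 :: nseq (size y) 0.
  by rewrite unit_weightsE // size_cat /=; congr (_ ++ _ :: nseq _ _); lia.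
case: c => [|c]; last first.
  split=> _; first by case: sortd.
  apply: reach_greedy; rewrite E sumn_cat /= !sumn_nseq; lia.
rewrite leqn0 eqb0 negbK E reach_unit0; split=> [r|s].
  apply/sortdP => t td; have /sortdP/(_ t td) := sw; apply: leq_trans.
  exact: (reach_dom pxy _ r).
rewrite -(sortd_eq kd lxy lw s sw); apply: reach_greedy.
by rewrite sumn_nseq.
Qed.

End UnitPath.

End Sorting.

(** * Words and cycle weights along a weave *)

Section Weaves.
Local Open Scope nat_scope.

Lemma mem_replace m k (s' s : seq nat) z :
  z \in replace m k s' s -> (z \in s') || (z \in s).
Proof.
rewrite /replace !mem_cat => /or3P[/mem_take h|->|/mem_drop h] //;
  by rewrite h orbT.
Qed.

Lemma move_letters d mv (w : word) : move_ok mv w ->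
  all (letters d) w -> all (letters d) (move_word mv w).
Proof.
move=> ok /allP lw; apply/allP => z /mem_replace /orP[|/lw //] h; apply: lw.
move: ok h; case: mv => -[] m; rewrite /move_ok /= => /andP[sz _].
- by rewrite inE => /eqP ->; apply: mem_nth; apply: leq_trans sz; lia.
- by rewrite !inE => /orP[] /eqP ->; apply: mem_nth; apply: leq_trans sz; lia.
by rewrite !inE => /or3P[] /eqP ->; apply: mem_nth; apply: leq_trans sz; lia.
Qed.

Lemma size_move_word mv (w : word) : move_ok mv w ->
  size (move_word mv w) + arity_in mv.1 = size w + arity_out mv.1.
Proof.
case: mv => -[] m; rewrite /move_ok /move_word /replace /= => /andP[sz _];
by rewrite size_cat /= size_take size_drop; case: ifP; lia.
Qed.

Lemma size_move_weights mv (w : word) (g : seq nat) : move_ok mv w -> size g = size w ->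
  size (move_weights mv g) = size (move_word mv w).
Proof.
by case: mv => -[] m _ gw;
  rewrite /move_word /move_weights /replace !size_cat !size_take !size_drop gw.
Qed.

Lemma move_weights0 mv n : mv.2 + arity_in mv.1 <= n ->
  move_weights mv (nseq n 0) = nseq (n - arity_in mv.1 + arity_out mv.1) 0.
Proof.
case: mv => v m /= h.
have E a l : size a = l -> all (pred1 0) a -> a = nseq l 0.
  by move=> <- /all_pred1P.
apply: E.
  by case: v h => /= h; rewrite size_cat /= size_take size_drop size_nseq; case: ifP; lia.
apply/allP => z /mem_replace /orP[|]; last by rewrite mem_nseq => /andP[_ /eqP ->].
rewrite !nth_nseq !if_same.
by case: v {h}; rewrite !inE => h; apply/eqP; lia.
Qed.

Section Weave.
Variables (b : word) (mk : pred nat) (w : seq move) (b' : word).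
Hypothesis hw : is_weave b w b'.
Local Notation cyc := (Defs.cycle b mk w).
Local Notation wd := (word_at b w).

Lemma word_at0 : wd 0 = b. Proof. by rewrite /word_at take0. Qed.

Lemma word_atS t : t < size w -> wd t.+1 = move_word (move_at w t) (wd t).
Proof.
move=> tw; rewrite /word_at (take_nth (Trivalent, 0) tw) -cats1 foldl_cat.
by [].
Qed.

Lemma weave_ok t : t < size w -> move_ok (move_at w t) (wd t).
Proof.
rewrite /word_at /move_at; elim: (w) (b) t hw => //= mv w' IH b0 [|t] /andP[ok hw'].
  by [].
by rewrite ltnS => tw; exact: IH.
Qed.

Lemma word_at_bottom : wd (bottom w) = b'.
Proof.
rewrite /word_at /bottom take_size; elim: (w) (b) hw => [|mv w' IH] b0 /=.
  by move/eqP.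
by case/andP=> _; exact: IH.
Qed.

Lemma run_word_at t v : t <= size w -> run (wd t) v = run b v.
Proof.
elim: t => [|t IH] tw; first by rewrite word_at0.
by rewrite word_atS // move_run ?IH ?weave_ok // ltnW.
Qed.

Lemma letters_word_at d t : all (letters d) b -> t <= size w -> all (letters d) (wd t).
Proof.
move=> lb; elim: t => [|t IH] tw; first by rewrite word_at0.
by rewrite word_atS //; apply: move_letters; [exact: weave_ok | apply: IH; lia].
Qed.

Lemma cnt_weave Phi v : injective v ->
  cnt Phi b v = cnt Phi b' v +
    \sum_(t < size w) is_trivalent (move_at w t).1 *
      Phi (run (take (move_at w t).2 (wd t) ++ drop (move_at w t).2.+2 (wd t)) v).
Proof.
move=> vi; rewrite /word_at /move_at; elim: (w) (b) hw => [|mv w' IH] b0 /=.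
  by move/eqP ->; rewrite big_ord0 addn0.
case/andP=> ok /IH{}IH; rewrite (move_cnt _ vi ok) IH big_ord_recl /=.
by rewrite -addnA; congr (_ + _); rewrite addnC.
Qed.

(** * Weights *)

Lemma propagateS s t g : s <= t -> t < size w ->
  propagate w s t.+1 g = move_weights (move_at w t) (propagate w s t g).
Proof.
move=> st tw; rewrite /propagate (take_nth (Trivalent, 0) tw) -cats1.
rewrite drop_cat size_take tw; case: ltnP => h; first by rewrite foldl_cat.
have -> : s = t by lia.
by rewrite subnn drop0 drop_oversize ?size_take ?tw.
Qed.

Lemma propagate_id s g : propagate w s s g = g.
Proof. by rewrite /propagate drop_oversize // size_take; case: ifP; lia. Qed.

Lemma size_propagate s t g : s <= t -> t <= size w -> size g = size (wd s) ->
  size (propagate w s t g) = size (wd t).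
Proof.
move=> st + gs; rewrite -(subnKC st).
elim: (t - s) => [|e IH] tw; first by rewrite addn0 propagate_id.
rewrite addnS propagateS ?word_atS; try lia.
by apply: size_move_weights; [apply: weave_ok; lia | apply: IH; lia].
Qed.

Lemma reach_propagate T s t g S c : s <= t -> t <= size w -> size g = size (wd s) ->
  reach T (wd t) (propagate w s t g) S c <-> reach T (wd s) g S c.
Proof.
move=> st + gs; rewrite -(subnKC st).
elim: (t - s) => [|e IH] tw; first by rewrite addn0 propagate_id.
rewrite addnS propagateS ?word_atS; try lia.
rewrite move_reach; [apply: IH; lia|apply: weave_ok; lia|].
by rewrite size_propagate //; lia.
Qed.

Definition level (c : cyc) : nat := if val c is inr s then s.+1 else 0.

Definition place (c : cyc) : nat :=
  match val c with inl m => m | inr s => (move_at w s).2 end.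

Lemma level_le c : level c <= size w.
Proof. by case: c => -[m|s] i; rewrite /level /=. Qed.

Lemma weightsE (c : cyc) t : level c <= t ->
  weights c t = propagate w (level c) t (unit_weights (place c) (size (wd (level c)))).
Proof.
case: c => -[m|s] i; rewrite /level /place /weights /=; first by rewrite word_at0.
by rewrite ltnNge => /negbTE ->.
Qed.

Lemma weights_level (c : cyc) :
  weights c (level c) = unit_weights (place c) (size (wd (level c))).
Proof. by rewrite weightsE // propagate_id. Qed.

Lemma weights_before (c : cyc) t : t < level c -> weights c t = nseq (size (wd t)) 0.
Proof. by case: c => -[m|s] i; rewrite /level /weights //= ltnS => ->. Qed.

Lemma size_weights (c : cyc) t : t <= size w -> size (weights c t) = size (wd t).
Proof.
move=> tw; case: (ltnP t (level c)) => h.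
  by rewrite weights_before // size_nseq.
by rewrite weightsE // size_propagate ?level_le // size_mkseq.
Qed.

Lemma weightsS (c : cyc) t : t < size w -> t.+1 != level c ->
  weights c t.+1 = move_weights (move_at w t) (weights c t).
Proof.
move=> tw tl; case: (leqP (level c) t) => h.
  by rewrite !weightsE ?propagateS // ltnW.
have h' : t.+1 < level c by lia.
rewrite !weights_before // word_atS //.
have ok := weave_ok tw; have sz := size_move_word ok.
rewrite move_weights0.
  by congr nseq; move: sz ok; rewrite /move_ok => sz /andP[]; lia.
by move: ok; rewrite /move_ok => /andP[].
Qed.

Lemma origin_trivalent (c : cyc) t : t < size w -> t.+1 = level c ->
  (move_at w t).1 = Trivalent /\ place c = (move_at w t).2.
Proof.
case: c => -[m|s] i; rewrite /level //= => tw [ts]; rewrite /place /= -ts.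
by move: i; rewrite /is_cycle /= -ts; case: (move_at w t).1.
Qed.

Lemma place_lt (c : cyc) : place c < size (wd (level c)).
Proof.
case E : (level c) => [|t].
  by case: c E => -[m|s] i //= _; rewrite word_at0 /place /=.
have tw : t < size w by rewrite -E level_le.
have [e1 e2] := origin_trivalent tw (esym E); rewrite e2 word_atS //.
have ok := weave_ok tw; have := size_move_word ok; move: ok; rewrite /move_ok.
by rewrite e1 /= => /andP[]; lia.
Qed.

(** * The bottom weights of a cycle *)

(** For a trivalent vertex this is the word above it with both incoming letters deleted
    ([removed_trivalent]), the word that [cnt_weave] tests. *)
Definition removed (c : cyc) : word :=
  take (place c) (wd (level c)) ++ drop (place c).+1 (wd (level c)).

Lemma removed_trivalent (c : cyc) t : t < size w -> t.+1 = level c ->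
  removed c = take (move_at w t).2 (wd t) ++ drop (move_at w t).2.+2 (wd t).
Proof.
move=> tw tl; have [e1 e2] := origin_trivalent tw tl.
rewrite /removed e2 -tl word_atS // /move_word /replace e1 /=.
have := weave_ok tw; rewrite /move_ok e1 /= => /andP[sz _].
have st : size (take (move_at w t).2 (wd t)) = (move_at w t).2.
  by rewrite size_take; case: ifP; lia.
rewrite take_cat st ltnn subnn take0 cats0 drop_cat st ltnNge leqnSn /=.
by rewrite subSnn /= drop0 addn2.
Qed.

Section Bottom.
Variable d : nat.
Hypotheses (lb : all (letters d) b) (ab : asc b' id)
  (sb : forall k, 0 < k < d -> sortd d k (run b id)).

(** The least cost of a path is the same at every level. Where the cycle starts it is given by
    [unit_path], at the reduced bottom word by the unique path of [asc_reach]. The two numbers are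
    compared through their upper bounds [n]. *)
Lemma lsum_weights (c : cyc) k : 0 < k < d ->
  lsum k b' (weights c (bottom w)) id = ~~ sortd d k (run (removed c) id).
Proof.
move=> kd; have lc := level_le c; have pl := place_lt c.
set W := wd (level c); set x := take (place c) W.
have WE : W = x ++ nth 0 W (place c) :: drop (place c).+1 W.
  by rewrite -drop_nth // cat_take_drop.
have sx : size x = place c by rewrite size_take pl.
have rE : run b' id = run W id by rewrite -word_at_bottom !run_word_at.
have lW : all (letters d) W by exact: letters_word_at.
have sW : sortd d k (run W id) by rewrite run_word_at //; exact: sb.
have H n : (lsum k b' (weights c (bottom w)) id <= n) =
           (~~ sortd d k (run (removed c) id) <= n).
  have U : reach (thr k (run W id)) W (unit_weights (place c) (size W)) (thr k id) n
      <-> ~~ sortd d k (run (removed c) id) <= n.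
    by rewrite -sx WE; apply: unit_path; rewrite // -WE.
  rewrite -(reach_propagate _ _ _ lc (leqnn (size w))) in U;
    last by rewrite size_mkseq.
  rewrite -weightsE // -/(bottom w) word_at_bottom -rE in U.
  have l0 : all (ltn 0) b'.
    rewrite -word_at_bottom; apply/allP => z /(allP (letters_word_at lb (leqnn _))).
    by case/andP.
  apply/idP/idP => h; first by apply/U; exact: reach_asc.
  by have [] := asc_reach l0 ab (fun t => leqnn _) (proj2 U h).
by apply/eqP; rewrite eqn_leq H leqnn -H leqnn.
Qed.

End Bottom.

Section Cut.
Variables (d : nat) (bs : seq bool).
Hypotheses (hd : 2 < d) (hbs : d < size bs) (bE : b = blocks d bs).
Hypothesis rb : reduced_word d b'.

Lemma letters_b : all (letters d) b.
Proof. by rewrite bE letters_blocks. Qed.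

Lemma letters_b' : all (letters d) b'.
Proof. by rewrite -word_at_bottom; apply: letters_word_at letters_b _. Qed.

Lemma asc_b' : asc b' id.
Proof. exact: reduced_asc letters_b' rb. Qed.

Lemma sortd_b k : 0 < k < d -> sortd d k (run b id).
Proof. by rewrite bE; exact: sortd_blocks. Qed.

Lemma lsum_cut (c : cyc) k : 0 < k < d ->
  lsum k b' (weights c (bottom w)) id = ~~ sortd d k (run (removed c) id).
Proof. exact: lsum_weights letters_b asc_b' sortd_b c k. Qed.

Lemma lsum_top (c : cyc) k : 0 < k < d -> level c = 0 ->
  lsum k b' (weights c (bottom w)) id = 0.
Proof.
move=> kd l0; rewrite lsum_cut // /removed l0 word_at0.
rewrite (@sortd_delete d bs hbs _ _ (nth 0 b (place c))) //.
rewrite -bE -drop_nth ?cat_take_drop //.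
by have := place_lt c; rewrite l0 word_at0.
Qed.

Lemma sum_bool_eq1 n (a : 'I_n -> bool) : \sum_(t < n) a t = 1 ->
  exists t0, a t0 /\ forall t, a t -> t = t0.
Proof.
move=> h; have /card1P : #|[pred t | a t]| == 1.
  rewrite -sum1_card -[X in _ == X]h big_mkcond; apply/eqP/eq_bigr => t _.
  by rewrite inE; case: (a t).
move=> [t0 ht]; exists t0; split; first by have := ht t0; rewrite !inE eqxx.
by move=> t at_; have := ht t; rewrite !inE at_ => /esym /eqP.
Qed.

(** The reduced bottom word has no drops, so the count 1 of the top word is the number of trivalent
    vertices whose deletion spoils the threshold [k]. *)
Lemma cycle_cut k : 0 < k < d -> exists c0 : cyc, forall c : cyc,
  lsum k b' (weights c (bottom w)) id = (c == c0).
Proof.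
move=> kd; have := @cnt_weave (fun v => ~~ sortd d k v) id (fun _ _ => id).
rewrite {1}bE cnt_top // (asc_cnt _ asc_b') add0n => /esym.
under eq_bigr do rewrite mulnb.
case/sum_bool_eq1=> t0 [/andP[tri0 h0] uniq].
have ic : is_cycle (b := b) mk (inr t0) by [].
exists (exist _ (inr t0) ic) => c; rewrite -val_eqE /=.
case E : (val c) => [m|t] /=.
  by rewrite lsum_top // /level E.
rewrite lsum_cut // (@removed_trivalent c t) ?/level ?E //.
congr nat_of_bool; apply/idP/eqP => [h|[->]]; last by [].
congr inr; apply: uniq; rewrite h andbT.
by have := valP c; rewrite /is_cycle E.
Qed.

(** Otherwise the vertex of [c] would be counted among those that spoil both thresholds, and by
    [cnt_top2] there are none. *)
Lemma cycle_cut_inj k l (c : cyc) : 0 < k < d -> 0 < l < d ->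
  lsum k b' (weights c (bottom w)) id = 1 ->
  lsum l b' (weights c (bottom w)) id = 1 -> k = l.
Proof.
move=> kd ld hk hl; apply/eqP/negPn/negP => kl.
case E : (level c) => [|t]; first by move: hk; rewrite lsum_top.
have tw : t < size w by rewrite -E level_le.
have := @cnt_weave (fun v => ~~ sortd d k v && ~~ sortd d l v) id (fun _ _ => id).
rewrite {1}bE cnt_top2 // (asc_cnt _ asc_b') add0n => /esym /eqP.
rewrite sum_nat_eq0 => /forallP /(_ (Ordinal tw)) /=.
have [-> _] := origin_trivalent tw (esym E).
move: hk hl; rewrite !lsum_cut // (removed_trivalent tw (esym E)).
by do 2 case: (~~ _).
Qed.

Lemma nth_le_lsum (c : cyc) e k : e < size b' -> va b' e <= k < vb b' e ->
  nth 0 (weights c (bottom w)) e <= lsum k b' (weights c (bottom w)) id.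
Proof.
move=> eb hk; rewrite lsumE (bigD1 (Ordinal eb)) //=.
by rewrite -/(va b' e) -/(vb b' e) hk mul1n leq_addr.
Qed.

Lemma bottom_top (c : cyc) e : e < size b' -> level c = 0 ->
  nth 0 (weights c (bottom w)) e = 0.
Proof.
move=> eb l0; have h0 := va_gt0 letters_b' eb; have h1 := vb_le letters_b' eb.
have h2 := asc_nth asc_b' eb.
have := @nth_le_lsum c e (va b' e) eb; rewrite lsum_top //; last lia.
by move/(_ (ltac:(lia))); lia.
Qed.

(** An edge with [vb > va + 1] enters the sums for the thresholds [va] and [va + 1], so a cycle
    through it would be [gam] of both, against [cycle_cut_inj]. Hence the total weight 1 for the
    threshold [k] sits on edges that exchange [k] and [k + 1], and [asc_uniq] leaves only one such
    edge. *)
Lemma bottom_weights : exists gam : nat -> cyc,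
  (forall (c : cyc) e, e < size b' -> nth 0 (weights c (bottom w)) e =
     (vb b' e == (va b' e).+1) && (c == gam (va b' e))) /\
  (forall k, 0 < k < d -> exists e, [/\ e < size b', va b' e = k & vb b' e = k.+1]).
Proof.
have [c1 _] := @cycle_cut 1 (ltac:(lia)).
(* Outside [0 < k < d] the value of [gam] is an arbitrary cycle. *)
have [gam hg] : {gam : nat -> cyc & forall k, 0 < k < d -> forall c : cyc,
    lsum k b' (weights c (bottom w)) id = (c == gam k)}.
  apply: (@choice _ _ (fun k g => 0 < k < d -> forall c : cyc,
    lsum k b' (weights c (bottom w)) id = (c == g))) => k.
  case: (boolP (0 < k < d)) => kd; last by exists c1.
  by have [c0 h] := cycle_cut kd; exists c0.
have le := nth_le_lsum.
have va0 e : e < size b' -> 0 < va b' e by apply: va_gt0 letters_b'.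
have vbd e : e < size b' -> vb b' e <= d by apply: vb_le letters_b'.
have vv e : e < size b' -> va b' e < vb b' e by apply: asc_nth asc_b'.
have zero (c : cyc) e : e < size b' ->
    ~~ ((vb b' e == (va b' e).+1) && (c == gam (va b' e))) ->
    nth 0 (weights c (bottom w)) e = 0.
  move=> eb; have h0 := va0 e eb; have h1 := vbd e eb; have h2 := vv e eb.
  have l1 := le c e (va b' e) eb; rewrite hg in l1; last lia.
  rewrite negb_and => /orP[ne|/negbTE ne].
    have l2 := le c e (va b' e).+1 eb; rewrite hg in l2; last lia.
    case: (c =P gam (va b' e)) l1 => [e1|_]; last by move/(_ (ltac:(lia))); lia.
    case: (c =P gam (va b' e).+1) l2 => [e2|_] l2 _; last first.
      by have := l2 (ltac:(lia)); lia.
    have := @cycle_cut_inj (va b' e) (va b' e).+1 c.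
    by rewrite !hg -?e1 -?e2 ?eqxx; [|lia|lia] => /(_ (ltac:(lia)) (ltac:(lia)) erefl erefl); lia.
  by rewrite ne in l1; have := l1 (ltac:(lia)); lia.
have ex k : 0 < k < d ->
    exists e, [/\ e < size b', va b' e = k & vb b' e = k.+1].
  move=> kd; have := hg k kd (gam k); rewrite eqxx lsumE => h.
  apply: contrapT => none; move: h; rewrite big1 // => -[e eb] _ /=.
  rewrite -/(va b' e) -/(vb b' e).
  case: (boolP (va b' e <= k < vb b' e)) => hk; last by rewrite mul0n.
  rewrite mul1n; apply/eqP/negPn/negP => nz; apply: none; exists e.
  have [] : (vb b' e == (va b' e).+1) && (gam k == gam (va b' e)).
    by apply/negPn/negP => /(zero _ _ eb) e0; rewrite e0 in nz.
  by case/andP=> /eqP h _; split=> //; lia.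
exists gam; split=> // c e eb; have h0 := va0 e eb; have h1 := vbd e eb.
case: (boolP (_ && _)) => [/andP[/eqP e1 /eqP e2]|]; last exact: zero.
have := hg (va b' e) (ltac:(lia)) c; rewrite e2 eqxx lsumE (bigD1 (Ordinal eb)) //=.
rewrite -/(va b' e) -/(vb b' e) e1 leqnn ltnSn mul1n big1 ?addn0 // => -[e' eb'] ne /=.
rewrite -/(va b' e') -/(vb b' e').
case: (boolP (va b' e' <= va b' e < vb b' e')) => hk; last by rewrite mul0n.
rewrite mul1n; apply/eqP/negPn/negP => nz.
have : (vb b' e' == (va b' e').+1) && (gam (va b' e) == gam (va b' e')).
  by apply/negPn/negP => /(zero _ _ eb') e0; rewrite e0 in nz.
case/andP=> /eqP h _; have va_e : va b' e' = va b' e by lia.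
have vb_e : vb b' e' = vb b' e by lia.
move: ne; rewrite -val_eqE /= neq_ltn => /orP[] lt.
  exact: (asc_uniq asc_b' lt).
exact: (asc_uniq asc_b' lt eb' (esym va_e) (esym vb_e)).
Qed.

End Cut.

End Weave.

(** * Reversal of a reduced word of the longest element *)

Section Reverse.

Lemma pure_comp (v : nat -> nat) w x : pure w v x = v (pure w id x).
Proof.
elim/last_ind: w v x => [//|w i IH] v x; rewrite -cats1 !pure_cat /=.
by rewrite !swpE IH.
Qed.

Lemma pure_rev w x : pure (rev w) id (pure w id x) = x.
Proof.
elim: w x => [//|i w IH] x; rewrite rev_cons -cats1 pure_cat /= [pure w _ x]pure_comp.
rewrite swpE [swp i id _]swpE -{2}[x]IH; congr (pure _ _ _).
rewrite /tr; move: (pure w id x) => y; case: (y =P i) => ?; last case: (y =P i.+1) => ?; repeat (case: eqP => ? //); lia.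
Qed.

(** The threshold [d - x] forces the value in position [x] to exceed [d - x]. By induction the
    larger values are taken by earlier positions, and injectivity leaves only equality. *)
Lemma sortd_longest d w : all (letters d) w ->
  (forall k, 0 < k < d -> sortd d k (pure w id)) ->
  forall x, 0 < x <= d -> pure w id x = d.+1 - x.
Proof.
move=> lw sd; have ge x : 0 < x <= d -> d.+1 - x <= pure w id x.
  move=> xd; have := pure_range lw xd; case: (eqVneq x d) => [->|ne]; first lia.
  move=> _; have kd : 0 < d - x < d by lia.
  have /sortdP/(_ x) := sd _ kd; case: x xd ne kd => // x xd ne kd.
  by rewrite NS /thr; lia.
have inj : injective (pure w id) by exact: pure_inj.
elim/ltn_ind => x IH xd; apply/eqP; rewrite eqn_leq ge // andbT leqNgt; apply/negP => lt.
have rx := pure_range lw xd; pose y := d.+1 - pure w id x.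
have yE := IH y (ltac:(rewrite /y; lia)) (ltac:(rewrite /y; lia)).
have /inj : pure w id y = pure w id x by rewrite yE /y; lia.
by rewrite /y; lia.
Qed.

(** For w = x i y, undoing [y] leads back to the state after [x i]. As w acts by z -> d + 1 - z, the
    values seen by [rev y] are the complements of those seen by [x], interchanged by [i]. *)
Lemma reverse_ends d w e : all (letters d) w ->
  (forall k, 0 < k < d -> sortd d k (pure w id)) -> e < size w ->
  va (rev w) (size w - e.+1) = d.+1 - vb w e /\
  vb (rev w) (size w - e.+1) = d.+1 - va w e.
Proof.
move=> lw sd ew; have long := sortd_longest lw sd.
pose i := nth 0 w e; pose x := take e w; pose y := drop e.+1 w.
have wE : w = x ++ i :: y by rewrite -drop_nth // cat_take_drop.
have E z : pure w id (pure (rev y) id z) = pure x id (tr i i.+1 z).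
  rewrite wE pure_cat /= pure_comp swpE; congr (pure x id (tr _ _ _)).
  by rewrite -{1}[y]revK pure_rev.
have id_ : letters d i by apply: (allP lw); exact: mem_nth.
have lx : all (letters d) (rev y).
  by rewrite all_rev; move: lw; rewrite wE all_cat /= => /and3P[].
have tE : take (size w - e.+1) (rev w) = rev y.
  by rewrite take_rev subKn.
rewrite /va /vb tE nth_rev; last lia.
rewrite (_ : size w - (size w - e.+1).+1 = e); last lia.
rewrite -/i -/x; move: id_; rewrite /letters => id_.
have r1 := pure_range lx (ltac:(lia) : 0 < i <= d).
have r2 := pure_range lx (ltac:(lia) : 0 < i.+1 <= d).
have := E i; have := E i.+1; rewrite !long // /tr !eqxx; case: eqP; lia.
Qed.

End Reverse.

End Weaves.

Import Order.TTheory GRing.Theory Num.Theory.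
Local Open Scope ring_scope.

(** * The exterior algebra in coordinates *)

Section Ext.
Variables (F : numFieldType) (d : nat).
Local Notation ext := (ext F d).
Implicit Types (x y z : ext) (A B C S : {set 'I_d}) (u v : 'rV[F]_d).

Lemma wedgeDl x y z : wedge (x + y) z = wedge x z + wedge y z.
Proof.
apply/ffunP => S; rewrite !ffunE -big_split; apply: eq_bigr => A _.
by rewrite !ffunE mulrDr mulrDl.
Qed.

Lemma wedgeDr x y z : wedge z (x + y) = wedge z x + wedge z y.
Proof.
apply/ffunP => S; rewrite !ffunE -big_split; apply: eq_bigr => A _.
by rewrite !ffunE mulrDr.
Qed.

Lemma wedgeZl (a : F) x z : wedge (a *: x) z = a *: wedge x z.
Proof.
apply/ffunP => S; rewrite !ffunE [RHS]mulr_sumr; apply: eq_bigr => A _.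
by rewrite !ffunE /GRing.scale /=; ring.
Qed.

Lemma wedgeZr (a : F) x z : wedge z (a *: x) = a *: wedge z x.
Proof.
apply/ffunP => S; rewrite !ffunE [RHS]mulr_sumr; apply: eq_bigr => A _.
by rewrite !ffunE /GRing.scale /=; ring.
Qed.

Lemma wedge0l x : wedge (0 : ext) x = 0.
Proof. by rewrite -[0 in LHS](scale0r (0 : ext)) wedgeZl scale0r. Qed.

Lemma wedge0r x : wedge x (0 : ext) = 0.
Proof. by rewrite -[0 in LHS](scale0r (0 : ext)) wedgeZr scale0r. Qed.

Lemma wedge_suml (I : finType) (P : pred I) (X : I -> ext) y :
  wedge (\sum_(i | P i) X i) y = \sum_(i | P i) wedge (X i) y.
Proof.
by apply: (big_morph (fun x => wedge x y)) => [a b|]; rewrite ?wedgeDl ?wedge0l.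
Qed.

Lemma wedge_sumr (I : finType) (P : pred I) (X : I -> ext) y :
  wedge y (\sum_(i | P i) X i) = \sum_(i | P i) wedge y (X i).
Proof. by apply: (big_morph (wedge y)) => [a b|]; rewrite ?wedgeDr ?wedge0r. Qed.

Lemma ext_sum x : x = \sum_A x A *: ebase F A.
Proof.
apply/ffunP => S; rewrite sum_ffunE (bigD1 S) //= big1 => [|A AS]; rewrite !ffunE.
  by rewrite eqxx addr0 /GRing.scale /= mulr1.
by rewrite eq_sym (negPf AS) scaler0.
Qed.

Lemma vecD u v : vec (u + v) = vec u + vec v.
Proof. by rewrite -big_split; apply: eq_bigr => i _; rewrite mxE scalerDl. Qed.

Lemma vecZ (a : F) v : vec (a *: v) = a *: vec v.
Proof. by rewrite scaler_sumr; apply: eq_bigr => i _; rewrite mxE scalerA. Qed.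

Lemma vecB u v : vec (u - v) = vec u - vec v.
Proof. by rewrite -[- v]scaleN1r vecD vecZ scaleN1r. Qed.

(** * Signs *)

Lemma sgnUr A B C : [disjoint B & C] ->
  sgn F A (B :|: C) = sgn F A B * sgn F A C.
Proof.
move=> dBC; rewrite /sgn -exprD; congr (_ ^+ _); rewrite -cardsUI.
rewrite [X in (_ + X)%N](_ : _ = 0%N) ?addn0.
  by apply: eq_card => -[a b]; rewrite !inE /=; case: (a \in A) => //=; rewrite andb_orl.
apply/eqP; rewrite cards_eq0; apply/eqP/setP => -[a b]; rewrite !inE /=.
apply/negP => /andP[/and3P[_ bB _] /and3P[_ bC _]].
by have := disjointFr dBC bB; rewrite bC.
Qed.

Lemma sgnUl A B C : [disjoint A & B] ->
  sgn F (A :|: B) C = sgn F A C * sgn F B C.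
Proof.
move=> dAB; rewrite /sgn -exprD; congr (_ ^+ _); rewrite -cardsUI.
rewrite [X in (_ + X)%N](_ : _ = 0%N) ?addn0.
  by apply: eq_card => -[a b]; rewrite !inE /= andb_orl.
apply/eqP; rewrite cards_eq0; apply/eqP/setP => -[a b]; rewrite !inE /=.
apply/negP => /andP[/and3P[aA _ _] /and3P[aB _ _]].
by have := disjointFr dAB aA; rewrite aB.
Qed.

Lemma sgn_sqr A B : sgn F A B * sgn F A B = 1.
Proof. by rewrite /sgn -expr2 -exprM mulnC exprM sqrrN !expr1n. Qed.

Lemma sgn0l A : sgn F set0 A = 1.
Proof. by rewrite /sgn (_ : [set _ | _] = set0) ?cards0 //; apply/setP => z; rewrite !inE. Qed.

Lemma sgn11 (i j : 'I_d) : sgn F [set i] [set j] = (-1) ^+ (j < i)%N.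
Proof.
rewrite /sgn; congr (_ ^+ _); case: ltnP => ij.
  rewrite (_ : [set _ | _] = [set (i, j)]) ?cards1 //.
  by apply/setP => -[a b]; rewrite !inE xpair_eqE /=; do 2 case: eqP => // ->; rewrite ?ij.
rewrite (_ : [set _ | _] = set0) ?cards0 //; apply/setP => -[a b]; rewrite !inE /=.
by do 2 case: eqP => //= ->; rewrite ltnNge ij.
Qed.

Lemma sgn_anti (i j : 'I_d) : i != j ->
  sgn F [set i] [set j] = - sgn F [set j] [set i].
Proof.
rewrite !sgn11 -val_eqE neq_ltn => /orP[] h.
  by rewrite h ltnNge (ltnW h) /= expr0 expr1 opprK.
by rewrite h ltnNge (ltnW h) /= expr0 expr1.
Qed.

Lemma wedge_ebaseA A B C :
  wedge (ebase F A) (wedge (ebase F B) (ebase F C)) =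
  wedge (wedge (ebase F A) (ebase F B)) (ebase F C).
Proof.
rewrite !wedge_ebase; case: ifP => dBC; case: ifP => dAB;
  rewrite ?wedgeZr ?wedgeZl ?wedge0l ?wedge0r ?wedge_ebase.
- rewrite !disjoints_subset setCU subsetI subUset -!disjoints_subset dAB dBC /= andbT.
  by case: ifP => dAC; rewrite ?scaler0 // !scalerA setUA sgnUr // sgnUl //; congr (_ *: _); ring.
- by rewrite disjoints_subset setCU subsetI -!disjoints_subset dAB scaler0.
- by rewrite disjoints_subset subUset -!disjoints_subset dBC andbF scaler0.
by [].
Qed.

Lemma wedgeA x y z : wedge x (wedge y z) = wedge (wedge x y) z.
Proof.
rewrite [x]ext_sum !wedge_suml; apply: eq_bigr => A _; rewrite !wedgeZl; congr (_ *: _).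
rewrite [y]ext_sum !(wedge_suml, wedge_sumr); apply: eq_bigr => B _.
rewrite !(wedgeZl, wedgeZr); congr (_ *: _).
rewrite [z]ext_sum !(wedge_suml, wedge_sumr); apply: eq_bigr => C _.
by rewrite !(wedgeZl, wedgeZr) wedge_ebaseA.
Qed.

Lemma wedge1l x : wedge (ebase F set0) x = x.
Proof.
rewrite [x]ext_sum wedge_sumr; apply: eq_bigr => A _.
rewrite wedgeZr wedge_ebase disjoints_subset sub0set set0U sgn0l scale1r //.
Qed.

Lemma sgn0r A : sgn F A set0 = 1.
Proof.
rewrite /sgn (_ : [set _ | _] = set0) ?cards0 //.
by apply/setP => z; rewrite !inE andbF.
Qed.

Lemma wedge1r x : wedge x (ebase F set0) = x.
Proof.
rewrite [x]ext_sum wedge_suml; apply: eq_bigr => A _.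
by rewrite wedgeZl wedge_ebase disjoint_sym disjoints_subset sub0set setU0 sgn0r scale1r.
Qed.

Lemma vec_anti u v : wedge (vec u) (vec v) = - wedge (vec v) (vec u).
Proof.
rewrite !wedge_sum exchange_big -sumrN; apply: eq_bigr => i _.
rewrite -sumrN; apply: eq_bigr => j _; rewrite !wedge_ebase.
rewrite ![ [disjoint _ & _] ]disjoints1 !inE [j == i]eq_sym.
case: eqP => [|/eqP ij]; rewrite ?scaler0 ?oppr0 //=.
by rewrite sgn_anti 1?eq_sym // scaleNr scalerN setUC mulrC.
Qed.

Lemma wedge_swap x u v :
  wedge (wedge x (vec u)) (vec v) = - wedge (wedge x (vec v)) (vec u).
Proof. by rewrite -!wedgeA vec_anti -scaleN1r wedgeZr scaleN1r. Qed.

Lemma wedge_vv x v : wedge (wedge x (vec v)) (vec v) = 0.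
Proof.
have /eqP := wedge_swap x v v; rewrite -subr_eq0 opprK -mulr2n -scaler_nat.
by rewrite scaler_eq0 pnatr_eq0 /= => /eqP.
Qed.

(** * Right contraction *)

(** The interior product taken from the right, so that [ctr_wedge] strips the last vector with
    coefficient f(v) and without a sign. *)
Definition ctr (f : 'cV[F]_d) x : ext :=
  \sum_(A : {set 'I_d}) x A *:
    \sum_(i | i \in A) (f i 0 * sgn F (A :\ i) [set i]) *: ebase F (A :\ i).

Lemma ctrD f x y : ctr f (x + y) = ctr f x + ctr f y.
Proof. by rewrite -big_split; apply: eq_bigr => A _; rewrite ffunE scalerDl. Qed.

Lemma ctrZ f (a : F) x : ctr f (a *: x) = a *: ctr f x.
Proof. by rewrite scaler_sumr; apply: eq_bigr => A _; rewrite ffunE scalerA. Qed.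

Lemma ctr0 f : ctr f 0 = 0.
Proof. by rewrite -[0 in LHS](scale0r (0 : ext)) ctrZ scale0r. Qed.

Lemma ctr_sum (I : finType) (P : pred I) f (X : I -> ext) :
  ctr f (\sum_(i | P i) X i) = \sum_(i | P i) ctr f (X i).
Proof. by apply: (big_morph (ctr f)) => [a b|]; rewrite ?ctrD ?ctr0. Qed.

Lemma ctr_ebase f A : ctr f (ebase F A) =
  \sum_(i | i \in A) (f i 0 * sgn F (A :\ i) [set i]) *: ebase F (A :\ i).
Proof.
rewrite /ctr (bigD1 A) //= [X in _ + X]big1 => [|B /negPf BA]; rewrite ffunE.
  by rewrite eqxx scale1r addr0.
by rewrite BA scale0r.
Qed.

Lemma ctr_wedge_ebase f A j :
  ctr f (wedge (ebase F A) (ebase F [set j])) =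
  f j 0 *: ebase F A - wedge (ctr f (ebase F A)) (ebase F [set j]).
Proof.
rewrite wedge_ebase ctr_ebase wedge_suml.
case: (boolP (j \in A)) => jA.
  have -> : [disjoint A & [set j]] = false by rewrite disjoint_sym disjoints1 jA.
  rewrite ctr0 (bigD1 j) //= big1 => [|i /andP[iA ij]]; last first.
    rewrite wedgeZl wedge_ebase disjoint_sym disjoints1 !inE jA andbT eq_sym ij.
    by rewrite scaler0.
  rewrite wedgeZl wedge_ebase disjoint_sym disjoints1 !inE eqxx /= addr0 scalerA.
  by rewrite -mulrA sgn_sqr mulr1 setUC setD1K // subrr.
have -> : [disjoint A & [set j]] by rewrite disjoint_sym disjoints1.
rewrite ctrZ ctr_ebase (bigD1 j) ?inE ?eqxx ?orbT //=.
have -> : (A :|: [set j]) :\ j = A.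
  apply/setP => i; rewrite !inE; case: eqP => [->|_]; first by rewrite (negPf jA).
  by rewrite orbF.
rewrite scalerDr scalerA mulrCA sgn_sqr mulr1; congr (_ + _).
rewrite -sumrN scaler_sumr.
rewrite [LHS](eq_bigl (fun i => i \in A)) => [|i]; last first.
  rewrite !inE; case: eqP => [->|/eqP ij]; rewrite ?orbF ?andbT ?andbF //.
  by rewrite (negPf jA).
apply: eq_bigr => i iA; have ij : i != j by apply: contraNneq jA => <-.
rewrite wedgeZl wedge_ebase disjoint_sym disjoints1 !inE (negPf jA) andbF /=.
have -> : (A :|: [set j]) :\ i = (A :\ i) :|: [set j].
  by apply/setP => l; rewrite !inE; case: (l =P i) => //= ->; rewrite (negPf ij).
rewrite !scalerA -scaleNr; congr (_ *: _).
have {1}-> : A = (A :\ i) :|: [set i] by rewrite setUC setD1K.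
have d1 l : [disjoint A :\ i & [set l]] = ~~ ((l != i) && (l \in A)).
  by rewrite disjoint_sym disjoints1 !inE.
rewrite !sgnUl ?d1 ?eqxx ?(negPf jA) ?andbF // (sgn_anti ij).
have := sgn_sqr [set j] [set i]; set s := sgn F [set j] [set i] => ss.
by rewrite -[RHS]mulr1 -ss; ring.
Qed.

Lemma ctr_wedge f x v :
  ctr f (wedge x (vec v)) = (\sum_i f i 0 * v 0 i) *: x - wedge (ctr f x) (vec v).
Proof.
rewrite [x]ext_sum wedge_suml !ctr_sum wedge_suml scaler_sumr -sumrB.
apply: eq_bigr => A _; rewrite wedgeZl !ctrZ wedgeZl scalerA mulrC -scalerA -scalerBr.
congr (_ *: _); rewrite !wedge_sumr ctr_sum scaler_suml -sumrB.
apply: eq_bigr => j _; rewrite !wedgeZr ctrZ ctr_wedge_ebase scalerBr scalerA.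
by rewrite mulrC.
Qed.

(** * Products of vectors *)

Definition wprod x (s : seq 'rV[F]_d) : ext := foldl (fun z v => wedge z (vec v)) x s.

Lemma wprod_rcons x s v : wprod x (rcons s v) = wedge (wprod x s) (vec v).
Proof. by rewrite /wprod foldl_rcons. Qed.

Lemma wprod_cat x s s' : wprod x (s ++ s') = wprod (wprod x s) s'.
Proof. exact: foldl_cat. Qed.

Lemma wedge_wprod x y s : wedge x (wprod y s) = wprod (wedge x y) s.
Proof. by elim/last_ind: s => // s v IH; rewrite !wprod_rcons wedgeA IH. Qed.

Lemma wprodZ (a : F) x s : wprod (a *: x) s = a *: wprod x s.
Proof. by elim: s x => //= v s IH x; rewrite wedgeZl IH. Qed.

Lemma wprod_kill x s v : wedge x (vec v) = 0 -> wedge (wprod x s) (vec v) = 0.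
Proof.
elim: s x => //= u s IH x h; apply: IH.
by rewrite wedge_swap h wedge0l oppr0.
Qed.

Lemma wprod_mem x s v : v \in s -> wedge (wprod x s) (vec v) = 0.
Proof.
by case/path.splitPr => s1 s2; rewrite wprod_cat /=; apply: wprod_kill; rewrite wedge_vv.
Qed.

Lemma ctr_wprod (f : 'cV[F]_d) s : (forall u, u \in s -> \sum_i f i 0 * u 0 i = 0) ->
  ctr f (wprod (ebase F set0) s) = 0.
Proof.
elim/last_ind: s => [|s v IH] h.
  by rewrite /= ctr_ebase big1 // => i; rewrite inE.
rewrite wprod_rcons ctr_wedge h ?mem_rcons ?mem_head // scale0r IH ?wedge0l ?subr0 //.
by move=> u us; apply: h; rewrite mem_rcons inE us orbT.
Qed.

(** A nonzero product puts [n] outside the span of [s]. A column of the cokernel matrix on which [n]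
    does not vanish, normalised, is the covector. *)
Lemma separate (s : seq 'rV[F]_d) n :
  wedge (wprod (ebase F set0) s) (vec n) != 0 ->
  exists f : 'cV[F]_d, (forall u, u \in s -> \sum_i f i 0 * u 0 i = 0) /\
    \sum_i f i 0 * n 0 i = 1.
Proof.
move=> nz; pose M := \matrix_(i < size s) s`_i.
have sM u : u \in s -> (u <= M)%MS.
  move=> us; have us' : (index u s < size s)%N by rewrite index_mem.
  have <- : row (Ordinal us') M = u by rewrite rowK /= nth_index.
  exact: row_sub.
have nM : ~~ (n <= M)%MS.
  apply/negP => /submxP[a na]; case/negP: nz; apply/eqP.
  rewrite na mulmx_sum_row.
  have vs (I : finType) (X : I -> 'rV[F]_d) : vec (\sum_i X i) = \sum_i vec (X i).
    elim/big_rec2: _ => [|i y1 y2 _ <-]; last by rewrite vecD.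
    by rewrite -(scale0r (0 : 'rV[F]_d)) vecZ scale0r.
  rewrite vs wedge_sumr big1 // => i _; rewrite vecZ wedgeZr rowK.
  by rewrite wprod_mem ?scaler0 // mem_nth.
rewrite submxE in nM.
have [j nj] : exists j, (n *m cokermx M) 0 j != 0.
  by have /rV0Pn := nM.
have E (u : 'rV[F]_d) (c : F) :
    \sum_i (c *: col j (cokermx M)) i 0 * u 0 i = c * (u *m cokermx M) 0 j.
  by rewrite mxE mulr_sumr; apply: eq_bigr => i _; rewrite !mxE; ring.
exists (((n *m cokermx M) 0 j)^-1 *: col j (cokermx M)); split=> [u us|]; rewrite E.
  by have := sM u us; rewrite submxE => /eqP ->; rewrite [X in _ * X]mxE mulr0.
by rewrite mulVf.
Qed.

(* The contraction by a covector that vanishes on s and not on n turns the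
   assumption into the conclusion. *)
Lemma wprod_extend s n v :
  wprod (ebase F set0) (rcons s n) != 0 ->
  wedge (wprod (ebase F set0) (rcons s n)) (vec v) = 0 ->
  exists a, wedge (wprod (ebase F set0) s) (vec v) =
    a *: wprod (ebase F set0) (rcons s n).
Proof.
rewrite wprod_rcons => nz h; have [f [fs fn]] := separate nz.
exists (\sum_i f i 0 * v 0 i); apply/eqP; rewrite -subr_eq0 -oppr_eq0 opprB; apply/eqP.
have := congr1 (ctr f) h; rewrite !ctr_wedge fn scale1r ctr0 ctr_wprod // wedge0l subr0.
by [].
Qed.

End Ext.

Lemma map_iota_rcons (T : Type) (f : nat -> T) a n :
  [seq f i | i <- iota a n.+1] = rcons [seq f i | i <- iota a n] (f (a + n)%N).
Proof. by rewrite -map_rcons -cats1 -[n.+1]addn1 iotaD. Qed.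

(** * Decorated flags and crossing values *)

Section Flags.
Variables (F : numFieldType) (d : nat).
Hypothesis hd : (1 < d)%N.
Local Notation ext := (ext F d).
Local Notation flag := (flag F d).
Local Notation one := (ebase F set0).
Implicit Types (G H : flag) (x y z : ext) (u v : 'rV[F]_d).

Lemma ebase_neq0 (A : {set 'I_d}) : ebase F A != 0.
Proof.
by apply/eqP => /ffunP /(_ A); rewrite !ffunE eqxx => /eqP; rewrite oner_eq0.
Qed.

Lemma fl_mid G k : (0 < k < d)%N -> fl G k = G k.
Proof. by rewrite /fl; case: eqP => [->|_] //; case: eqP => [->|_] //; rewrite ltnn andbF. Qed.

Lemma fl0 G : fl G 0 = one. Proof. by []. Qed.

Lemma fld G : fl G d = vol F d.
Proof. by rewrite /fl eqxx; case: eqP => // d0; move: hd; rewrite d0. Qed.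

Lemma fl_neq0 G k : is_flag G -> (k <= d)%N -> fl G k != 0.
Proof.
move=> [gG _] kd; rewrite /fl; case: (k =P 0%N) => [_|/eqP k0]; first exact: ebase_neq0.
case: (k =P d) => [_|/eqP kd']; first exact: ebase_neq0.
by have [] := gG k; rewrite // lt0n k0 ltn_neqAle kd'.
Qed.

Lemma wedge_corank1 x (i : 'I_d) : in_ext d.-1 x ->
  wedge x (ebase F [set i]) =
  (x (~: [set i]) * sgn F (~: [set i]) [set i]) *: vol F d.
Proof.
move=> hx; rewrite {1}[x]ext_sum wedge_suml (bigD1 (~: [set i])) //= big1 ?addr0.
  rewrite wedgeZl wedge_ebase disjoint_sym disjoints1 !inE eqxx /= scalerA.
  by rewrite setUC setUCr.
move=> A Ai; rewrite wedgeZl; case: (eqVneq (x A) 0) => [->|nz]; first by rewrite scale0r.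
rewrite wedge_ebase disjoint_sym disjoints1; case: (boolP (i \in A)) => iA /=.
  by rewrite scaler0.
case/negP: Ai; rewrite eqEcard subsetC sub1set inE iA /= cardsCs setCK cards1 card_ord.
by rewrite (hx A nz) subn1.
Qed.

(** [is_flag] covers only 0 < k < d - 1. At k = 0 the vector is read off the coordinates; at k = d -
    1 a nonzero coordinate singles out a basis vector completing it to the volume form. *)
Lemma flag_step G k : is_flag G -> (k < d)%N ->
  exists v, fl G k.+1 = wedge (fl G k) (vec v).
Proof.
move=> [gG sG] kd; case: (posnP k) => [->|k0].
  have [i1 _] := gG 1%N (ltac:(lia)).
  exists (\row_i G 1%N [set i]); rewrite fl0 wedge1l fl_mid; last lia.
  rewrite {1}[G 1%N]ext_sum /vec.
  rewrite (bigID (fun A : {set 'I_d} => #|A| == 1%N)) /= [X in _ + X]big1 ?addr0.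
    rewrite (reindex_onto (fun i : 'I_d => [set i])
      (fun A : {set 'I_d} => if [pick i in A] is Some i then i else Ordinal kd)).
      apply: eq_big => [i|i _]; last by rewrite mxE.
      rewrite cards1 eqxx /=; case: pickP => [j|/(_ i)]; rewrite inE ?eqxx //.
    move=> A /cards1P[i ->]; case: pickP => [j|/(_ i)]; rewrite inE ?eqxx //.
    by move/eqP ->.
  move=> A A1; case: (eqVneq (G 1%N A) 0) => [->|/i1 /eqP]; first by rewrite scale0r.
  by rewrite (negPf A1).
case: (ltnP k d.-1) => kd1.
  have [|v hv] := sG k; first by rewrite k0.
  by exists v; rewrite !fl_mid ?hv //; lia.
have -> : k = d.-1 by lia.
have [id1 nz] := gG d.-1 (ltac:(lia)).
have [A nA] : exists A, G d.-1 A != 0.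
  apply: contrapT => none; case/negP: nz; apply/eqP/ffunP => A; rewrite ffunE.
  by apply/eqP/negPn/negP => h; apply: none; exists A.
have [i Ai] : exists i, A = ~: [set i].
  have /cards1P[i Ei] : #|~: A| == 1%N.
    by rewrite cardsCs setCK card_ord (id1 A nA); apply/eqP; lia.
  by exists i; rewrite -Ei setCK.
set a := G d.-1 A * sgn F A [set i].
have a0 : a != 0.
  by rewrite mulf_neq0 // /sgn expf_neq0 // oppr_eq0 oner_eq0.
exists (a^-1 *: delta_mx 0 i); rewrite prednK; last lia.
rewrite fld fl_mid; last lia.
have -> : vec (a^-1 *: delta_mx 0 i) = a^-1 *: ebase F [set i].
  rewrite vecZ /vec (bigD1 i) //= big1 => [|j ji]; rewrite !mxE !eqxx /=.
    by rewrite scale1r addr0.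
  by rewrite (negPf ji) scale0r.
by rewrite wedgeZr wedge_corank1 // -Ai scalerA mulVf // scale1r.
Qed.

Lemma flag_basis G : is_flag G -> exists xs : nat -> 'rV[F]_d,
  forall l, (l <= d)%N -> fl G l = wprod one [seq xs i | i <- iota 1 l].
Proof.
move=> fG; suff H k : (k <= d)%N -> exists xs : nat -> 'rV[F]_d,
    forall l, (l <= k)%N -> fl G l = wprod one [seq xs i | i <- iota 1 l].
  by have [xs h] := H d (leqnn d); exists xs.
elim: k => [|k IH] kd; first by exists (fun _ => 0) => l; rewrite leqn0 => /eqP ->.
have [xs h] := IH (ltnW kd); have [v hv] := flag_step fG kd.
exists (fun i => if i == k.+1 then v else xs i) => l lk.
have E m : (m <= k)%N -> [seq (if i == k.+1 then v else xs i) | i <- iota 1 m] =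
    [seq xs i | i <- iota 1 m].
  move=> mk; apply/eq_in_map => i; rewrite mem_iota => hi.
  by case: eqP => // ik; move: hi; rewrite ik; lia.
case: (ltnP k l) => kl; last by rewrite E // h.
have -> : l = k.+1 by lia.
by rewrite map_iota_rcons E // wprod_rcons add1n eqxx hv -h.
Qed.

Lemma fl_kill G k v : is_flag G -> (k < d)%N ->
  wedge (fl G k) (vec v) = 0 -> wedge (fl G k.+1) (vec v) = 0.
Proof.
by move=> fG kd h; have [u ->] := flag_step fG kd; rewrite wedge_swap h wedge0l oppr0.
Qed.

Lemma fl_extend G k v : is_flag G -> (0 < k <= d)%N ->
  wedge (fl G k) (vec v) = 0 -> exists a, wedge (fl G k.-1) (vec v) = a *: fl G k.
Proof.
move=> fG /andP[k0 kd]; have [xs h] := flag_basis fG.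
rewrite !h //; last lia.
case: k k0 kd => // k _ kd; rewrite [k.+1.-1]/=.
rewrite map_iota_rcons => hv.
by apply: wprod_extend hv; rewrite -map_iota_rcons -h // fl_neq0.
Qed.

(** * Crossing values and rescaling *)

(** The vector a y' - r y is killed by the component [k - 1] of G, hence by the component [k], which
    makes the two crossing equations comparable. The component [k + 1] of G' is not assumed
    proportional to that of G: for a nonzero crossing value its rescaling is an outcome, which is
    how a new component below a 6-valent vertex is found. *)
Lemma crossing_scale G H G' H' k (c c' a s r : F) : is_flag G ->
  crossing k G H c -> crossing k G' H' c' ->
  fl G' k.-1 = a *: fl G k.-1 -> fl G' k = s *: fl G k -> fl H' k = r *: fl H k ->
  (a * c') *: fl G' k.+1 = (r * c * s) *: fl G k.+1.
Proof.
move=> fG [/andP[k0 kd] _ [y [y1 y2]]] [_ _ [y' [y1' y2']]] ea es er.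
have h : wedge (fl G k.-1) (vec (a *: y' - r *: y)) = 0.
  rewrite vecB !vecZ -scaleN1r wedgeDr !wedgeZr -y1 -er y1' ea wedgeZl.
  by rewrite scaleN1r subrr.
have := fl_kill fG (ltac:(lia) : (k.-1 < d)%N) h; rewrite prednK // => /eqP.
rewrite vecB !vecZ -scaleN1r wedgeDr !wedgeZr scaleN1r subr_eq0 => /eqP E.
rewrite -scalerA -y2' es wedgeZl scalerA mulrC -[LHS]scalerA E y2 !scalerA.
by congr (_ *: _); ring.
Qed.

Lemma crossing_scale_mid G H G' H' k (c c' a s r t : F) : is_flag G ->
  crossing k G H c -> crossing k G' H' c' ->
  fl G' k.-1 = a *: fl G k.-1 -> fl G' k = s *: fl G k -> fl H' k = r *: fl H k ->
  fl G' k.+1 = t *: fl G k.+1 -> a * c' * t = r * c * s.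
Proof.
move=> fG cr cr' ea es er et; have := crossing_scale fG cr cr' ea es er.
have [/andP[_ kd] _ _] := cr; rewrite et scalerA => /eqP.
rewrite -subr_eq0 -scalerBl scaler_eq0 (negPf (fl_neq0 fG kd)) orbF subr_eq0.
by move/eqP.
Qed.

(** The unknown component K has degree one less than the colour of the middle edge, where
    [crossing_scale] says nothing about it. The first outer edge gives K' = al K + mu N, and the
    last one then gives mu (N /\ z) = 0. If N /\ z vanished, the component [j] of G3 would be a
    multiple of that of G0, which is excluded; so mu = 0. *)
Lemma hexagon_scale G0 H1 H2 G3 G0' H1' H2' G3' j (b b' e e' m n p q s al : F) :
  is_flag G0 -> is_flag H2 ->
  crossing j G0 H1 b -> crossing j G0' H1' b' ->
  crossing j H2 G3 e -> crossing j H2' G3' e' ->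
  fl H2 j = fl H1 j -> fl H2' j = fl H1' j ->
  fl H2 j.-1 = fl G0 j.-1 -> fl H2' j.-1 = fl G0' j.-1 ->
  (forall c, fl G3 j <> c *: fl G0 j) ->
  fl G0' j.-1 = m *: fl G0 j.-1 -> fl G0' j = n *: fl G0 j ->
  fl G0' j.+1 = p *: fl G0 j.+1 -> fl H2' j.+1 = q *: fl H2 j.+1 ->
  fl G3' j = s *: fl G3 j -> n != 0 -> s != 0 -> m != 0 -> b != 0 ->
  m * b' * p = al * b * n -> m * e' * q = s * e * al ->
  fl H1' j = al *: fl H1 j.
Proof.
move=> fG0 fH2 [jd _ [y [y1 y2]]] [_ _ [y' [y1' y2']]] [_ _ [z [z1 z2]]]
  [_ _ [z' [z1' z2']]] eK eK' eM eM' np em en ep eq es n0 s0 m0 b0 r1 r2.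
have [j0 jd'] := andP jd.
set K := fl H1 j in y1 eK *; set K' := fl H1' j in y1' eK' *.
set M := fl G0 j.-1 in y1 em eM np *; set N := fl G0 j in y2 en np *.
set P := fl G0 j.+1 in y2 ep; set Q := fl H2 j.+1 in z2 eq.
have h1 : wedge N (vec (n *: y' - (b' * p / b) *: y)) = 0.
  rewrite vecB !vecZ -scaleN1r wedgeDr !wedgeZr y2 -wedgeZl -en y2' ep !scalerA.
  by rewrite -scalerDl; apply/eqP; rewrite scaler_eq0; apply/orP; left; apply/eqP; field.
have [la hla] := fl_extend fG0 (ltac:(lia) : (0 < j <= d)%N) h1.
have eKK : K' = al *: K + (m * la / n) *: N.
  have : n *: K' = m *: ((b' * p / b) *: K + la *: N).
    move: hla; rewrite vecB !vecZ -scaleN1r wedgeDr !wedgeZr scaleN1r -y1 => /eqP.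
    rewrite subr_eq addrC => /eqP <-; rewrite y1' em wedgeZl !scalerA.
    by rewrite mulrC.
  move/(congr1 ( *:%R n^-1)); rewrite scalerA mulVf // scale1r => ->.
  rewrite !scalerDr !scalerA; congr (_ *: _ + _ *: _); last by field.
  by have -> : al = m * b' * p / (b * n) by [rewrite r1; field; rewrite b0 n0];
    field; rewrite b0 n0.
set mu := m * la / n in eKK.
rewrite -/M -/K in z1 z2; rewrite eM eK in z1 z2; rewrite eM' eK' em in z1' z2'.
have h2 : wedge M (vec (m *: z' - s *: z)) = 0.
  rewrite vecB !vecZ -scaleN1r wedgeDr !wedgeZr -z1 -wedgeZl -z1' es scaleN1r.
  by rewrite subrr.
have h3 : wedge N (vec (m *: z' - s *: z)) = 0.
  by rewrite /N -(prednK j0); apply: fl_kill => //; lia.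
have h4 : wedge K (vec (m *: z' - s *: z)) = 0.
  by rewrite y1 wedge_swap h2 wedge0l oppr0.
have h5 : wedge K' (vec (m *: z' - s *: z)) = 0.
  by rewrite eKK wedgeDl !wedgeZl h3 h4 !scaler0 addr0.
have : (m * e' * q) *: Q = s *: (al *: (e *: Q) + mu *: wedge N (vec z)).
  rewrite -z2 -!wedgeZl -wedgeDl -eKK -wedgeZr -vecZ -mulrA -scalerA -[_ *: Q]scalerA.
  rewrite -eq -z2' -wedgeZr -vecZ; apply/eqP; rewrite -subr_eq0.
  by rewrite -scaleN1r -wedgeZr -wedgeDr -vecZ -vecD scaleN1r h5.
rewrite r2 scalerDr !scalerA mulrAC => /eqP; rewrite -subr_eq0 opprD addrA.
rewrite subrr sub0r oppr_eq0 scaler_eq0 mulf_eq0 (negPf s0) /= => /orP[/eqP mu0|/eqP h6].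
  by rewrite eKK mu0 scale0r addr0.
have [l hl] := fl_extend fG0 (ltac:(lia) : (0 < j <= d)%N) h6.
by case: (np l); rewrite z1 hl.
Qed.

End Flags.

(** * The pairing of the end flags of a gallery along a reduced word *)

Section Gallery.
Variables (F : numFieldType) (d : nat).
Hypothesis hd : (1 < d)%N.
Local Notation one := (ebase F set0).
Variables (w : word) (Gs : nat -> flag F d) (cs : nat -> F) (k : nat).
Hypotheses (lw : all (letters d) w) (aw : asc w id) (kd : (0 < k < d)%N)
  (sw : sortd d k (pure w id))
  (fG : forall m, (m <= size w)%N -> is_flag (Gs m))
  (cr : forall m, (m < size w)%N -> crossing (nth 0%N w m) (Gs m) (Gs m.+1) (cs m))
  (cs0 : forall m, (m < size w)%N -> cs m != 0).

Local Notation val m := (pure (take m w) id).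

Lemma iota_split i n : (0 < i <= n)%N ->
  iota 1 n = iota 1 i.-1 ++ i :: iota i.+1 (n - i).
Proof.
case: i => // i /andP[_ h]; have {1}-> : n = (i + (n - i))%N by lia.
rewrite iotaD add1n; congr (_ ++ _); have -> : (n - i = (n - i.+1).+1)%N by lia.
by [].
Qed.

Lemma iota_split2 i n : (0 < i < n)%N ->
  iota 1 n = iota 1 i.-1 ++ [:: i, i.+1 & iota i.+2 (n - i.+1)].
Proof.
move=> h; rewrite (@iota_split i); last lia.
have -> : (n - i = (n - i.+1).+1)%N by lia.
by [].
Qed.

(** The change of basis has determinant 1. *)
Lemma wprod_sl2 (Y : ext F d) (c z : F) (a b : 'rV[F]_d) : c != 0 ->
  wprod Y [:: c *: b + z *: a; - (c^-1) *: a] = wprod Y [:: a; b].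
Proof.
move=> c0; rewrite /wprod /= !vecD !vecZ wedgeZr wedgeDr wedgeDl !wedgeZr !wedgeZl.
rewrite wedge_vv scaler0 addr0 scalerA mulNr mulVf // scaleN1r.
by rewrite [RHS]wedge_swap.
Qed.

(* The vectors xs span the flag Gs m, and those in the positions of the values
   above k complete Gs 0 k to the volume form. *)
Definition gallery_basis m (xs : nat -> 'rV[F]_d) :=
  [/\ forall l, (l <= d)%N -> fl (Gs m) l = wprod one [seq xs i | i <- iota 1 l],
      forall l, (0 < l <= d)%N -> (val m l <= k)%N ->
        wedge (fl (Gs 0%N) k) (vec (xs l)) = 0 &
      wprod (fl (Gs 0%N) k) [seq xs i | i <- iota 1 d & (k < val m i)%N] =
      (\prod_(e < m) (if (va w e <= k < vb w e)%N then cs e else 1)) *: vol F d].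

Lemma gallery_basis0 : exists xs, gallery_basis 0 xs.
Proof.
have [xs h] := flag_basis hd (fG (leq0n _)); exists xs; split=> //.
  move=> l ld; rewrite take0 /= => lk; rewrite h; last lia.
  by apply: wprod_mem; apply: map_f; rewrite mem_iota; lia.
rewrite take0 big_ord0 scale1r /= h; last lia.
rewrite -wprod_cat -map_cat.
have -> : [seq i <- iota 1 d | (k < i)%N] = iota k.+1 (d - k).
  have {1}-> : d = (k + (d - k))%N by lia.
  rewrite iotaD filter_cat add1n (@eq_in_filter _ _ pred0 (iota 1 k)); last first.
    by move=> i; rewrite mem_iota /=; lia.
  rewrite filter_pred0 (@eq_in_filter _ _ predT) ?filter_predT //.
  by move=> i; rewrite mem_iota /=; lia.
by rewrite -[k.+1]add1n -iotaD subnKC -?h ?fld //; lia.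
Qed.

(** Crossing an edge changes the basis only in positions i and i + 1, by the unimodular matrix of
    [wprod_sl2]. The completing product picks up a factor only if exactly the second value exceeds
    [k]: the vector kept is then c times the old one, up to a vector that the component [k] of
    [Gs 0] kills. *)
Lemma gallery_basisS m xs : (m < size w)%N -> gallery_basis m xs ->
  exists xs', gallery_basis m.+1 xs'.
Proof.
move=> mw [I1 I2 I3]; set i := nth 0%N w m.
have /andP[i0 id] : letters d i by apply: (allP lw); rewrite mem_nth.
have [_ [rp _] [y [y1 y2]]] := cr mw; rewrite -/i in rp y1 y2.
have vS : val m.+1 = swp i (val m).
  by rewrite (take_nth 0%N mw) -cats1 pure_cat.
have lt : (val m i < val m i.+1)%N := asc_nth aw mw.
have c0 := cs0 mw; set c := cs m in c0 y2.
have fGm := fG (ltnW mw).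
have flS : fl (Gs m) i.+1 = wedge (fl (Gs m) i) (vec (xs i.+1)).
  by rewrite !I1 ?map_iota_rcons ?wprod_rcons //; lia.
have fli : fl (Gs m) i = wedge (fl (Gs m) i.-1) (vec (xs i)).
  rewrite !I1; try lia.
  by rewrite -{1}(prednK i0) map_iota_rcons wprod_rcons add1n prednK.
(* [y] and [c *: xs i.+1] have the same product with the component [i], so they agree up to a
   multiple of [xs i] modulo the span below. *)
have [z hz] : exists z, wedge (fl (Gs m) i.-1) (vec (y - c *: xs i.+1)) = z *: fl (Gs m) i.
  apply: (fl_extend hd) => //; first lia.
  by rewrite vecB vecZ -scaleN1r wedgeDr !wedgeZr y2 flS scaleN1r subrr.
pose a := c *: xs i.+1 + z *: xs i; pose a' := - (c^-1) *: xs i.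
have ya : fl (Gs m.+1) i = wedge (fl (Gs m) i.-1) (vec a).
  rewrite y1 /a -[y](subrK (c *: xs i.+1)) vecD wedgeDr hz fli -wedgeZr -vecZ.
  by rewrite -wedgeDr -vecD addrC.
pose xs' l := if l == i then a else if l == i.+1 then a' else xs l.
have xi : xs' i = a by rewrite /xs' eqxx.
have xi1 : xs' i.+1 = a' by rewrite /xs' eqxx; case: eqP => //; lia.
have xo l : l != i -> l != i.+1 -> xs' l = xs l.
  by rewrite /xs' => /negPf -> /negPf ->.
have pre l : (l < i)%N -> [seq xs' j | j <- iota 1 l] = [seq xs j | j <- iota 1 l].
  by move=> li; apply/eq_in_map => j; rewrite mem_iota => hj; rewrite xo //; lia.
have post l : [seq xs' j | j <- iota i.+2 l] = [seq xs j | j <- iota i.+2 l].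
  by apply/eq_in_map => j; rewrite mem_iota => hj; rewrite xo //; lia.
have flo l : (l <= d)%N -> l != i -> fl (Gs m.+1) l = fl (Gs m) l.
  move=> ld li; case: (posnP l) => [->//|l0]; case: (ltnP l d) => ld'.
    by rewrite !fl_mid ?(rp l) //; [apply/eqP|..]; lia.
  by have -> : l = d; [lia|rewrite !fld].
have cons2 Y (p q : 'rV[F]_d) s : wprod Y [:: p, q & s] = wprod (wprod Y [:: p; q]) s.
  by [].
exists xs'; split.
- move=> l ld; case: (ltngtP l i) => li.
  + by rewrite pre // -I1 // flo //; lia.
  + rewrite flo ?I1 //; last lia.
    rewrite !(@iota_split2 i l) ?map_cat /= ?i0 // xi xi1 post pre; last lia.
    by rewrite !wprod_cat [RHS]cons2 /a /a' wprod_sl2.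
  rewrite li ya -(prednK i0) map_iota_rcons wprod_rcons add1n prednK // xi pre; last lia.
  by rewrite I1 //; lia.
- move=> l ld; rewrite vS => vl; case: (eqVneq l i) => [li|li].
    move: vl; rewrite li swpl xi => vl; rewrite vecD !vecZ wedgeDr !wedgeZr.
    by rewrite !I2 ?scaler0 ?addr0 //; lia.
  case: (eqVneq l i.+1) => [li'|li'].
    move: vl; rewrite li' swpr xi1 => vl; rewrite vecZ wedgeZr.
    by rewrite I2 ?scaler0 //; lia.
  by rewrite xo // I2 // -(swpD _ li li').
move: I3; rewrite !(@iota_split2 i d) ?i0 // !filter_cat !map_cat !wprod_cat.
have E1 : [seq j <- iota 1 i.-1 | (k < val m.+1 j)%N] =
          [seq j <- iota 1 i.-1 | (k < val m j)%N].
  by apply: eq_in_filter => j; rewrite mem_iota vS => hj; rewrite swpD //; lia.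
have E2 : [seq j <- iota i.+2 (d - i.+1) | (k < val m.+1 j)%N] =
          [seq j <- iota i.+2 (d - i.+1) | (k < val m j)%N].
  by apply: eq_in_filter => j; rewrite mem_iota vS => hj; rewrite swpD //; lia.
rewrite E1 (_ : [seq xs' j | j <- [seq j <- iota 1 i.-1 | (k < val m j)%N]] =
  [seq xs j | j <- [seq j <- iota 1 i.-1 | (k < val m j)%N]]); last first.
  apply/eq_in_map => j; rewrite mem_filter mem_iota => /andP[_ hj].
  by rewrite xo //; lia.
set Y := wprod _ [seq xs j | j <- [seq j <- iota 1 i.-1 | (k < val m j)%N]].
pose R := [seq j <- iota i.+2 (d - i.+1) | (k < val m j)%N].
have ER : [seq xs' j | j <- R] = [seq xs j | j <- R].
  apply/eq_in_map => j; rewrite mem_filter mem_iota => /andP[_ hj].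
  by rewrite xo //; lia.
rewrite /= E2 -/R vS swpl swpr big_ord_recr /= -/(va w m) -/(vb w m).
have eva : va w m = val m i by []. 
have evb : vb w m = val m i.+1 by [].
rewrite eva evb.
have kill j : (0 < j <= d)%N -> (val m j <= k)%N -> wedge Y (vec (xs j)) = 0.
  by move=> jd jk; apply: wprod_kill; apply: I2.
case: (ltnP k (val m i)) => ki.
  have -> : (k < val m i.+1)%N by lia.
  by rewrite [in X in _ -> X = _]map_cons [in X in _ -> X = _]map_cons ER xi xi1 mulr1 [X in _ -> X = _]cons2 /a /a' wprod_sl2.
case: (ltnP k (val m i.+1)) => ki1 /=; last by rewrite ER mulr1.
rewrite ER xi vecD !vecZ wedgeDr !wedgeZr (kill i) //; last lia.
by rewrite scaler0 addr0 wprodZ => ->; rewrite scalerA mulrC.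
Qed.

(** At the end the values above [k] occupy exactly the first [d - k] positions, so the accumulated
    product is the wedge with the last flag. *)
Lemma gallery_det :
  det (wedge (fl (Gs 0%N) k) (fl (Gs (size w)) (d - k))) =
  \prod_(e < size w) (if (va w e <= k < vb w e)%N then cs e else 1).
Proof.
have H m : (m <= size w)%N -> exists xs, gallery_basis m xs.
  elim: m => [|m IH] mw; first exact: gallery_basis0.
  by have [xs h] := IH (ltnW mw); apply: gallery_basisS h.
have [xs [I1 _ I3]] := H _ (leqnn _); move: I3; rewrite take_size => I3.
rewrite I1; last lia.
rewrite wedge_wprod wedge1r.
rewrite (_ : iota 1 (d - k) = [seq i <- iota 1 d | (k < pure w id i)%N]) ?I3.
  by rewrite /det !ffunE eqxx /GRing.scale /= mulr1.
have Nd : N (thr k (pure w id)) d = k.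
  by rewrite -asc_run //; apply: N_run_id => //; lia.
have Nt t : (t <= d)%N -> N (thr k (pure w id)) t = (t - (d - k))%N.
  by move=> td; apply: sortd_N => //; lia.
have {2}-> : d = ((d - k) + k)%N by lia.
rewrite iotaD filter_cat (@eq_in_filter _ _ predT (iota 1 _)); last first.
  move=> j; rewrite mem_iota => hj /=; have := Nt j; have := Nt j.-1.
  by have := NS (thr k (pure w id)) j.-1; rewrite prednK /thr; lia.
rewrite filter_predT (@eq_in_filter _ _ pred0) ?filter_pred0 ?cats0 //.
move=> j; rewrite mem_iota => hj /=; have := Nt j; have := Nt j.-1.
by have := NS (thr k (pure w id)) j.-1; rewrite prednK /thr; lia.
Qed.

End Gallery.

(** * Polynomial functions *)

Section Nonvanishing.
Variable F : numFieldType.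

Lemma poly_nonroot (q : {poly F}) : q != 0 -> exists2 t, t != 0 & q.[t] != 0.
Proof.
(* The factor ['X] keeps the point away from 0. *)
move=> q0; have qX : q * 'X != 0 by rewrite mulf_neq0 ?polyX_eq0.
apply: contrapT => none.
have := max_poly_roots (rs := [seq i%:R | i <- iota 0 (size (q * 'X))]) qX.
rewrite size_map size_iota ltnn => H; suff: false by []. apply: H.
  apply/allP => _ /mapP[i _ ->]; apply/negPn/negP => h; apply: none.
  move: h; rewrite /root hornerM hornerX mulf_eq0 negb_or => /andP[h1 h2].
  by exists i%:R.
rewrite map_inj_uniq ?iota_uniq // => i j /eqP.
by rewrite eqr_nat => /eqP.
Qed.

Lemma poly_vanish (q : {poly F}) : (forall x, x != 0 -> q.[x] = 0) -> q = 0.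
Proof.
move=> h; apply/eqP/negPn/negP => /poly_nonroot[t t0].
by rewrite h ?eqxx.
Qed.

Lemma digits_inj B n (a b : 'I_n -> nat) :
  (forall i, (a i < B)%N) -> (forall i, (b i < B)%N) ->
  (\sum_i a i * B ^ i = \sum_i b i * B ^ i)%N -> a =1 b.
Proof.
elim: n a b => [|n IH] a b aB bB; first by move=> _ [].
have B0 : (0 < B)%N by apply: leq_ltn_trans (aB ord0).
rewrite !big_ord_recl /= !expn0 !muln1.
have E (c : 'I_n.+1 -> nat) : (\sum_(i < n) c (lift ord0 i) * B ^ bump 0 i =
    B * \sum_(i < n) c (lift ord0 i) * B ^ i)%N.
  by rewrite big_distrr /=; apply: eq_bigr => i _; rewrite /bump /= add1n expnS; lia.
rewrite !E => h.
have h0 : a ord0 = b ord0.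
  by have := congr1 (modn^~ B) h; rewrite /= ![(_ + B * _)%N]addnC ![(B * _)%N]mulnC !modnMDl !modn_small.
have h1 : (\sum_(i < n) a (lift ord0 i) * B ^ i = \sum_(i < n) b (lift ord0 i) * B ^ i)%N.
  by move/eqP: h; rewrite h0 eqn_add2l eqn_pmul2l // => /eqP.
have h2 := IH (fun i => a (lift ord0 i)) (fun i => b (lift ord0 i))
  (fun i => aB _) (fun i => bB _) h1.
by move=> i; case: (unliftP ord0 i) => [j ->|->].
Qed.

(* Kronecker substitution: distinct monomials become distinct powers of t. *)
Lemma mpoly_nonroot m (P : {mpoly F[m]}) : P != 0 ->
  exists v : 'I_m -> F, P.@[v] != 0.
Proof.
move=> P0; pose B := msize P; pose ka (e : 'X_{1..m}) := (\sum_i e i * B ^ i)%N.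
have eB e : e \in msupp P -> forall i, (e i < B)%N.
  move=> es i; apply: leq_ltn_trans (msize_mdeg_lt es).
  by rewrite mdegE (bigD1 i) //= leq_addr.
pose q : {poly F} := \sum_(e <- msupp P) P@_e *: 'X^(ka e).
have [e0 e0s] : exists e0, e0 \in msupp P.
  apply: contrapT => none; case/negP: P0; apply/eqP/mpolyP => e; rewrite mcoeff0.
  by apply: memN_msupp_eq0; apply/negP => es; apply: none; exists e.
have q0 : q != 0.
  apply/eqP => /(congr1 (fun p : {poly F} => p`_(ka e0))); rewrite coef0 coef_sum.
  rewrite (bigD1_seq e0) ?msupp_uniq //= coefZ coefXn eqxx mulr1 big_seq_cond big1.
    by rewrite addr0 => /eqP; rewrite mcoeff_eq0 e0s.
  move=> e /andP[es ne]; rewrite coefZ coefXn; case: eqP => [h|]; last by rewrite mulr0.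
  case/negP: ne; apply/eqP/mnmP => i; apply: esym; move: i.
  exact: (digits_inj (eB _ e0s) (eB _ es)).
have [t _ tq] := poly_nonroot q0; exists (fun i => t ^+ (B ^ i)).
have -> : P.@[fun i => t ^+ (B ^ i)] = q.[t] by
  rewrite mevalE horner_sum; apply: eq_bigr => e _; rewrite hornerZ hornerXn; congr (_ * _);
  rewrite -prodrXr; apply: eq_bigr => i _; rewrite -exprM mulnC.
by [].
Qed.

End Nonvanishing.

(** * Rational functions, homogeneity in one argument, invariants *)

Section Rational.
Variables (F : numFieldType) (n d : nat) (sigma : int -> int).
Local Notation polyfun := (polyfun F n d).
Local Notation ratfun := (ratfun F n d).
Local Notation mat := 'M[F]_(n, d).
Implicit Types (P Q : polyfun) (f g : ratfun) (u : mat) (r : 'I_n) (x : F).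

Lemma pevalM P Q u : peval (P * Q) u = peval P u * peval Q u.
Proof. exact: mevalM. Qed.

Lemma pevalD P Q u : peval (P + Q) u = peval P u + peval Q u.
Proof. exact: mevalD. Qed.

Lemma pevalB P Q u : peval (P - Q) u = peval P u - peval Q u.
Proof. exact: mevalB. Qed.

Lemma pevalZ a P u : peval (a *: P) u = a * peval P u.
Proof. exact: mevalZ. Qed.

Lemma peval0 u : peval (0 : polyfun) u = 0. Proof. exact: meval0. Qed.

Lemma peval1 u : peval (1 : polyfun) u = 1. Proof. exact: meval1. Qed.

Lemma peval_neq0 P : P != 0 -> exists u, peval P u != 0.
Proof.
case/mpoly_nonroot => v hv; exists (vec_mx (\row_i v i)).
by rewrite /peval vec_mxK (meval_eq (v2 := v)) // => i; rewrite mxE.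
Qed.

Lemma peval_inj P Q : (forall u, peval P u = peval Q u) -> P = Q.
Proof.
move=> h; apply/eqP; rewrite -subr_eq0; apply/negPn/negP => /peval_neq0[u].
by rewrite pevalB h subrr eqxx.
Qed.

Lemma generic_and (A B : mat -> Prop) : generically A -> generically B ->
  generically (fun u => A u /\ B u).
Proof.
move=> [G G0 hG] [H H0 hH]; exists (G * H); first exact: mulf_neq0.
by move=> u; rewrite pevalM mulf_eq0 negb_or => /andP[/hG ? /hH ?].
Qed.

Lemma generic_imp (A B : mat -> Prop) : (forall u, A u -> B u) ->
  generically A -> generically B.
Proof. by move=> h [G G0 hG]; exists G => // u /hG /h. Qed.

Lemma generic_ex (A : mat -> Prop) : generically A -> exists u, A u.
Proof. by move=> [G /peval_neq0[u hu] hG]; exists u; exact: hG. Qed.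

Lemma generic_eq P Q : generically (fun u => peval P u = peval Q u) -> P = Q.
Proof.
move=> [G G0 hG]; apply/eqP; rewrite -subr_eq0 -[_ == 0]orbF -(negbTE G0) -mulf_eq0.
apply/eqP/peval_inj => u; rewrite pevalM pevalB peval0.
case: (eqVneq (peval G u) 0) => [->|/hG ->]; first by rewrite mulr0.
by rewrite subrr mul0r.
Qed.

(** * Rescaling one argument *)

Definition scl r x u : mat := \matrix_(a, b) ((if a == r then x else 1) * u a b).

Definition inrow r (i : 'I_(n * d)) : bool := mxvec (\matrix_(a < n, b < d) (a == r)) 0 i.

Lemma mxvec_scl r x u i :
  mxvec (scl r x u) 0 i = (if inrow r i then x else 1) * mxvec u 0 i.
Proof. by case/mxvec_indexP: i => a b; rewrite /inrow !mxvecE !mxE. Qed.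

Definition psub r x P : polyfun :=
  P \mPo [tuple (if inrow r i then x else 1) *: 'X_i | i < n * d].

Lemma psubE r x P u : peval (psub r x P) u = peval P (scl r x u).
Proof.
rewrite /peval /psub comp_mpoly_meval; apply: meval_eq => i.
by rewrite tnth_mktuple mevalZ mevalXU mxvec_scl.
Qed.

Lemma psubM r x P Q : psub r x (P * Q) = psub r x P * psub r x Q.
Proof. by apply: peval_inj => u; rewrite !(psubE, pevalM). Qed.

Lemma psubD r x P Q : psub r x (P + Q) = psub r x P + psub r x Q.
Proof. by apply: peval_inj => u; rewrite !(psubE, pevalD). Qed.

Lemma psub1 r x : psub r x 1 = 1.
Proof. by apply: peval_inj => u; rewrite !(psubE, peval1). Qed.

Lemma psub0 r x : psub r x 0 = 0.
Proof. by apply: peval_inj => u; rewrite !(psubE, peval0). Qed.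

Lemma sclK r x u : x != 0 -> scl r x (scl r x^-1 u) = u.
Proof.
move=> x0; apply/matrixP => a b; rewrite !mxE; case: eqP => _; rewrite ?mul1r //.
by rewrite mulVKf.
Qed.

Lemma psub_eq0 r x P : x != 0 -> P != 0 -> psub r x P != 0.
Proof.
move=> x0 /peval_neq0[u hu]; apply: contraNneq hu => h.
by rewrite -(sclK r u x0) -psubE h peval0.
Qed.

Lemma generic_scl r x (A : mat -> Prop) : x != 0 -> generically A ->
  generically (fun u => A (scl r x u)).
Proof.
move=> x0 [G G0 hG]; exists (psub r x G); first exact: psub_eq0.
by move=> u; rewrite psubE => /hG.
Qed.

(** * Homogeneity of rational functions *)

Lemma frac_eq P Q P' Q' : Q != 0 -> Q' != 0 ->
  (P%:F / Q%:F == P'%:F / Q'%:F :> ratfun) = (P * Q' == P' * Q).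
Proof.
move=> Q0 Q0'.
by rewrite eqr_div ?tofrac_eq0 // -!tofracM tofrac_eq.
Qed.

(** Cross-multiplied, so that it is a polynomial identity and admits negative degrees. By [hom_rep]
    it does not depend on the fraction chosen. *)
Definition hom r (a : int) f := exists P Q,
  [/\ Q != 0, f = P%:F / Q%:F &
      forall x, x != 0 -> psub r x P * Q = (x ^ a) *: (P * psub r x Q)].

Lemma hom_rep r a f P Q : hom r a f -> Q != 0 -> f = P%:F / Q%:F ->
  forall x, x != 0 -> psub r x P * Q = (x ^ a) *: (P * psub r x Q).
Proof.
move=> [P0 [Q0 [Q00 fE h0]]] Qn0 fE' x x0.
have /eqP E : P0 * Q == P * Q0 by rewrite -frac_eq // -fE -fE'.
have E' := congr1 (psub r x) E; rewrite !psubM in E'.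
have nz : psub r x Q0 * Q0 != 0 by rewrite mulf_neq0 ?psub_eq0.
apply: (mulIf nz); have := h0 x x0; move: E E'.
rewrite -!mul_mpolyC; set c := (x ^ a)%:MP.
set p := psub _ _ P; set p0 := psub _ _ P0; set q := psub _ _ Q; set q0 := psub _ _ Q0.
move=> E E' h.
have -> : p * Q * (q0 * Q0) = (p * q0) * (Q * Q0) by ring.
rewrite -E'; have -> : p0 * q * (Q * Q0) = (p0 * Q0) * (q * Q) by ring.
rewrite h; have -> : c * (P0 * q0) * (q * Q) = c * q0 * q * (P0 * Q) by ring.
by rewrite E; ring.
Qed.

Lemma hom0 r a : hom r a 0.
Proof.
exists 0, 1; split; rewrite ?oner_neq0 ?tofrac0 ?mul0r // => x _.
by rewrite psub0 !mul0r scaler0.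
Qed.

Lemma hom1 r : hom r 0 1.
Proof.
exists 1, 1; split; rewrite ?oner_neq0 ?tofrac1 ?divr1 // => x _.
by rewrite psub1 expr0z scale1r.
Qed.

Lemma homM r a b f g : hom r a f -> hom r b g -> hom r (a + b) (f * g).
Proof.
move=> [P [Q [Q0 -> h]]] [P' [Q' [Q0' -> h']]]; exists (P * P'), (Q * Q').
split; [exact: mulf_neq0 | by rewrite !tofracM mulf_div | move=> x x0].
have := h x x0; have := h' x x0; rewrite !psubM expfzDr // -!mul_mpolyC mpolyCM.
set p := psub _ _ P; set p' := psub _ _ P'; set q := psub _ _ Q; set q' := psub _ _ Q'.
move=> e' e; have -> : p * p' * (Q * Q') = (p * Q) * (p' * Q') by ring.
by rewrite e e'; ring.
Qed.

Lemma homV r a f : hom r a f -> hom r (- a) f^-1.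
Proof.
move=> [P [Q [Q0 -> h]]]; case: (eqVneq P 0) => [->|P0].
  by rewrite tofrac0 mul0r invr0; exact: hom0.
exists Q, P; split; [exact: P0 | exact: invf_div | move=> x x0].
by rewrite [Q * _]mulrC h // scalerA -expfzDr // addNr expr0z scale1r mulrC.
Qed.

Lemma homD r a f g : hom r a f -> hom r a g -> hom r a (f + g).
Proof.
move=> [P [Q [Q0 -> h]]] [P' [Q' [Q0' -> h']]]; exists (P * Q' + P' * Q), (Q * Q').
split; first exact: mulf_neq0.
  by rewrite addf_div ?tofrac_eq0 // -!tofracM -tofracD.
move=> x x0; have := h x x0; have := h' x x0; rewrite psubD !psubM -!mul_mpolyC.
set p := psub _ _ P; set p' := psub _ _ P'; set q := psub _ _ Q; set q' := psub _ _ Q'.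
move=> e' e.
have -> : (p * q' + p' * q) * (Q * Q') = (p * Q) * (q' * Q') + (p' * Q') * (q * Q) by ring.
by rewrite e e'; ring.
Qed.

Lemma homX r a f m : hom r a f -> hom r (a * m%:Z) (f ^+ m).
Proof.
move=> h; elim: m => [|m IH]; first by rewrite mulr0; exact: hom1.
by rewrite exprS -[m.+1]add1n PoszD mulrDr mulr1; exact: homM.
Qed.

Lemma hom_prod r (I : finType) (a : I -> int) (f : I -> ratfun) :
  (forall i, hom r (a i) (f i)) -> hom r (\sum_i a i) (\prod_i f i).
Proof.
by move=> h; elim/big_ind2: _ => [|*|*]; [exact: hom1|exact: homM|exact: h].
Qed.

(** The degrees are compared at x = 2, no nontrivial power of which is 1. *)
Lemma hom_uniq r a b f : f != 0 -> hom r a f -> hom r b f -> a = b.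
Proof.
move=> f0 ha [P [Q [Q0 fE hb]]]; have := hom_rep ha Q0 fE.
have P0 : P != 0 by apply: contraNneq f0 => P0; rewrite fE P0 tofrac0 mul0r.
have x0 : 2 != 0 :> F by rewrite pnatr_eq0.
move/(_ 2 x0); rewrite hb // -!mul_mpolyC => E.
have {}E : (2 ^ b)%:MP = (2 ^ a)%:MP :> polyfun.
  by apply: (mulIf _ E); rewrite mulf_neq0 ?psub_eq0.
have /eqP : (2 : F) ^ (a - b) = 1.
  have := congr1 (fun p : polyfun => peval p 0) E; rewrite /peval !mevalC => e.
  by rewrite expfzDr // -e -expfzDr // subrr expr0z.
rewrite pexprz_eq1 ?ler0n // subr_eq0 => /orP[/eqP //|].
by rewrite -[1]/(1%:R) eqr_nat.
Qed.

(** * Values *)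

Lemma has_value_rep f u c P Q : Q != 0 -> f = P%:F / Q%:F -> has_value f u c ->
  peval P u = c * peval Q u.
Proof.
move=> Q0 fE [P0 [Q1 [fE0 q1 ->]]].
have Q10 : Q1 != 0 by apply: contraNneq q1 => ->; rewrite peval0.
have /eqP E : P * Q1 == P0 * Q by rewrite -frac_eq // -fE -fE0.
have := congr1 (fun p => peval p u) E; rewrite !pevalM => e.
by apply: (mulIf q1); rewrite e; field.
Qed.

Lemma generic_rep f (A : mat -> Prop) : generically A ->
  (forall u, A u -> exists c, has_value f u c) ->
  exists P Q, Q != 0 /\ f = P%:F / Q%:F.
Proof.
move=> /generic_ex[u Au] /(_ u Au)[c [P [Q [fE q0 _]]]]; exists P, Q; split=> //.
by apply: contraNneq q0 => ->; rewrite peval0.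
Qed.

Lemma value_eq f g :
  generically (fun u => exists c, has_value f u c /\ has_value g u c) -> f = g.
Proof.
move=> gen; have [P [Q [Q0 fE]]] : exists P Q, Q != 0 /\ f = P%:F / Q%:F.
  by apply: (generic_rep gen) => u [c []]; exists c.
have [P' [Q' [Q0' gE]]] : exists P Q, Q != 0 /\ g = P%:F / Q%:F.
  by apply: (generic_rep gen) => u [c []]; exists c.
apply/eqP; rewrite fE gE frac_eq //; apply/eqP/generic_eq.
apply: generic_imp gen => u [c [h h']]; rewrite !pevalM.
by rewrite (has_value_rep Q0 fE h) (has_value_rep Q0' gE h'); ring.
Qed.

Lemma hom_value r a f :
  (forall x, x != 0 -> generically (fun u => exists c,
     has_value f u c /\ has_value f (scl r x u) (x ^ a * c))) -> hom r a f.
Proof.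
move=> gen; have [P [Q [Q0 fE]]] : exists P Q, Q != 0 /\ f = P%:F / Q%:F.
  apply: (generic_rep (gen 1 (oner_neq0 _))) => u [c [h _]]; by exists c.
exists P, Q; split=> // x x0; apply: generic_eq.
apply: generic_imp (gen x x0) => u [c [h h']]; rewrite pevalZ !pevalM !psubE.
by rewrite (has_value_rep Q0 fE h) (has_value_rep Q0 fE h'); ring.
Qed.

Lemma has_value_neq0 f u c : has_value f u c -> c != 0 -> f != 0.
Proof.
move=> h c0; have [P [Q [fE q0 cE]]] := h; apply: contraNneq c0 => f0.
have Q0 : Q != 0 by apply: contraNneq q0 => ->; rewrite peval0.
have := @has_value_rep f u c 0 1 (oner_neq0 _).
rewrite tofrac0 mul0r peval0 peval1 mulr1 => H.
by rewrite -(H f0 h).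
Qed.

(** * Homogeneous components *)

Definition rdeg r (m : 'X_{1..n * d}) : nat := (\sum_(i | inrow r i) m i)%N.

Definition comp r b P : polyfun :=
  \sum_(m <- msupp P | rdeg r m == b) P@_m *: 'X_[m].

Definition rowhom r b P := all (fun m => rdeg r m == b) (msupp P).

Lemma mono_scl r x u (m : 'X_{1..n * d}) :
  \prod_i mxvec (scl r x u) 0 i ^+ m i =
  x ^+ rdeg r m * \prod_i mxvec u 0 i ^+ m i.
Proof.
rewrite /rdeg -prodrXr [X in X * _]big_mkcond -big_split /=; apply: eq_bigr => i _.
by rewrite mxvec_scl exprMn; case: ifP => _ //; rewrite expr1n.
Qed.

Lemma msupp_comp r b P m : m \in msupp (comp r b P) -> m \in msupp P /\ rdeg r m = b.
Proof.
rewrite !mcoeff_msupp /comp raddf_sum /= => h.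
have [e] : exists e, [&& e \in msupp P, rdeg r e == b & e == m].
  apply: contrapT => none; case/negP: h; rewrite big_seq_cond big1 // => e /andP[es eb].
  rewrite mcoeffZ mcoeffX; case: eqP => [em|_]; last by rewrite mulr0.
  by case: none; exists e; rewrite es eb em eqxx.
by case/and3P=> es /eqP eb /eqP <-; rewrite -mcoeff_msupp.
Qed.

Lemma rowhom_comp r b P : rowhom r b (comp r b P).
Proof. by apply/allP => m /msupp_comp[_ ->]. Qed.

Lemma rowhom_comp2 r b r' b' P : rowhom r' b' P -> rowhom r' b' (comp r b P).
Proof. by move=> /allP h; apply/allP => m /msupp_comp[/h]. Qed.

Lemma comp_sum r P : exists B0, forall B, (B0 <= B)%N -> forall x u,
  peval P (scl r x u) = \sum_(b < B) x ^+ b * peval (comp r b P) u.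
Proof.
exists (\max_(m <- msupp P) rdeg r m).+1 => B hB x u.
transitivity (\sum_(m <- msupp P) x ^+ rdeg r m * (P@_m * \prod_i mxvec u 0 i ^+ m i)).
  rewrite /peval mevalE; apply: eq_bigr => m _; by rewrite mono_scl mulrCA.
have E b : peval (comp r b P) u =
    \sum_(m <- msupp P | rdeg r m == b) P@_m * \prod_i mxvec u 0 i ^+ m i.
  rewrite /peval /comp raddf_sum /=; apply: eq_bigr => m _.
  by rewrite mevalZ mevalX.
under [RHS]eq_bigr => b _ do rewrite E big_distrr /=.
rewrite (exchange_big_dep predT) //= big_seq [RHS]big_seq; apply: eq_bigr => m ms.
have mB : (rdeg r m < B)%N.
  by apply: leq_trans hB; rewrite ltnS (big_rem _ ms) /= leq_maxl.
rewrite (bigD1 (Ordinal mB)) //= [X in _ + X]big1 ?addr0 // => b /andP[/eqP h].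
by rewrite -val_eqE /= h eqxx.
Qed.

(** * Invariants *)

Local Notation act := (SLact sigma).
Local Notation in_R := (in_R sigma).
Local Notation in_K := (in_K sigma).

Lemma in_R0 : in_R (0 : polyfun).
Proof. by move=> g _ u; rewrite !peval0. Qed.

Lemma in_R1 : in_R (1 : polyfun).
Proof. by move=> g _ u; rewrite !peval1. Qed.

Lemma in_RM P Q : in_R P -> in_R Q -> in_R (P * Q).
Proof. by move=> hP hQ g g1 u; rewrite !pevalM hP ?hQ. Qed.

Lemma in_RD P Q : in_R P -> in_R Q -> in_R (P + Q).
Proof. by move=> hP hQ g g1 u; rewrite !pevalD hP ?hQ. Qed.

Lemma in_K0 : in_K (0 : ratfun).
Proof.
exists 0, 1; split; rewrite ?oner_neq0 ?tofrac0 ?mul0r //; [exact: in_R0|exact: in_R1].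
Qed.

Lemma in_K1 : in_K (1 : ratfun).
Proof.
exists 1, 1; split; rewrite ?oner_neq0 ?tofrac1 ?divr1 //; exact: in_R1.
Qed.

Lemma in_KM f g : in_K f -> in_K g -> in_K (f * g).
Proof.
move=> [P [Q [hP hQ Q0 ->]]] [P' [Q' [hP' hQ' Q0' ->]]]; exists (P * P'), (Q * Q').
by split; rewrite ?mulf_neq0 // ?mulf_div ?tofracM //; exact: in_RM.
Qed.

Lemma in_KD f g : in_K f -> in_K g -> in_K (f + g).
Proof.
move=> [P [Q [hP hQ Q0 ->]]] [P' [Q' [hP' hQ' Q0' ->]]].
exists (P * Q' + P' * Q), (Q * Q'); split; rewrite ?mulf_neq0 //.
- by apply: in_RD; exact: in_RM.
- exact: in_RM.
by rewrite addf_div ?tofrac_eq0 // -!tofracM -tofracD.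
Qed.

Lemma in_KV f : in_K f -> in_K f^-1.
Proof.
move=> [P [Q [hP hQ Q0 ->]]]; case: (eqVneq P 0) => [->|P0].
  by rewrite tofrac0 mul0r invr0; exact: in_K0.
by exists Q, P; split; rewrite ?invf_div.
Qed.

Lemma in_KX f m : in_K f -> in_K (f ^+ m).
Proof. by move=> h; elim: m => [|m IH]; [exact: in_K1|rewrite exprS; exact: in_KM]. Qed.

Lemma in_K_prod (I : finType) (f : I -> ratfun) :
  (forall i, in_K (f i)) -> in_K (\prod_i f i).
Proof.
by move=> h; elim/big_ind: _ => [|*|*]; [exact: in_K1|exact: in_KM|exact: h].
Qed.

Lemma act_scl (g : 'M[F]_d) r x u : act g (scl r x u) = scl r x (act g u).
Proof.
have E a : row a (scl r x u) = (if a == r then x else 1) *: row a u.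
  by apply/rowP => b; rewrite !mxE.
apply/matrixP => a b; rewrite !mxE; case: ifP => _; rewrite E -scalemxAl !mxE //.
Qed.

Lemma coeffs_eq0 B (c : nat -> F) : (forall x, x != 0 -> \sum_(b < B) x ^+ b * c b = 0) ->
  forall b, (b < B)%N -> c b = 0.
Proof.
move=> h b bB; have /(congr1 (fun p : {poly F} => p`_b)) : \poly_(i < B) c i = 0.
  apply: poly_vanish => x x0; rewrite horner_poly -[RHS](h x x0).
  by apply: eq_bigr => i _; rewrite mulrC.
by rewrite coef_poly bB coef0.
Qed.

(** Rescaling an argument commutes with the group action, so invariance can be read off coefficient
    by coefficient in x. *)
Lemma in_R_comp r b P : in_R P -> in_R (comp r b P).
Proof.
move=> hP g g1 u; have [B0 hB] := comp_sum r P; apply/eqP; rewrite -subr_eq0; apply/eqP.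
pose B := maxn B0 b.+1.
apply: (@coeffs_eq0 B (fun b => peval (comp r b P) (act g u) - peval (comp r b P) u)).
  move=> x x0; under eq_bigr => i _ do rewrite mulrBr.
  by rewrite sumrB -!hB ?leq_maxl // -act_scl hP // subrr.
by rewrite leq_maxr.
Qed.

Lemma comp_neq0 r P : P != 0 -> exists b, comp r b P != 0.
Proof.
move=> /peval_neq0[u hu]; have [B0 hB] := comp_sum r P; apply: contrapT => none.
case/negP: hu; have -> : u = scl r 1 u.
  by apply/matrixP => a b; rewrite mxE if_same mul1r.
rewrite (hB B0) // big1 // => b _.
have -> : comp r b P = 0; last by rewrite peval0 mulr0.
by apply/eqP/negPn/negP => h; apply: none; exists (b : nat).
Qed.

(** For a nonzero component of Q of degree c, comparing coefficients in the homogeneity identity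
    gives P Q_c = P_(c+a) Q, so f is also P_(c+a) / Q_c. Components preserve invariance and
    homogeneity in the other arguments, so the arguments can be treated one at a time. *)
Lemma row_step r a f P Q : f != 0 -> hom r a f ->
  in_R P -> in_R Q -> Q != 0 -> f = P%:F / Q%:F ->
  exists P' Q', [/\ in_R P', in_R Q', Q' != 0, f = P'%:F / Q'%:F &
    [/\ exists b, rowhom r b P', exists c, rowhom r c Q',
       forall r' b, rowhom r' b P -> rowhom r' b P' &
       forall r' b, rowhom r' b Q -> rowhom r' b Q']].
Proof.
move=> f0 hf hP hQ Q0 fE; have [c c0] := comp_neq0 r Q0.
have P0 : P != 0 by apply: contraNneq f0 => P0; rewrite fE P0 tofrac0 mul0r.
(* As [a] may be negative, both sides are multiplied by [x ^+ A]; then the exponents are natural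
   numbers and [A' - A = a]. *)
pose A := absz a; pose A' := absz (a + A%:Z).
have AA : (A'%:Z = a + A%:Z)%R by rewrite /A' /A; lia.
have key u : peval (P * comp r c Q) u =
    if (A <= c + A')%N then peval (comp r (c + A' - A)%N P * Q) u else 0.
  have [B1 h1] := comp_sum r P; have [B2 h2] := comp_sum r Q.
  pose B := (B1 + B2 + c + A').+1%N.
  have k1 x v : peval P (scl r x v) = \sum_(b < B) x ^+ b * peval (comp r b P) v.
    by apply: h1; rewrite /B; lia.
  have k2 x v : peval Q (scl r x v) = \sum_(b < B) x ^+ b * peval (comp r b Q) v.
    by apply: h2; rewrite /B; lia.
  pose p : {poly F} := \sum_(b < B) (peval (comp r b P) u * peval Q u) *: 'X^(b + A)%N
    - \sum_(b < B) (peval P u * peval (comp r b Q) u) *: 'X^(b + A')%N.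
  have p0 : p = 0.
    apply: poly_vanish => x x0; rewrite /p hornerD hornerN !horner_sum.
    under eq_bigr => b _ do rewrite hornerZ hornerXn exprD.
    under [X in _ - X]eq_bigr => b _ do rewrite hornerZ hornerXn exprD.
    have := congr1 (fun q => peval q u) (hom_rep hf Q0 fE x0).
    rewrite pevalZ !pevalM !psubE k1 k2 mulr_suml !mulr_sumr => /(congr1 (fun z => x ^+ A * z)).
    rewrite !mulr_sumr => E; apply/eqP; rewrite subr_eq0; apply/eqP.
    transitivity (\sum_(i < B) x ^+ A * (x ^+ i * peval (comp r i P) u * peval Q u)).
      by apply: eq_bigr => i _; ring.
    rewrite E; apply: eq_bigr => i _.
    have -> : x ^+ A' = x ^ a * x ^+ A.
      by rewrite !exprnP AA expfzDr.
    by ring.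
  have := congr1 (fun q : {poly F} => q`_(c + A')%N) p0.
  rewrite coef0 /p coefB !coef_sum.
  have cB : (c < B)%N by rewrite /B; lia.
  rewrite [X in _ - X](bigD1 (Ordinal cB)) //= coefZ coefXn eqxx mulr1 [X in _ - (_ + X)]big1 ?addr0.
    move/eqP; rewrite subr_eq0 !pevalM => /eqP <-.
    case: leqP => AcA.
      have bB : (c + A' - A < B)%N by rewrite /B; lia.
      rewrite (bigD1 (Ordinal bB)) //= coefZ coefXn subnK // eqxx mulr1 big1 ?addr0 //.
      move=> i; rewrite -val_eqE /= => ni; rewrite coefZ coefXn.
      by case: eqP => [h|_]; [case/eqP: ni; lia|rewrite mulr0].
    rewrite big1 // => i _; rewrite coefZ coefXn.
    by case: eqP => [h|_]; [lia|rewrite mulr0].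
  move=> i; rewrite -val_eqE /= => ni; rewrite coefZ coefXn.
  by case: eqP => [h|_]; [case/eqP: ni; lia|rewrite mulr0].
(* A negative degree c + a would make a product of two nonzero polynomials vanish. *)
case: (leqP A (c + A')%N) => AcA; last first.
  have : P * comp r c Q = 0.
    by apply: peval_inj => u; rewrite key leqNgt AcA peval0.
  by move/eqP; rewrite mulf_eq0 (negPf P0) (negPf c0).
have E : P * comp r c Q = comp r (c + A' - A)%N P * Q.
  by apply: peval_inj => u; rewrite key AcA.
exists (comp r (c + A' - A)%N P), (comp r c Q); split=> //; try exact: in_R_comp.
  by rewrite fE; apply/eqP; rewrite frac_eq // E.
by split; [exists (c + A' - A)%N|exists c|..]; rewrite ?rowhom_comp //;
  move=> r' b; exact: rowhom_comp2.
Qed.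

Lemma rowhom_multidegree (a : 'I_n -> nat) P : (forall r, rowhom r (a r) P) ->
  has_multidegree a P.
Proof.
move=> h t _ u; rewrite /peval !mevalE big_distrr /= big_seq [RHS]big_seq.
apply: eq_bigr => m ms; rewrite [RHS]mulrCA; congr (_ * _).
have -> : \prod_r t 0 r ^+ a r = \prod_i \prod_r (if inrow r i then t 0 r ^+ m i else 1).
  rewrite exchange_big /=; apply: eq_bigr => r _.
  by rewrite -(eqP (allP (h r) m ms)) /rdeg -prodrXr big_mkcond.
rewrite -big_split /=; apply: eq_bigr => i _.
case/mxvec_indexP: i => a' b'; rewrite !mxvecE mul_diag_mx mxE exprMn; congr (_ * _).
rewrite (bigD1 a') //= big1 => [|r /negPf ra]; rewrite /inrow mxvecE mxE ?eqxx ?mulr1 //.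
by rewrite eq_sym ra.
Qed.

Lemma hom_multihomogeneous (a : 'I_n -> int) f : in_K f ->
  (forall r, hom r (a r) f) -> multihomogeneous sigma f.
Proof.
move=> fK hf; case: (eqVneq f 0) => [->|f0].
  exists 0, 1; split; rewrite ?oner_neq0 ?tofrac0 ?mul0r //; [exact: in_R0|exact: in_R1|].
  exists (fun _ => 0%N), (fun _ => 0%N); split=> t _ u; rewrite ?peval0 ?peval1 ?mulr0 //.
  by rewrite big1 ?mul1r // => i _; rewrite expr0.
have H (s : seq 'I_n) : exists P Q, [/\ in_R P, in_R Q, Q != 0, f = P%:F / Q%:F &
    forall r, r \in s -> (exists b, rowhom r b P) /\ (exists c, rowhom r c Q)].
  elim: s => [|r s [P [Q [hP hQ Q0 fE h]]]].
    by have [P [Q [hP hQ Q0 fE]]] := fK; exists P, Q.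
  have [P' [Q' [hP' hQ' Q0' fE' [h1 h2 h3 h4]]]] := row_step f0 (hf r) hP hQ Q0 fE.
  exists P', Q'; split=> // r'; rewrite inE => /orP[/eqP -> //|/h[[b hb] [c hc]]].
  by split; [exists b; exact: h3|exists c; exact: h4].
have [P [Q [hP hQ Q0 fE h]]] := H (enum 'I_n); exists P, Q; split=> //.
have [aP haP] := choice (fun r => proj1 (h r (mem_enum _ r))).
have [aQ haQ] := choice (fun r => proj2 (h r (mem_enum _ r))).
by exists aP, aQ; split; exact: rowhom_multidegree.
Qed.

End Rational.

(** * Degrees on a weave and the flux of a cycle *)

Lemma nth_replace m k (s' s : seq nat) e : (m + k <= size s)%N ->
  nth 0%N (replace m k s' s) e =
  if (e < m)%N then nth 0%N s e
  else if (e < m + size s')%N then nth 0%N s' (e - m)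
  else nth 0%N s (e - size s' + k).
Proof.
move=> h; rewrite /replace nth_cat size_take.
have -> : (if (m < size s)%N then m else size s) = m by case: ltnP; lia.
case: ltnP => em; first by rewrite nth_take.
rewrite nth_cat (_ : (e - m < size s')%N = (e < m + size s')%N); last lia.
by case: ltnP => // es; rewrite nth_drop; congr nth; lia.
Qed.

(* Below a vertex, the edges and gaps to its right are shifted. *)
Definition shift_edge (v : vertex) e := (e - arity_in v + arity_out v)%N.

Lemma sum_nat2 (f : nat -> int) m : \sum_(m <= e < m.+2) f e = f m + f m.+1.
Proof. by rewrite big_nat_recr //= big_nat1. Qed.

Lemma sum_nat3 (f : nat -> int) m :
  \sum_(m <= e < m.+3) f e = f m + f m.+1 + f m.+2.
Proof. by rewrite big_nat_recr ?leqW //= sum_nat2. Qed.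

Section GradedWeave.
Variables (b : word) (mk : pred nat) (w : seq move) (b' : word) (d : nat).
Hypotheses (hw : is_weave b w b').
Local Notation cyc := (Defs.cycle b mk w).
Local Notation wd := (word_at b w).
Local Notation letter t m := (nth 0%N (wd t) m).
Local Notation vx t := (move_at w t).1.
Local Notation pos t := (move_at w t).2.
Implicit Types (c : cyc) (t m e g i : nat).

Lemma vertex_fits t : (t < size w)%N -> (pos t + arity_in (vx t) <= size (wd t))%N.
Proof. by move/(weave_ok hw); rewrite /move_ok => /andP[]. Qed.

Lemma size_word_atS t : (t < size w)%N ->
  (size (wd t.+1) + arity_in (vx t) = size (wd t) + arity_out (vx t))%N.
Proof. by move=> tw; rewrite word_atS // (size_move_word (weave_ok hw tw)). Qed.

Lemma letter_left t e : (t < size w)%N -> (e < pos t)%N -> letter t.+1 e = letter t e.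
Proof.
move=> tw h; rewrite word_atS // /move_word nth_replace ?h //.
exact: vertex_fits.
Qed.

Lemma letter_right t e : (t < size w)%N -> (pos t + arity_in (vx t) <= e)%N ->
  letter t.+1 (shift_edge (vx t) e) = letter t e.
Proof.
move=> tw h; rewrite word_atS // /move_word nth_replace; last exact: vertex_fits.
rewrite /shift_edge; move: h; case: (move_at w t).1 => /= h;
  by do 2 (case: ltnP => ?; try lia); congr nth; lia.
Qed.

Lemma weight_left c t e : (t < size w)%N -> (e < pos t)%N ->
  weight c t.+1 e = weight c t e.
Proof.
move=> tw h; rewrite /weight; case: (eqVneq t.+1 (level c)) => [tl|tl].
  have [_ pE] := origin_trivalent tw tl.
  rewrite -pE in h; rewrite (@weights_before _ _ _ c t) -?tl // nth_nseq if_same tl (weights_level hw).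
  have := place_lt hw c; rewrite -tl => pl.
  by rewrite /unit_weights nth_mkseq; [case: eqP => //; lia|lia].
rewrite (weightsS hw) // /move_weights nth_replace ?h //.
by rewrite (size_weights hw) ?vertex_fits // ltnW.
Qed.

Lemma weight_right c t e : (t < size w)%N -> (pos t + arity_in (vx t) <= e)%N ->
  weight c t.+1 (shift_edge (vx t) e) = weight c t e.
Proof.
move=> tw h; rewrite /weight; case: (eqVneq t.+1 (level c)) => [tl|tl].
  have [vE pE] := origin_trivalent tw tl.
  rewrite (@weights_before _ _ _ c t) -?tl // nth_nseq if_same tl (weights_level hw).
  move: h; rewrite /shift_edge vE /= -pE => h.
  case: (ltnP (e - 2 + 1) (size (wd t.+1))) => he; last first.
    by rewrite nth_default // size_mkseq -tl.
  by rewrite /unit_weights nth_mkseq -?tl //; case: eqP => //; lia.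
rewrite (weightsS hw) // /move_weights nth_replace; last first.
  by rewrite (size_weights hw) ?vertex_fits // ltnW.
rewrite /shift_edge; move: h; case: (move_at w t).1 => /= h;
  by do 2 (case: ltnP => ?; try lia); congr nth; lia.
Qed.

Lemma weight_before c t e : (t < level c)%N -> weight c t e = 0%N.
Proof. by move=> h; rewrite /weight weights_before // nth_nseq if_same. Qed.

Lemma weight_level c t e : t.+1 = level c -> (t < size w)%N -> weight c t.+1 e = (e == pos t).
Proof.
move=> tl tw; have [_ pE] := origin_trivalent tw tl.
have pl := place_lt hw c; rewrite /weight tl (weights_level hw) -pE.
case: (ltnP e (size (wd (level c)))) => he; first by rewrite nth_mkseq.
rewrite nth_default ?size_mkseq //; case: eqP => // ep.
by move: pl; rewrite ep in he; rewrite ltnNge he.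
Qed.

Lemma weight_mid c t : (t < size w)%N -> t.+1 != level c ->
  let m := pos t in
  let x := weight c t m in let y := weight c t m.+1 in let z := weight c t m.+2 in
  match vx t with
  | Trivalent => weight c t.+1 m = minn x y
  | Fourvalent => weight c t.+1 m = y /\ weight c t.+1 m.+1 = x
  | Sixvalent => [/\ weight c t.+1 m = (y + z - minn x z)%N,
      weight c t.+1 m.+1 = minn x z & weight c t.+1 m.+2 = (x + y - minn x z)%N]
  end.
Proof.
move=> tw tl /=; have := vertex_fits tw; have E e := @size_weights _ _ _ _ hw c t (ltnW tw).
rewrite /weight (weightsS hw) // /move_weights; have {E} := E 0%N.
case: (move_at w t) => v m /=; set g := weights c t => sg.
have e1 : (m.+1 - m = 1)%N by lia.
have e2 : (m.+2 - m = 2)%N by lia.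
by case: v => /= sz; rewrite !nth_replace ?sg //= ?subnn ?e1 ?e2 //=;
  repeat (case: ltnP => ?; try lia).
Qed.

Definition edge_deg (A : nat -> nat -> nat -> int) t m : int :=
  let k := letter t m in A t m k + A t m.+1 k - A t m k.-1 - A t m k.+1.

Definition total_deg (dg : cyc -> int) t m : int :=
  \sum_(c : cyc) (weight c t m)%:Z * dg c.

(* A t g i is the degree of the i-th component of the flag in the g-th gap of
   level t, and dg c the degree of the variable of c; only the levels up to T
   are constrained. *)
Record graded (A0 : nat -> nat -> int) (T : nat) (dg : cyc -> int)
    (A : nat -> nat -> nat -> int) : Prop := Graded {
  gr_top : forall g i, A 0%N g i = A0 g i;
  gr_edge : forall t m, (t <= T)%N -> (m < size (wd t))%N ->
    total_deg dg t m = edge_deg A t m;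
  gr_same : forall t m i, (t <= T)%N -> (m < size (wd t))%N -> i <> letter t m ->
    A t m.+1 i = A t m i;
  gr_left : forall t g i, (t < T)%N -> (g <= pos t)%N -> A t.+1 g i = A t g i;
  gr_right : forall t g i, (t < T)%N -> (pos t + arity_in (vx t) <= g)%N ->
    A t.+1 (shift_edge (vx t) g) i = A t g i }.

(** * The flux of a cycle *)

Definition flux (A : nat -> nat -> nat -> int) c t : int :=
  \sum_(0 <= e < size (wd t))
    (weight c t e)%:Z * (A t e (letter t e) - A t e.+1 (letter t e)).

Lemma flux_before A c t : (t < level c)%N -> flux A c t = 0.
Proof. by move=> h; rewrite /flux big1 // => e _; rewrite weight_before // mul0r. Qed.

Lemma weight_six c t : (t < size w)%N -> vx t = Sixvalent ->
  let m := pos t in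
  let x := weight c t m in let y := weight c t m.+1 in let z := weight c t m.+2 in
  [/\ weight c t.+1 m = (y + z - minn x z)%N,
      weight c t.+1 m.+1 = minn x z & weight c t.+1 m.+2 = (x + y - minn x z)%N].
Proof.
move=> tw v6; have tl : t.+1 != level c.
  by apply/eqP => tl; have [] := origin_trivalent tw tl; rewrite v6.
by have := weight_mid tw tl; rewrite v6.
Qed.

Lemma weight_four c t : (t < size w)%N -> vx t = Fourvalent ->
  weight c t.+1 (pos t) = weight c t (pos t).+1 /\
  weight c t.+1 (pos t).+1 = weight c t (pos t).
Proof.
move=> tw v4; have tl : t.+1 != level c.
  by apply/eqP => tl; have [] := origin_trivalent tw tl; rewrite v4.
by have := weight_mid tw tl; rewrite v4.
Qed.

(** The determinants are linear in the weights of c', so summing against [dg] turns them into total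
    degrees of edges. At a 6-valent vertex the two determinants coincide, which removes the factor
    one half. *)
Lemma local_pairing_sum dg c t : (t < size w)%N ->
  \sum_(c' : cyc) local_pairing c c' t * dg c' =
  let m := pos t in
  let X e := total_deg dg t e in let Y e := total_deg dg t.+1 e in
  let x e := (weight c t e)%:Z in let y e := (weight c t.+1 e)%:Z in
  match vx t with
  | Trivalent => x m * (Y m - X m.+1) + y m * (X m.+1 - X m) + x m.+1 * (X m - Y m)
  | Fourvalent => 0
  | Sixvalent => x m * (Y m.+1 - X m.+2) + y m.+1 * (X m.+2 - X m)
                 + x m.+2 * (X m - Y m.+1)
  end.
Proof.
move=> tw /=; rewrite /total_deg /local_pairing.
have half (z : int) : ((z + z) %/ 2)%Z = z.
  by have -> : z + z = z * 2 by [ring]; rewrite mulzK.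
have W6 c' := @weight_six c' t tw; move: W6.
case: (move_at w t) => -[] m /= W; rewrite ?addn0 ?addn1 ?addn2.
- rewrite -!sumrB !mulr_sumr -!big_split; apply: eq_bigr => c' _ /=.
  by rewrite DE; ring.
- by rewrite big1 // => c' _; rewrite mul0r.
rewrite -!sumrB !mulr_sumr -!big_split; apply: eq_bigr => c' _ /=.
have [h1 h2 h3] := W c erefl; have [h1' h2' h3'] := W c' erefl.
have -> : (weight c t.+1 m)%:Z = (weight c t m.+1)%:Z + (weight c t m.+2)%:Z - (weight c t.+1 m.+1)%:Z by lia.
have -> : (weight c t.+1 m.+2)%:Z = (weight c t m)%:Z + (weight c t m.+1)%:Z - (weight c t.+1 m.+1)%:Z by lia.
have -> : (weight c' t.+1 m)%:Z = (weight c' t m.+1)%:Z + (weight c' t m.+2)%:Z - (weight c' t.+1 m.+1)%:Z by lia.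
have -> : (weight c' t.+1 m.+2)%:Z = (weight c' t m)%:Z + (weight c' t m.+1)%:Z - (weight c' t.+1 m.+1)%:Z by lia.
by rewrite D_sixvalent half DE; ring.
Qed.

Hypothesis lb : all (letters d) b.

Lemma letter_range t m : (t <= size w)%N -> (m < size (wd t))%N -> (0 < letter t m < d)%N.
Proof.
move=> tw mt; apply: (allP (letters_word_at hw lb tw)).
by rewrite mem_nth.
Qed.

Lemma letter_mid t : (t < size w)%N ->
  let m := pos t in let i := letter t m in let j := letter t m.+1 in
  match vx t with
  | Trivalent => j = i /\ letter t.+1 m = i
  | Fourvalent => [/\ (i.+1 < j) || (j.+1 < i), letter t.+1 m = j &
      letter t.+1 m.+1 = i]%N
  | Sixvalent => [/\ letter t m.+2 = i, (i.+1 == j) || (j.+1 == i)%N,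
      letter t.+1 m = j, letter t.+1 m.+1 = i & letter t.+1 m.+2 = j]
  end.
Proof.
move=> tw /=; have := weave_ok hw tw; have := vertex_fits tw.
rewrite (word_atS _ tw) /move_ok /move_word; case: (move_at w t) => v m /= sz.
have e1 : (m.+1 - m = 1)%N by lia.
have e2 : (m.+2 - m = 2)%N by lia.
have e3 : [/\ (m.+1 < m)%N = false, (m.+2 < m)%N = false, (m < m + 2)%N,
  (m < m + 3)%N & (m < m + 1)%N] by split; lia.
have [e4 e5 e6 e7 e8] := e3.
have e9 : [/\ (m.+1 < m + 2)%N, (m.+1 < m + 3)%N & (m.+2 < m + 3)%N] by split; lia.
have [e10 e11 e12] := e9.
move=> /andP[_ ok]; case: v sz ok => /= sz ok;
  rewrite !nth_replace //= ?subnn ?ltnn ?(e1, e2, e4, e5, e6, e7, e8, e10, e11, e12) //=.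
- by rewrite (eqP ok).
by case/andP: ok => /eqP ->.
Qed.

Lemma flux_split A c t m k : (m + k <= size (wd t))%N ->
  let f e := (weight c t e)%:Z * (A t e (letter t e) - A t e.+1 (letter t e)) in
  flux A c t = \sum_(0 <= e < m) f e + \sum_(m <= e < m + k) f e +
    \sum_(0 <= e < size (wd t) - (m + k)) f (e + (m + k))%N.
Proof.
move=> h f; rewrite /flux (big_cat_nat (n := m + k)) //=.
rewrite (big_cat_nat (n := m)) ?leq_addr //=; congr (_ + _).
by rewrite -{1}[(m + k)%N]add0n big_addn.
Qed.

Section Flux.
Variables (A0 : nat -> nat -> int) (T : nat) (dg : cyc -> int)
  (A : nat -> nat -> nat -> int).
Hypotheses (gA : graded A0 T dg A) (Tw : (T <= size w)%N).

(** Edges away from the vertex cancel. At a trivalent vertex let a0, a1, a2 be the components of its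
    colour in the three regions: the differences of edge degrees in the pairing are a0 - a1, a2 - a0
    and a1 - a2, so the pairing is the flux above minus the flux below, also at the origin of [c].
    The other vertices reduce to similar linear identities. *)
Lemma local_flux c t : (t < T)%N ->
  \sum_(c' : cyc) local_pairing c c' t * dg c' = flux A c t - flux A c t.+1.
Proof.
move=> tT; have tw : (t < size w)%N by apply: leq_trans Tw.
rewrite local_pairing_sum //=.
have sz := vertex_fits tw; have sz' := size_word_atS tw.
rewrite (flux_split _ _ sz) (@flux_split A c t.+1 (pos t) (arity_out (vx t))); last lia.
have -> : (size (wd t.+1) - (pos t + arity_out (vx t)) =
  size (wd t) - (pos t + arity_in (vx t)))%N by lia.
set L := \sum_(0 <= e < pos t) _; set L' := \sum_(0 <= e < pos t) _.
set R := \sum_(0 <= e < _ - _) _; set R' := \sum_(0 <= e < _ - _) _.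
have -> : L' = L.
  apply: eq_big_nat => e /andP[_ em]; rewrite weight_left // letter_left //.
  by rewrite !(gr_left gA) // ltnW.
have -> : R' = R.
  apply: eq_big_nat => e _.
  have E : (e + (pos t + arity_out (vx t)) =
      shift_edge (vx t) (e + (pos t + arity_in (vx t))))%N by rewrite /shift_edge; lia.
  have E' : ((e + (pos t + arity_out (vx t))).+1 =
      shift_edge (vx t) (e + (pos t + arity_in (vx t))).+1)%N by rewrite /shift_edge; lia.
  rewrite E' E weight_right ?letter_right ?(gr_right gA) //; lia.
rewrite [RHS](_ : _ = \sum_(pos t <= e < pos t + arity_in (vx t))
   (weight c t e)%:Z * (A t e (letter t e) - A t e.+1 (letter t e)) -
  \sum_(pos t <= e < pos t + arity_out (vx t))
   (weight c t.+1 e)%:Z * (A t.+1 e (letter t.+1 e) - A t.+1 e.+1 (letter t.+1 e)));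
  last by ring.
clear L L' R R'.
have rg e : (e < arity_in (vx t))%N -> (pos t + e < size (wd t))%N by lia.
have rg' e : (e < arity_out (vx t))%N -> (pos t + e < size (wd t.+1))%N by lia.
have lm := letter_mid tw; have lr := @letter_range t _ (ltnW tw).
have hE e : (e < arity_in (vx t))%N -> total_deg dg t (pos t + e) = edge_deg A t (pos t + e).
  by move=> /rg h; apply: (gr_edge gA) => //; exact: ltnW.
have hE' e : (e < arity_out (vx t))%N -> total_deg dg t.+1 (pos t + e) = edge_deg A t.+1 (pos t + e).
  by move=> /rg' h; apply: (gr_edge gA).
have hS e i : (e < arity_in (vx t))%N -> i <> letter t (pos t + e) ->
    A t (pos t + e).+1 i = A t (pos t + e)%N i.
  by move=> /rg h; apply: (gr_same gA) => //; exact: ltnW.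
have hS' e i : (e < arity_out (vx t))%N -> i <> letter t.+1 (pos t + e) ->
    A t.+1 (pos t + e).+1 i = A t.+1 (pos t + e)%N i.
  by move=> /rg' h; apply: (gr_same gA).
have hL i : A t.+1 (pos t) i = A t (pos t) i by apply: (gr_left gA).
have hR i : A t.+1 (pos t + arity_out (vx t))%N i = A t (pos t + arity_in (vx t))%N i.
  rewrite -[RHS](gr_right gA) //; congr (A _ _ _); rewrite /shift_edge; lia.
have W6 := @weight_six c t tw; have W4 := @weight_four c t tw.
have lr0 := lr (pos t) (ltac:(by have := rg 0%N; rewrite addn0; apply; case: (vx t))).
have lr1 : (1 < arity_in (vx t))%N -> (0 < letter t (pos t).+1 < d)%N.
  by move=> h; apply: lr; have := rg 1%N h; rewrite addn1.
move: lm hE hE' hS hS' hL hR W6 W4 lr0 lr1 {rg rg' lr sz sz'}.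
move: (vx t) (pos t) => -[] m /= lm hE hE' hS hS' hL hR W6 W4 lr0 lr1.
- have [l1 l2] := lm; rewrite addn1 addn2 in hR *.
  have := hE 0%N isT; have := hE 1%N isT; have := hE' 0%N isT; rewrite addn0 addn1.
  move=> -> -> ->; rewrite big_nat1 sum_nat2 /edge_deg l1 l2 !hL !hR.
  have hS0 k : k <> letter t m -> A t m.+1 k = A t m k.
    by move=> h; have := hS 0%N k isT; rewrite addn0; apply.
  by rewrite !(hS0 _.-1) ?(hS0 _.+1) ?hL; try lia; ring.
- have [ij l1 l2] := lm; have [w1 w2] := W4 erefl; rewrite addn2 in hR *.
  have hS0 k : k <> letter t m -> A t m.+1 k = A t m k.
    by move=> h; have := hS 0%N k isT; rewrite addn0; apply.
  have hS1 k : k <> letter t m.+1 -> A t m.+2 k = A t m.+1 k.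
    by move=> h; have := hS 1%N k isT; rewrite addn1; apply.
  have hS0' k : k <> letter t m.+1 -> A t.+1 m.+1 k = A t m k.
    by move=> h; have := hS' 0%N k isT; rewrite addn0 l1 hL; apply.
  have hS1' k : k <> letter t m -> A t.+1 m.+1 k = A t m.+2 k.
    by move=> h; have := hS' 1%N k isT; rewrite addn1 l2 hR => ->.
  rewrite !sum_nat2 l1 l2 w1 w2 !hL !hR.
  rewrite (hS0' (letter t m)) ?(hS1' (letter t m.+1)) ?(hS1 (letter t m)); try lia.
  by rewrite (hS0 (letter t m.+1)); try lia; ring.
have [l0 ij l1 l2 l3] := lm; have [w1 w2 w3] := W6 erefl; rewrite addn3 in hR *.
have := hE 0%N isT; have := hE 2%N isT; have := hE' 1%N isT; rewrite addn0 addn1 addn2.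
move=> -> -> ->; rewrite !sum_nat3 /edge_deg l0 l1 l2 l3 !hL !hR.
set i := letter t m in lm l0 ij l2 hS hS' lr0 *; set j := letter t m.+1 in l1 l3 lm ij hS hS' lr1 *.
have hS0 k : k <> i -> A t m.+1 k = A t m k.
  by move=> h; have := hS 0%N k isT; rewrite addn0; apply.
have hS1 k : k <> j -> A t m.+2 k = A t m.+1 k.
  by move=> h; have := hS 1%N k isT; rewrite addn1; apply.
have hS2 k : k <> i -> A t m.+3 k = A t m.+2 k.
  by move=> h; have := hS 2%N k isT; rewrite addn2 l0; apply.
have hS0' k : k <> j -> A t.+1 m.+1 k = A t m k.
  by move=> h; have := hS' 0%N k isT; rewrite addn0 l1 hL; apply.
have hS1' k : k <> i -> A t.+1 m.+2 k = A t.+1 m.+1 k.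
  by move=> h; have := hS' 1%N k isT; rewrite addn1 l2; apply.
have hS2' k : k <> j -> A t.+1 m.+2 k = A t m.+3 k.
  by move=> h; have := hS' 2%N k isT; rewrite addn2 l3 hR => ->.
have -> : (weight c t.+1 m)%:Z = (weight c t m.+1)%:Z + (weight c t m.+2)%:Z
  - (weight c t.+1 m.+1)%:Z by lia.
have -> : (weight c t.+1 m.+2)%:Z = (weight c t m)%:Z + (weight c t m.+1)%:Z
  - (weight c t.+1 m.+1)%:Z by lia.
case/orP: ij => /eqP ij.
  rewrite -ij in hS1 hS0' hS2' *.
  rewrite (hS0 i.+1) ?(hS1 i) ?(hS2 i.+1) ?(hS0' i) ?(hS1' i.+1) ?(hS2' i); try lia.
  rewrite ?(hS0 i.-1) ?(hS1 i.-1) ?(hS0' i.-1); try lia.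
  by rewrite ?(hS0 i.-1); try lia; ring.
rewrite -ij in hS0 hS2 hS1' *; rewrite [j.+1.-1]/=.
rewrite (hS0 j) ?(hS1 j.+1) ?(hS2 j) ?(hS0' j.+1) ?(hS1' j) ?(hS2' j.+1); try lia.
rewrite ?(hS0 j.+2) ?(hS1 j.+2) ?(hS0' j.+2); try lia.
by rewrite ?(hS0 j.+2); try lia; ring.
Qed.

Lemma pairing_flux c : (T = size w) ->
  \sum_(c' : cyc) pairing c c' * dg c' = flux A c 0 - flux A c (size w).
Proof.
move=> TE; rewrite /pairing; under eq_bigr => c' _ do rewrite mulr_suml.
rewrite exchange_big /=.
transitivity (\sum_(t < size w) (flux A c t - flux A c t.+1)).
  by apply: eq_bigr => t _; rewrite local_flux // TE.
elim: (size w) => [|m IH]; first by rewrite big_ord0 subrr.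
by rewrite big_ord_recr /= IH; ring.
Qed.

End Flux.

(** * Existence of the weights *)

Section Step.
Variables (A0 : nat -> nat -> int) (T : nat) (dg : cyc -> int)
  (A : nat -> nat -> nat -> int).
Hypotheses (gA : graded A0 T dg A) (Tw : (T < size w)%N).
Local Notation m := (pos T).
Local Notation i := (letter T m).
Local Notation j := (letter T m.+1).

(* The degree of the j-th component of the new flag below a 6-valent vertex, read
   off the middle outgoing edge. *)
Definition next_value : int :=
  A T m i + A T m.+3 i - A T m (if j == i.+1 then i.-1 else i.+1)
  - total_deg dg T.+1 m.+1.

Definition next_gaps (g l : nat) : int :=
  match vx T with
  | Trivalent => if (g <= m)%N then A T g l else A T g.+1 l
  | Fourvalent =>
      if g == m.+1 then (if l == j then A T m.+2 l else A T m l) else A T g l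
  | Sixvalent =>
      if g == m.+1 then (if l == j then next_value else A T m l)
      else if g == m.+2 then (if l == j then next_value else A T m.+3 l)
      else A T g l
  end.

Definition next_A t : nat -> nat -> int := if (t <= T)%N then A t else next_gaps.

(** The cycle born at this vertex absorbs the discrepancy on its first edge. The change is invisible
    on earlier levels, where its weight is 0. *)
Definition next_dg c : int :=
  if level c == T.+1 then dg c + (edge_deg next_A T.+1 m - total_deg dg T.+1 m)
  else dg c.

Lemma next_A_old t : (t <= T)%N -> next_A t = A t.
Proof. by rewrite /next_A => ->. Qed.

Lemma next_A_new : next_A T.+1 = next_gaps.
Proof. by rewrite /next_A ltnn. Qed.

Lemma next_left g l : (g <= m)%N -> next_A T.+1 g l = A T g l.
Proof.
rewrite next_A_new /next_gaps => gm; case: (vx T); first by rewrite gm.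
  by case: eqP => //; lia.
by case: eqP; [lia|case: eqP => //; lia].
Qed.

Lemma next_right g l : (m + arity_in (vx T) <= g)%N ->
  next_A T.+1 (shift_edge (vx T) g) l = A T g l.
Proof.
rewrite next_A_new /next_gaps /shift_edge; case: (vx T) => /= gm.
- by case: leqP; [lia|move=> _; congr (A _ _ _); lia].
- by rewrite subnK; [case: eqP => //; lia|lia].
by rewrite subnK; [case: eqP; [lia|case: eqP => //; lia]|lia].
Qed.

Lemma total_old t e : (t <= T)%N -> total_deg next_dg t e = total_deg dg t e.
Proof.
move=> tT; apply: eq_bigr => c _; rewrite /next_dg; case: eqP => // lc.
by rewrite weight_before ?mul0r // lc.
Qed.

Lemma total_new e : e != m \/ vx T <> Trivalent ->
  total_deg next_dg T.+1 e = total_deg dg T.+1 e.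
Proof.
move=> h; apply: eq_bigr => c _; rewrite /next_dg; case: eqP => // lc.
have [v _] := origin_trivalent Tw (esym lc).
by case: h => // /negPf em; rewrite weight_level // em !mul0r.
Qed.

Lemma total_trivalent : vx T = Trivalent ->
  total_deg next_dg T.+1 m = edge_deg next_A T.+1 m.
Proof.
move=> v.
have ic : is_cycle (b := b) (w := w) mk (inr (Ordinal Tw)) by rewrite /is_cycle /= v.
pose c0 : cyc := exist _ (inr (Ordinal Tw)) ic.
have l0 : level c0 = T.+1 by [].
rewrite /total_deg (bigD1 c0) //= weight_level // eqxx mul1r {1}/next_dg l0 eqxx.
rewrite {1}/total_deg [X in edge_deg _ _ _ - X](bigD1 c0) //= weight_level // eqxx mul1r.
set S1 := \sum_(_ | _) _; set S2 := \sum_(_ | _) _.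
have -> : S2 = S1; last by ring.
apply: eq_bigr => c nc; rewrite /next_dg; case: eqP => // lc; case/negP: nc.
apply/eqP/val_inj; move: lc; rewrite /level /=; case: (val c) => // s [] sT.
by congr inr; apply: val_inj.
Qed.

Lemma total_left e : (e < m)%N -> total_deg next_dg T.+1 e = total_deg dg T e.
Proof.
move=> em; rewrite total_new; last by left; apply/eqP; lia.
by apply: eq_bigr => c _; rewrite weight_left.
Qed.

Lemma total_right e : (m + arity_in (vx T) <= e)%N ->
  total_deg next_dg T.+1 (shift_edge (vx T) e) = total_deg dg T e.
Proof.
move=> em; rewrite total_new; first by apply: eq_bigr => c _; rewrite weight_right.
by left; apply/eqP; rewrite /shift_edge; move: em; case: (vx T) => /=; lia.
Qed.

(** At a 6-valent vertex the middle edge holds by the choice of [next_value]. The outer edges follow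
    because each of their weights is the sum of two incoming weights minus the middle weight. *)
Lemma next_edge_same e : (e < size (wd T.+1))%N ->
  total_deg next_dg T.+1 e = edge_deg next_A T.+1 e /\
  (forall l, l <> letter T.+1 e -> next_A T.+1 e.+1 l = next_A T.+1 e l).
Proof.
move=> es; have sz := vertex_fits Tw; have sz' := size_word_atS Tw.
case: (ltnP e m) => em.
  rewrite total_left // /edge_deg !next_left ?letter_left //; try lia.
  rewrite (gr_edge gA) //; last lia.
  by split=> // l hl; rewrite !next_left //; [apply: (gr_same gA) => //; lia|lia].
case: (leqP (m + arity_out (vx T)) e) => em'.
  have [e0 [E E' h0 h1]] : exists e0, [/\ e = shift_edge (vx T) e0,
      e.+1 = shift_edge (vx T) e0.+1, (m + arity_in (vx T) <= e0)%N &
      (e0 < size (wd T))%N].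
    exists (e - arity_out (vx T) + arity_in (vx T))%N; rewrite /shift_edge.
    by split; lia.
  have h0' : (m + arity_in (vx T) <= e0.+1)%N by lia.
  rewrite /edge_deg E' E total_right // !(next_right _ h0) !(next_right _ h0').
  rewrite !letter_right // (gr_edge gA) //.
  split=> // l hl; rewrite (next_right _ h0) (next_right _ h0').
  exact: (gr_same gA).
have lm := letter_mid Tw.
have W6 c := @weight_six c T Tw; have W4 c := @weight_four c T Tw.
have hS k l : (k < arity_in (vx T))%N -> l <> letter T (m + k)%N ->
    A T (m + k).+1 l = A T (m + k)%N l.
  by move=> h; apply: (gr_same gA) => //; lia.
have hE k : (k < arity_in (vx T))%N -> total_deg dg T (m + k)%N = edge_deg A T (m + k)%N.
  by move=> h; apply: (gr_edge gA) => //; lia.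
have nL l : next_A T.+1 m l = A T m l := @next_left m l (leqnn _).
have nR l : next_A T.+1 (shift_edge (vx T) (m + arity_in (vx T))) l =
    A T (m + arity_in (vx T))%N l := @next_right (m + arity_in (vx T))%N l (leqnn _).
have i0 := letter_range (ltnW Tw) (ltac:(by move: sz; case: (vx T) => /=; lia) : (m < size (wd T))%N).
have j0 : (1 < arity_in (vx T))%N -> (0 < j < d)%N.
  by move=> h; apply: letter_range; lia.
have tn e' : vx T <> Trivalent -> total_deg next_dg T.+1 e' = total_deg dg T.+1 e'.
  by move=> h; apply: total_new; right.
have tt := total_trivalent.
have gaps : next_A T.+1 = next_gaps := next_A_new.
case v : (vx T) lm hS hE nR em' j0 tn tt => /= lm hS hE nR em' j0 tn tt.
- have -> : e = m by lia.
  rewrite tt //; split=> // l; have [ji ->] := lm => hl.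
  have -> : m.+1 = shift_edge Trivalent (m + 2) by rewrite /shift_edge /=; lia.
  rewrite nR nL addn2; have := hS 1%N l isT; have := hS 0%N l isT.
  by rewrite addn0 addn1 ji => h1 h2; rewrite h2 // h1.
- have [ij l1 l2] := lm.
  have hS0 l : l <> i -> A T m.+1 l = A T m l.
    by move=> h; have := hS 0%N l isT; rewrite addn0; apply.
  have hS1 l : l <> j -> A T m.+2 l = A T m.+1 l.
    by move=> h; have := hS 1%N l isT; rewrite addn1; apply.
  have n1j : next_A T.+1 m.+1 j = A T m.+2 j.
    by rewrite gaps /next_gaps v !eqxx.
  have n1 l : l <> j -> next_A T.+1 m.+1 l = A T m l.
    by move/eqP/negPf => h; rewrite gaps /next_gaps v eqxx h.
  have n2 l : next_A T.+1 m.+2 l = A T m.+2 l.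
    have -> : m.+2 = shift_edge Fourvalent (m + 2) by rewrite /shift_edge /=; lia.
    by rewrite nR; congr (A _ _ _); rewrite /shift_edge /=; lia.
  have t1 : total_deg next_dg T.+1 m = edge_deg A T m.+1.
    rewrite tn // -[m.+1]addn1 -hE //; apply: eq_bigr => c _.
    by rewrite addn1; have [-> _] := W4 c v.
  have t2 : total_deg next_dg T.+1 m.+1 = edge_deg A T m.
    rewrite tn // -[X in edge_deg _ _ X]addn0 -hE //; apply: eq_bigr => c _.
    by rewrite addn0; have [_ ->] := W4 c v.
  have [->|->] : e = m \/ e = m.+1 by lia.
    split; last by move=> l; rewrite l1 nL => hl; rewrite n1.
    by rewrite t1 /edge_deg l1 !nL n1j !hS0; try lia; ring.
  split; first by rewrite t2 /edge_deg l2 !n2 !n1; try lia; rewrite hS1; lia.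
  move=> l; rewrite l2 => hl; rewrite n2; case: (eqVneq l j) => [->|/eqP lj]; first by rewrite n1j.
  by rewrite n1 // hS1 // hS0.
have [l0 ij l1 l2 l3] := lm.
have hS0 l : l <> i -> A T m.+1 l = A T m l.
  by move=> h; have := hS 0%N l isT; rewrite addn0; apply.
have hS1 l : l <> j -> A T m.+2 l = A T m.+1 l.
  by move=> h; have := hS 1%N l isT; rewrite addn1; apply.
have hS2 l : l <> i -> A T m.+3 l = A T m.+2 l.
  by move=> h; have := hS 2%N l isT; rewrite addn2 l0; apply.
have n1j : next_A T.+1 m.+1 j = next_value by rewrite gaps /next_gaps v !eqxx.
have n1 l : l <> j -> next_A T.+1 m.+1 l = A T m l.
  by move/eqP/negPf => h; rewrite gaps /next_gaps v eqxx h.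
have n21 : (m.+2 == m.+1) = false by apply/eqP; lia.
have n2j : next_A T.+1 m.+2 j = next_value.
  by rewrite gaps /next_gaps v n21 !eqxx.
have n2 l : l <> j -> next_A T.+1 m.+2 l = A T m.+3 l.
  by move/eqP/negPf => h; rewrite gaps /next_gaps v n21 eqxx h.
have n3 l : next_A T.+1 m.+3 l = A T m.+3 l.
  have -> : m.+3 = shift_edge Sixvalent (m + 3) by rewrite /shift_edge /=; lia.
  by rewrite nR; congr (A _ _ _); rewrite /shift_edge /=; lia.
have e0 := hE 0%N isT; have e1 := hE 1%N isT; have e2 := hE 2%N isT.
rewrite addn0 in e0; rewrite addn1 in e1; rewrite addn2 in e2.
pose C := total_deg dg T.+1 m.+1.
have t1 : total_deg next_dg T.+1 m = edge_deg A T m.+1 + edge_deg A T m.+2 - C.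
  rewrite tn // -e1 -e2 -big_split -sumrB; apply: eq_bigr => c _ /=.
  by have [h1 h2 h3] := W6 c v; rewrite -mulrDl -mulrBl; congr (_ * _); lia.
have t2 : total_deg next_dg T.+1 m.+1 = C by rewrite tn.
have t3 : total_deg next_dg T.+1 m.+2 = edge_deg A T m + edge_deg A T m.+1 - C.
  rewrite tn // -e0 -e1 -big_split -sumrB; apply: eq_bigr => c _ /=.
  by have [h1 h2 h3] := W6 c v; rewrite -mulrDl -mulrBl; congr (_ * _); lia.
have hval : next_value = A T m i + A T m.+3 i - A T m (if j == i.+1 then i.-1 else i.+1) - C by [].
have {}ij : j = i.+1 \/ i = j.+1 by case/orP: ij => /eqP; lia.
have [->|[->|->]] : e = m \/ (e = m.+1 \/ e = m.+2) by lia.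
- split; last by move=> l; rewrite l1 nL => hl; rewrite n1.
  rewrite t1 /edge_deg l1 l0 !nL n1j hval.
  case: ij => ij; rewrite ij in hS0 hS1 hS2 i0 *; rewrite ?eqxx ?predn1.
    rewrite (hS1 i) ?(hS1 i.-1) ?(hS0 i.-1) ?(hS0 i.+1) ?(hS0 i.+2); try lia;
      by rewrite (_ : i.+1.-1 = i) //; ring.
  have -> : (j == j.+2) = false by apply/eqP; lia.
  rewrite (_ : j.+1.-1 = j) //.
  by rewrite (hS1 j.+1) ?(hS1 j.+2) ?(hS0 j.+2) ?(hS0 j) ?(hS0 j.-1); try lia; ring.
- split.
    rewrite t2 /edge_deg l2.
    case: ij => ij; rewrite {}ij in n1j n1 n2 n2j hval *.
      by rewrite n1j !n1 ?n2 ?hval ?eqxx; try lia; ring.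
    have e3 : (j == j.+2) = false by apply/eqP; lia.
    by rewrite (_ : j.+1.-1 = j) // n1j !n1 ?n2 ?hval ?e3; try lia; ring.
  move=> l; rewrite l2 => hl; case: (eqVneq l j) => [->|/eqP lj].
    by rewrite n2j n1j.
  by rewrite n1 ?n2 // hS2 // hS1 // hS0.
split; last by move=> l; rewrite l3 => hl; rewrite n3 n2.
rewrite t3 /edge_deg l3 n2j !n3 hval.
case: ij => ij; rewrite ij in hS0 hS1 hS2 n2 i0 *; rewrite ?eqxx.
  rewrite (_ : i.+1.-1 = i) // !n2; try lia.
  by rewrite (hS2 i.+2) ?(hS2 i.+1) ?(hS1 i.+2) ?(hS0 i.+2) ?(hS0 i.+1); try lia; ring.
have -> : (j == j.+2) = false by apply/eqP; lia.
rewrite (_ : j.+1.-1 = j) // !n2; try lia.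
by rewrite (hS2 j.-1) ?(hS2 j) ?(hS1 j.-1) ?(hS0 j.-1) ?(hS0 j); try lia; ring.
Qed.

Lemma graded_step : graded A0 T.+1 next_dg next_A.
Proof.
split=> [g l|t e|t e l|t g l|t g l].
- by rewrite next_A_old // (gr_top gA).
- rewrite leq_eqVlt => /orP[/eqP -> es|]; first by have [] := next_edge_same es.
  rewrite ltnS => tT es; rewrite total_old // (gr_edge gA) //.
  by rewrite /edge_deg next_A_old.
- rewrite leq_eqVlt => /orP[/eqP -> es hl|]; first by have [_] := next_edge_same es; apply.
  by rewrite ltnS => tT es hl; rewrite next_A_old // (gr_same gA).
- rewrite ltnS leq_eqVlt => /orP[/eqP -> gm|tT gm].
    by rewrite next_left // next_A_old.
  by rewrite !next_A_old ?(gr_left gA) // ltnW.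
rewrite ltnS leq_eqVlt => /orP[/eqP -> gm|tT gm].
  by rewrite next_right // next_A_old.
by rewrite !next_A_old ?(gr_right gA) // ltnW.
Qed.

End Step.

(** A marked top letter has a cycle of its own, whose degree is free to match the edge; only
    unmarked letters impose a condition at the top. Below, each vertex extends the grading by
    [graded_step]. *)
Lemma graded_exists (A0 : nat -> nat -> int) :
  (forall m, (m < size b)%N -> ~~ mk m -> edge_deg (fun _ => A0) 0 m = 0) ->
  (forall m l, (m < size b)%N -> l <> nth 0%N b m -> A0 m.+1 l = A0 m l) ->
  exists dg A, graded A0 (size w) dg A.
Proof.
move=> hu hs; suff H T : (T <= size w)%N -> exists dg A, graded A0 T dg A by exact: H.
elim: T => [_|T IH Tw]; last first.
  have [dg [A gA]] := IH (ltnW Tw).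
  by exists (next_dg T dg A), (next_A T dg A); exact: graded_step.
exists (fun c => if val c is inl m then edge_deg (fun _ => A0) 0 m else 0), (fun _ => A0).
split=> // [t m|t m l]; rewrite leqn0 => /eqP ->; rewrite word_at0 => mb.
  have W c : weight c 0 m = if val c is inl m' then (m == m' :> nat) : nat else 0%N.
    case: c => -[m'|s] i; rewrite /weight /weights /=; last by rewrite nth_nseq if_same.
    by rewrite (propagate_id hw) nth_mkseq.
  rewrite -[RHS]/(edge_deg (fun _ => A0) 0 m).
  case: (boolP (mk m)) => mkm; last first.
    rewrite hu // /total_deg big1 // => c _; rewrite W.
    case E : (val c) => [m'|s]; last by rewrite mul0r.
    case: eqP => [mm|_]; last by rewrite mul0r.
    by have := valP c; rewrite /is_cycle E -mm (negPf mkm).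
  have ic : is_cycle (b := b) (w := w) mk (inl (Ordinal mb)) by [].
  pose c0 : cyc := exist _ (inl (Ordinal mb)) ic.
  rewrite /total_deg (bigD1 c0) //= W /= eqxx mul1r big1 ?addr0 // => c nc; rewrite W.
  case E : (val c) => [m'|s]; last by rewrite mul0r.
  case: eqP => [mm|_]; last by rewrite mul0r.
  case/negP: nc; rewrite -val_eqE /= E; apply/eqP; congr inl; exact: val_inj.
by apply: hs.
Qed.

End GradedWeave.

(** * Comparison of the decorations of a point and of its rescaling *)

Section Rescaling.
Variables (F : numFieldType) (d : nat).
Hypothesis hd : (1 < d)%N.
Variables (b : word) (mk : pred nat) (w : seq move) (b' : word).
Hypotheses (hw : is_weave b w b') (lb : all (letters d) b).
Local Notation cyc := (Defs.cycle b mk w).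
Local Notation wd := (word_at b w).
Local Notation letter t m := (nth 0%N (wd t) m).
Local Notation vx t := (move_at w t).1.
Local Notation pos t := (move_at w t).2.
Variables (A0 : nat -> nat -> int) (dg : cyc -> int) (A : nat -> nat -> nat -> int).
Hypothesis gA : graded A0 (size w) dg A.
Hypothesis A00 : forall i, i = 0%N \/ i = d -> A0 0%N i = 0.
Variables (Fl Fl' : nat -> nat -> flag F d) (de de' : cyc -> F) (x : F).
Hypotheses (x0 : x != 0) (de0 : forall c, de c != 0) (de0' : forall c, de' c != 0).
Hypotheses (dFl : is_decoration Fl de) (dFl' : is_decoration Fl' de').
Hypothesis top_scale : forall g i, (g <= size b)%N -> (0 < i < d)%N ->
  Fl' 0%N g i = x ^ A0 g i *: Fl 0%N g i.
Implicit Types (c : cyc) (t m g i : nat).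

Lemma A_ends t g i : (t <= size w)%N -> (g <= size (wd t))%N -> i = 0%N \/ i = d ->
  A t g i = 0.
Proof.
move=> tw gw hi; elim: g gw => [_|g IH gw]; last first.
  have [l0 ld] := andP (letter_range hw lb tw gw).
  by rewrite (gr_same gA) //; [apply: IH; lia|lia].
elim: t tw => [_|t IH tw]; first by rewrite (gr_top gA) A00.
by rewrite (gr_left gA) // IH // ltnW.
Qed.

Definition scaled t g := forall i, (i <= d)%N ->
  fl (Fl' t g) i = x ^ A t g i *: fl (Fl t g) i.

Definition scaled_cycle c := de' c = x ^ dg c * de c.

Lemma scaledP t g : (t <= size w)%N -> (g <= size (wd t))%N ->
  (forall i, (0 < i < d)%N -> Fl' t g i = x ^ A t g i *: Fl t g i) -> scaled t g.
Proof.
move=> tw gw h i ie; case: (posnP i) => [->|i0].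
  by rewrite !fl0 A_ends ?expr0z ?scale1r //; left.
case: (ltnP i d) => id; first by rewrite !fl_mid ?h ?i0.
have -> : i = d by lia.
by rewrite !fld // A_ends ?expr0z ?scale1r //; right.
Qed.

Lemma rel_fl k G H i : rel_pos (d := d) k G H -> i <> k -> (i <= d)%N ->
  fl (F := F) H i = fl G i.
Proof.
move=> [h _] ik ie; case: (posnP i) => [->//|i0].
case: (ltnP i d) => id; first by rewrite !fl_mid ?h ?i0.
by have -> : i = d; [lia|rewrite !fld].
Qed.

Definition edge_value (e : cyc -> F) t m := \prod_c e c ^+ weight c t m.

Lemma crossings t m : (t <= size w)%N -> (m < size (wd t))%N ->
  crossing (letter t m) (Fl t m) (Fl t m.+1) (edge_value de t m) /\
  crossing (letter t m) (Fl' t m) (Fl' t m.+1) (edge_value de' t m).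
Proof. by move=> tw mw; have [_ _ _ h] := dFl; have [_ _ _ h'] := dFl'; split; auto. Qed.

Lemma flags_ok t g : (t <= size w)%N -> (g <= size (wd t))%N -> is_flag (Fl t g).
Proof. by move=> tw gw; have [h _ _ _] := dFl; apply: h. Qed.

Lemma xD a e : x ^ a * x ^ e = x ^ (a + e).
Proof. by rewrite expfzDr. Qed.

Lemma edge_value_neq0 t m : edge_value de t m != 0.
Proof. by apply/prodf_neq0 => c _; rewrite expf_neq0. Qed.

Lemma edge_scale t m : (t <= size w)%N -> (m < size (wd t))%N ->
  scaled t m -> scaled t m.+1 ->
  edge_value de' t m = x ^ edge_deg b w A t m * edge_value de t m.
Proof.
move=> tw mw s1 s2; have [cr cr'] := crossings tw mw.
have /andP[l0 ld] := letter_range hw lb tw mw.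
have := crossing_scale_mid hd (flags_ok tw (ltnW mw)) cr cr' (s1 _ _) (s1 _ _) (s2 _ _) (s1 _ _).
move/(_ (ltac:(lia)) (ltac:(lia)) (ltac:(lia)) (ltac:(lia))) => E.
have nz a : x ^ a != 0 by rewrite expfz_neq0.
set k := letter t m in E *.
have -> : edge_deg b w A t m = A t m.+1 k + A t m k - (A t m k.-1 + A t m k.+1).
  by rewrite /edge_deg -/k; ring.
apply: (mulfI (nz (A t m k.-1 + A t m k.+1))).
by rewrite mulrA xD addrCA subrr addr0 -!xD; move: E; set p := x ^ _; set q := x ^ _; 
  set r := x ^ _; set s := x ^ _ => E; rewrite mulrAC E; ring.
Qed.

Lemma total_scale t m :
  (forall c, weight c t m = 0%N \/ scaled_cycle c) ->
  edge_value de' t m = x ^ total_deg dg t m * edge_value de t m.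
Proof.
move=> h; rewrite /edge_value /total_deg.
have -> : x ^ (\sum_(c : cyc) (weight c t m)%:Z * dg c) =
    \prod_(c : cyc) x ^ ((weight c t m)%:Z * dg c).
  apply: (big_morph (fun a : int => x ^ a)) => [a e|]; last by rewrite expr0z.
  by rewrite xD.
rewrite -big_split; apply: eq_bigr => c _ /=.
have [->|->] := h c; first by rewrite !expr0 mul0r expr0z mul1r.
by rewrite exprMn [_%:Z * _]mulrC -exprz_exp.
Qed.

(** On its first edge the new cycle has weight 1, and every other cycle present there is already
    known, so the edge equation can be solved for the new variable. *)
Lemma new_cycle t c0 : t = level c0 -> (t <= size w)%N ->
  scaled t (place c0) -> scaled t (place c0).+1 ->
  (forall c, c != c0 -> weight c t (place c0) = 0%N \/ scaled_cycle c) ->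
  scaled_cycle c0.
Proof.
move=> tl tw s1 s2 h.
have pl : (place c0 < size (wd t))%N by rewrite tl; exact: (place_lt hw).
have w1 : weight c0 t (place c0) = 1%N.
  by rewrite /weight tl (weights_level hw) nth_mkseq ?eqxx // -tl.
have := edge_scale tw pl s1 s2; rewrite -(gr_edge gA) //.
rewrite /edge_value /total_deg (bigD1 c0) //= [in RHS](bigD1 c0) //= w1 mul1r !expr1.
rewrite [X in _ = _ * X](bigD1 c0) //= w1 expr1.
have -> : \prod_(c | c != c0) de' c ^+ weight c t (place c0) =
    x ^ (\sum_(c | c != c0) (weight c t (place c0))%:Z * dg c) *
    \prod_(c | c != c0) de c ^+ weight c t (place c0).
  have -> : x ^ (\sum_(c | c != c0) (weight c t (place c0))%:Z * dg c) =
      \prod_(c | c != c0) x ^ ((weight c t (place c0))%:Z * dg c).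
    apply: (big_morph (fun a : int => x ^ a)) => [a e|]; last by rewrite expr0z.
    by rewrite xD.
  rewrite -big_split; apply: eq_bigr => c nc /=.
  have [->|->] := h c nc; first by rewrite !expr0 mul0r expr0z mul1r.
  by rewrite exprMn [_%:Z * _]mulrC -exprz_exp.
set S := \sum_(_ | _) _; set P := \prod_(_ | _) _ => E.
have nz : x ^ S * P != 0.
  by rewrite mulf_neq0 ?expfz_neq0 //; apply/prodf_neq0 => c _; rewrite expf_neq0.
by apply: (mulIf nz); rewrite E -xD mulrACA.
Qed.

Lemma comp_right t m i : (t <= size w)%N -> (m < size (wd t))%N -> (i <= d)%N ->
  i <> letter t m ->
  fl (Fl' t m) i = x ^ A t m i *: fl (Fl t m) i <->
  fl (Fl' t m.+1) i = x ^ A t m.+1 i *: fl (Fl t m.+1) i.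
Proof.
move=> tw mw ie il; have [[_ r _] [_ r' _]] := crossings tw mw.
by rewrite (rel_fl r il ie) (rel_fl r' il ie) (gr_same gA).
Qed.

(** Level by level. Regions away from the vertex are inherited, and below a 4-valent vertex every
    component agrees with that of a neighbour. Below a 6-valent vertex only the component [j] is
    new: [crossing_scale] at the middle edge yields it if j = i0 + 1, and [hexagon_scale] if j = i0
    - 1. A cycle born at the vertex is then settled by [new_cycle]. *)
Lemma decoration_scaled t : (t <= size w)%N ->
  (forall g, (g <= size (wd t))%N -> scaled t g) /\
  (forall c, (level c <= t)%N -> scaled_cycle c).
Proof.
elim: t => [_|t IH tw].
  have S0 g : (g <= size (wd 0))%N -> scaled 0 g.
    rewrite word_at0 => gb; apply: scaledP; rewrite ?word_at0 // => i hi.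
    by rewrite top_scale // (gr_top gA).
  split=> // c; rewrite leqn0 => /eqP l0.
  have pl := place_lt hw c; rewrite l0 in pl.
  apply: (new_cycle (esym l0)) => //; try by apply: S0; lia.
  move=> c' nc; left; case: (posnP (level c')) => l0'; last by rewrite weight_before.
  have := weights_level hw c'; rewrite l0' /weight => ->; rewrite nth_mkseq //.
  case: eqP => // pp; case/eqP: nc; apply: val_inj.
  move: l0 l0' pp; rewrite /level /place.
  case: (val c) => [p|//]; case: (val c') => [p'|//] _ _ pp; congr inl; exact: val_inj.
have [Sg Sc] := IH (ltnW tw).
have [_ fL fR _] := dFl; have [_ fL' fR' _] := dFl'.
have sz := vertex_fits hw tw; have sz' := size_word_atS hw tw.
have SL g : (g <= pos t)%N -> scaled t.+1 g.
  move=> gm; apply: scaledP => // [|i hi]; first by lia.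
  rewrite (fL' t g) // (fL t g) // (gr_left gA) //.
  have := Sg g (ltac:(lia)) i (ltac:(lia)); rewrite !fl_mid //.
have SR g : (pos t + arity_out (vx t) <= g <= size (wd t.+1))%N -> scaled t.+1 g.
  move=> hg; apply: scaledP => // [|i hi]; first by lia.
  have [g0 gE hg0] : exists2 g0, g = shift_edge (vx t) g0 &
      (pos t + arity_in (vx t) <= g0 <= size (wd t))%N.
    by exists (g - arity_out (vx t) + arity_in (vx t))%N; rewrite /shift_edge; lia.
  have /andP[h1 h2] := hg0.
  rewrite gE (gr_right gA) //.
  have := fR t g0 tw; have := fR' t g0 tw; rewrite /shift_edge.
  case: (move_at w t) h1 hg0 => v m /= h1 hg0 /(_ hg0 i hi) -> /(_ hg0 i hi) ->.
  by have := Sg g0 h2 i (ltac:(lia)); rewrite !fl_mid.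
have lm := letter_mid hw lb tw.
have Sold c m : vx t <> Trivalent -> weight c t.+1 m = 0%N \/ scaled_cycle c.
  move=> v; case: (ltngtP (level c) t.+1) => lc; first by right; apply: Sc.
    by left; rewrite weight_before.
  by have [/v] := origin_trivalent tw (esym lc).
have Sgap g : (g <= size (wd t.+1))%N -> scaled t.+1 g.
  move=> gs; case: (leqP g (pos t)) => gm; first exact: SL.
  case: (leqP (pos t + arity_out (vx t)) g) => gm'; first by apply: SR; rewrite gm' gs.
  have [b1 b2] : (pos t < size (wd t.+1))%N /\
     (pos t + arity_out (vx t) <= size (wd t.+1))%N.
    by move: gm' sz' sz gm; case: (vx t) => /=; lia.
  have S0 : scaled t.+1 (pos t) by apply: SL.
  have SE : scaled t.+1 (pos t + arity_out (vx t))%N by apply: SR; rewrite leqnn b2.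
  have cr m i : (m < size (wd t.+1))%N -> (i <= d)%N -> i <> letter t.+1 m ->
      fl (Fl' t.+1 m) i = x ^ A t.+1 m i *: fl (Fl t.+1 m) i <->
      fl (Fl' t.+1 m.+1) i = x ^ A t.+1 m.+1 i *: fl (Fl t.+1 m.+1) i.
    by move=> *; exact: comp_right.
  have fwd m i b1' ie il := proj1 (cr m i b1' ie il).
  have bwd m i b1' ie il := proj2 (cr m i b1' ie il).
  have jr m : (m < size (wd t.+1))%N -> (0 < letter t.+1 m < d)%N.
    by move=> *; apply: (letter_range hw lb).
  case v : (vx t) lm gm' b2 SE Sold sz => /= lm gm' b2 SE Sold sz; first by lia.
    have -> : g = (pos t).+1 by lia.
    move=> i ie; have [ij l1 l2] := lm.
    have b3 : ((pos t).+1 < size (wd t.+1))%N by lia.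
    case: (eqVneq i (letter t.+1 (pos t))) => [iE|/eqP iE]; last by apply: fwd => //; exact: S0.
    by apply: bwd => //; [rewrite l2 iE l1; lia|rewrite -addn2; exact: SE].
  have [l0 ij l1 l2 l3] := lm.
  set m := pos t in l0 l1 l2 l3 lm gm' b2 SE S0 b1 sz gm ij *.
  set i0 := letter t m in ij l0 l2 lm *; set j := letter t m.+1 in ij l1 l3 lm *.
  have b3 : (m.+1 < size (wd t.+1))%N by lia.
  have b4 : (m.+2 < size (wd t.+1))%N by lia.
  have {}ij : j = i0.+1 \/ i0 = j.+1 by case/orP: ij => /eqP; lia.
  have jd : (0 < j < d)%N by rewrite -l1; apply: jr.
  have id : (0 < i0 < d)%N by rewrite -l2; apply: jr.
  rewrite addn3 in SE.
  have c1 i : (i <= d)%N -> i <> j ->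
      fl (Fl' t.+1 m.+1) i = x ^ A t.+1 m.+1 i *: fl (Fl t.+1 m.+1) i.
    by move=> ie ne; apply: fwd => //; [rewrite l1|exact: S0].
  have c2 i : (i <= d)%N -> i <> j ->
      fl (Fl' t.+1 m.+2) i = x ^ A t.+1 m.+2 i *: fl (Fl t.+1 m.+2) i.
    by move=> ie ne; apply: bwd => //; [rewrite l3|exact: SE].
  have v3 e : edge_value de' t.+1 e = x ^ total_deg dg t.+1 e * edge_value de t.+1 e.
    by apply: total_scale => c; apply: Sold.
  have key : fl (Fl' t.+1 m.+1) j = x ^ A t.+1 m.+1 j *: fl (Fl t.+1 m.+1) j.
    have nz a : x ^ a != 0 by rewrite expfz_neq0.
    case: ij => ij.
      have [k1 k2] := crossings tw b3; rewrite l2 in k1 k2.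
      have := crossing_scale hd (flags_ok tw (ltnW b3)) k1 k2 (c1 _ _ _) (c1 _ _ _) (c2 _ _ _).
      move/(_ (ltac:(lia)) (ltac:(lia)) (ltac:(lia)) (ltac:(lia)) (ltac:(lia)) (ltac:(lia))).
      rewrite -ij v3 (gr_edge gA) // /edge_deg l2 -ij.
      set p := A t.+1 m.+1 i0; set q := A t.+1 m.+2 i0; set r := A t.+1 m.+1 i0.-1.
      set s := A t.+1 m.+1 j; set ev := edge_value de _ _.
      rewrite mulrA xD (_ : r + (p + q - r - s) = p + q - s); last by ring.
      rewrite mulrAC xD => E.
      have ev0 : ev != 0 by exact: edge_value_neq0.
      apply: (scalerI (a := x ^ (p + q - s) * ev)); first by rewrite mulf_neq0.
      rewrite E scalerA mulrAC xD; congr (_ * _ *: _); congr (x ^ _); ring.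
    have [h1 h1'] := crossings tw b1; have [h2 h2'] := crossings tw b4.
    rewrite l1 in h1 h1'; rewrite l3 in h2 h2'.
    have [[_ r1 _] [_ r1' _]] := (h1, h1').
    have [[_ r2 _] [_ r2' _]] := crossings tw b3; rewrite l2 in r2 r2'.
    have [_ r3 _] := h2.
    have e1 : (j <= d)%N by lia.
    have jp : (j.-1 <= d)%N by lia.
    have S00 := S0; have SEE := SE.
    apply: (hexagon_scale hd (flags_ok tw (ltnW b1)) (flags_ok tw (ltnW b4)) h1 h1' h2 h2'
      (m := x ^ A t.+1 m j.-1) (n := x ^ A t.+1 m j) (p := x ^ A t.+1 m j.+1)
      (q := x ^ A t.+1 m.+2 j.+1) (s := x ^ A t.+1 m.+3 j)); rewrite ?expfz_neq0 //.
    - by apply: (rel_fl r2) => //; lia.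
    - by apply: (rel_fl r2') => //; lia.
    - by rewrite (rel_fl r2) ?(rel_fl r1) //; lia.
    - by rewrite (rel_fl r2') ?(rel_fl r1') //; lia.
    (* Above the vertex the middle edge has colour [j] and the outer edges do not change the
       component [j], so the outer regions differ there. *)
    - move=> c; have tw' := ltnW tw.
      have [[_ [_ np] _] _] := crossings tw' (ltac:(lia) : (m.+1 < size (wd t))%N).
      have [[_ q1 _] _] := crossings tw' (ltac:(lia) : (m < size (wd t))%N).
      have [[_ q3 _] _] := crossings tw' (ltac:(lia) : (m.+2 < size (wd t))%N).
      have f0 : fl (Fl t.+1 m) j = fl (Fl t m) j.
        by rewrite !fl_mid // (fL t m tw (leqnn _)).
      have f3 : fl (Fl t.+1 m.+3) j = fl (Fl t m.+3) j.
        rewrite !fl_mid //; have := fR t m.+3 tw.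
        have sz1 : (pos t + 3 <= size (wd t))%N := sz.
        move: v sz1; rewrite /m; case: (move_at w t) => v0 m0 /= -> sz1 /=; rewrite addn3 leqnn /= => H.
        have := H (ltac:(lia)) j jd; rewrite (_ : (m0.+3 - 3 + 3 = m0.+3)%N) //; lia.
      have ji : j <> i0 by lia.
      rewrite f0 f3 (rel_fl q3 (i := j)) ?l0 // -(rel_fl q1 ji e1).
      by rewrite !fl_mid //; exact: np.
    - exact: S0.
    - exact: S0.
    - by apply: S0; lia.
    - by apply: c2; lia.
    - exact: SE.
    - exact: edge_value_neq0.
    - rewrite v3 (gr_edge gA) // /edge_deg l1; set ev := edge_value _ _ _.
      rewrite mulrA xD mulrAC xD mulrAC xD; congr (x ^ _ * _); ring.
    rewrite v3 (gr_edge gA) // /edge_deg l3; set ev := edge_value _ _ _.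
    rewrite mulrA xD mulrAC xD mulrAC xD; congr (x ^ _ * _).
    have n1 : j <> letter t.+1 m.+1 by rewrite l2; lia.
    have n2 : j.-1 <> letter t.+1 m.+1 by rewrite l2; lia.
    have n3 : j.-1 <> letter t.+1 m by rewrite l1; lia.
    rewrite (gr_same gA _ b3 n1) // (gr_same gA _ b3 n2) // (gr_same gA _ b1 n3) //.
    ring.
  have [->|->] : g = m.+1 \/ g = m.+2 by lia.
    by move=> i ie; case: (eqVneq i j) => [->//|/eqP ne]; exact: c1.
  move=> i ie; case: (eqVneq i j) => [->|/eqP ne]; last exact: c2.
  by apply: fwd => //; [lia|rewrite l2; lia].
split=> // c; rewrite leq_eqVlt => /orP[/eqP lc|]; last by rewrite ltnS; exact: Sc.
have pl := place_lt hw c; rewrite lc in pl.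
apply: (new_cycle (esym lc)) => //; try by apply: Sgap; lia.
move=> c' nc; case: (ltngtP (level c') t.+1) => lc'; first by right; apply: Sc.
  by left; rewrite weight_before.
case/eqP: nc; apply: val_inj; move: lc lc'; rewrite /level.
case: (val c) => // s; case: (val c') => // s' [sE] [sE'].
by congr inr; apply: val_inj; rewrite /= sE sE'.
Qed.

End Rescaling.

(** * Rescaling of the mixed wedge and of the top flags *)

Section Cap.
Variables (F : numFieldType) (d : nat).
Local Notation ext := (ext F d).

Lemma capZl q (a : F) (u v : ext) : cap q (a *: u) v = a *: cap q u v.
Proof.
rewrite /cap scaler_sumr; apply: eq_bigr => A _; rewrite scaler_sumr.
by apply: eq_bigr => B _; rewrite scalerA ffunE /GRing.scale /= !mulrA.
Qed.

Lemma capZr q (a : F) (u v : ext) : cap q u (a *: v) = a *: cap q u v.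
Proof.
rewrite /cap scaler_sumr; apply: eq_bigr => A _; rewrite scaler_sumr.
apply: eq_bigr => B _; rewrite scalerA wedgeZr /det ffunE /GRing.scale /=.
by rewrite mulrCA !mulrA.
Qed.

Lemma psiZ (a : F) (c : 'rV[F]_d) : psi (a *: c) = a *: psi c.
Proof. by rewrite scaler_sumr; apply: eq_bigr => i _; rewrite mxE scalerA mulrA. Qed.

Definition scaled_pair (a : F) (y z : nat * ext) := y.1 = z.1 /\ y.2 = a *: z.2.

Lemma mwedge_scaled a c y y' z z' : scaled_pair a y y' -> scaled_pair c z z' ->
  scaled_pair (a * c) (mwedge y z) (mwedge y' z').
Proof.
move=> [e1 e2] [e3 e4]; rewrite /mwedge e1 e3; case: ifP => _; split=> //=.
  by rewrite e2 e4 wedgeZl wedgeZr scalerA.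
by rewrite e2 e4 capZl capZr scalerA.
Qed.

End Cap.

Section Top.
Variables (F : numFieldType) (n d : nat) (sigma : int -> int).
Hypotheses (hd : (2 < d)%N) (hsigma : signature n sigma) (hadm : admissible d sigma).
Variable r : 'I_n.
Implicit Types (j : int) (k l t : nat) (u : 'M[F]_(n, d)) (x : F).

Definition hit_row j : nat := (absz (j %% n%:Z)%Z == r) : nat.

Definition row_count j t : nat := (\sum_(i < t.+1) hit_row (j + i%:Z))%N.

(** The value 0 outside [0 < k < d] reflects the fixed components 1 and [vol] of degrees 0 and d. *)
Definition flag_deg j k : int :=
  if (0 < k < d)%N then (row_count j (first_hit d sigma j k))%:Z else 0.

Lemma row_countS j t : row_count j t.+1 = (hit_row j + row_count (j + 1) t)%N.
Proof.
rewrite /row_count big_ord_recl /= addr0; congr (_ + _)%N; apply: eq_bigr => i _.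
by congr hit_row; rewrite /bump /=; lia.
Qed.

Lemma row_count0 j : row_count j 0 = hit_row j.
Proof. by rewrite /row_count big_ord_recl big_ord0 addn0 /= addr0. Qed.

Lemma n_gt0 : (0 < n)%N.
Proof. by case: hsigma; lia. Qed.

Lemma arg_scl x u j : arg (scl r x u) j = x ^+ hit_row j *: arg u j.
Proof.
rewrite /arg /hit_row; case: insubP => [a _ aE|]; last first.
  by case/negP; have := n_gt0; have := modz_ge0 j (_ : n%:Z != 0);
     have := ltz_pmod j (_ : 0 < n%:Z); lia.
apply/rowP => b; rewrite !mxE -aE; case: eqP => [->|ne]; first by rewrite eqxx expr1.
by case: eqP => [/val_inj //|_]; rewrite expr0.
Qed.

Lemma arg_ext_scl x u j :
  scaled_pair (x ^+ hit_row j) (arg_ext sigma (scl r x u) j) (arg_ext sigma u j).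
Proof.
by rewrite /arg_ext; case: ifP => _; split=> //=; rewrite arg_scl ?vecZ ?psiZ.
Qed.

Lemma iter_scl x u j t : scaled_pair (x ^+ row_count j t)
  (iter_mwedge (arg_ext sigma (scl r x u)) j t) (iter_mwedge (arg_ext sigma u) j t).
Proof.
elim: t j => [|t IH] j; first by rewrite row_count0; exact: arg_ext_scl.
rewrite row_countS exprD; apply: mwedge_scaled; [exact: arg_ext_scl | exact: IH].
Qed.

Lemma Fflag_scl x u j k : (0 < k < d)%N ->
  Fflag sigma (scl r x u) j k = x ^ flag_deg j k *: Fflag sigma u j k.
Proof. by move=> kd; rewrite /flag_deg kd; have [_] := iter_scl x u j (first_hit d sigma j k). Qed.

(** * Degrees of the top flags *)

Lemma first_hitP j k : (k < d)%N ->
  hits d sigma j k (first_hit d sigma j k) /\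
  forall t, hits d sigma j k t -> (first_hit d sigma j k <= t)%N.
Proof.
move=> kd; rewrite /first_hit; case: pselect => [h|[]]; last exact: hadm.
by case: ex_minnP => m hm hmin; split.
Qed.

Lemma first_hit_uniq j k t : (k < d)%N -> hits d sigma j k t ->
  (forall s, (s < t)%N -> ~~ hits d sigma j k s) -> first_hit d sigma j k = t.
Proof.
move=> kd ht hs; have [h1 h2] := first_hitP j kd; apply/eqP; rewrite eqn_leq h2 //=.
by rewrite leqNgt; apply/negP => /hs; rewrite h1.
Qed.

Lemma hits0 j k : hits d sigma j k 0 = (sigma j == k %[mod d])%Z.
Proof. by rewrite /hits big_ord_recl big_ord0 addr0 /= addr0. Qed.

Lemma hitsS j k t : hits d sigma j k t.+1 =
  (\sum_(i < t.+1) sigma (j + 1 + i%:Z) == k%:Z - sigma j %[mod d])%Z.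
Proof.
rewrite /hits big_ord_recl /= addr0 -(eqz_modDl (sigma j) (\sum_(i < _) _)).
rewrite [sigma j + (_ - _)]addrC subrK; congr ((_ + _) %% _ == _)%Z.
by apply: eq_bigr => i _; congr sigma; rewrite /bump /=; lia.
Qed.

Lemma small_mod (a c : nat) : (a < d)%N -> (c < d)%N ->
  (a%:Z == c%:Z %[mod d])%Z = (a == c).
Proof. by move=> ad cd; rewrite !modz_nat !modn_small. Qed.

(** The first partial sum is 1 and not yet k + 1, so F_j^(k+1) is formed by u_j in front of
    F_(j+1)^k. For a covector the sum starts at -1, that is d - 1, and the degree drops instead. *)
Lemma first_hit_up j k : sigma j = 1 -> (0 < k)%N -> (k.+1 < d)%N ->
  first_hit d sigma j k.+1 = (first_hit d sigma (j + 1) k).+1.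
Proof.
move=> sj k0 kd; have [h1 h2] := first_hitP (j + 1) (ltnW kd).
have E t : hits d sigma j k.+1 t.+1 = hits d sigma (j + 1) k t.
  by rewrite hitsS sj /hits; congr (_ == _ %[mod d])%Z; lia.
apply: first_hit_uniq => //; first by rewrite E.
move=> [_|s]; last by rewrite ltnS E => hs; apply/negP => /h2; lia.
by rewrite hits0 sj (small_mod (a := 1)) //; lia.
Qed.

Lemma first_hit_down j k : sigma j = -1 -> (1 < k)%N -> (k < d)%N ->
  first_hit d sigma j k.-1 = (first_hit d sigma (j + 1) k).+1.
Proof.
move=> sj k0 kd; have [h1 h2] := first_hitP (j + 1) kd.
have E t : hits d sigma j k.-1 t.+1 = hits d sigma (j + 1) k t.
  by rewrite hitsS sj /hits; congr (_ == _ %[mod d])%Z; lia.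
apply: first_hit_uniq => //; [lia|by rewrite E|].
move=> [_|s]; last by rewrite ltnS E => hs; apply/negP => /h2; lia.
have -> : hits d sigma j k.-1 0 = (d.-1%:Z == k.-1%:Z %[mod d])%Z.
  rewrite hits0 sj; congr (_ == _); rewrite -(modzDr (-1)); congr (_ %% _)%Z; lia.
by rewrite small_mod; lia.
Qed.

Lemma first_hit_1 j : sigma j = 1 -> first_hit d sigma j 1 = 0%N.
Proof.
by move=> sj; apply: first_hit_uniq => //; [lia|rewrite hits0 sj eqxx].
Qed.

Lemma first_hit_d1 j : sigma j = -1 -> first_hit d sigma j d.-1 = 0%N.
Proof.
move=> sj; apply: first_hit_uniq => //; first lia.
rewrite hits0 sj -(modzDr (-1)); apply/eqP; congr (_ %% _)%Z; lia.
Qed.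

Lemma flag_deg_up j k : sigma j = 1 -> (k.+1 < d)%N ->
  flag_deg j k.+1 = (hit_row j)%:Z + flag_deg (j + 1) k.
Proof.
move=> sj kd; rewrite /flag_deg kd /=; case: (posnP k) => [->|k0] /=.
  by rewrite first_hit_1 // row_count0 addr0.
by rewrite first_hit_up // row_countS PoszD ltnW.
Qed.

Lemma flag_deg_down j k : sigma j = -1 -> (1 < k <= d)%N ->
  flag_deg j k.-1 = (hit_row j)%:Z + flag_deg (j + 1) k.
Proof.
move=> sj kd; rewrite /flag_deg (_ : (0 < k.-1 < d)%N); last lia.
case: (ltnP k d) => k1; last first.
  have -> : k = d by lia.
  by rewrite andbF first_hit_d1 // row_count0 addr0.
have k2 : (1 < k)%N by lia.
by rewrite (ltnW k2) first_hit_down // row_countS PoszD.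
Qed.

Definition gap_deg j k l : int :=
  if sigma j == 1 then (if (k <= l)%N then flag_deg j l else flag_deg (j + 1) l)
  else (if (l <= d - k)%N then flag_deg j l else flag_deg (j + 1) l).

Lemma Fgap_scl x u j k l : (0 < l < d)%N ->
  Fgap sigma (scl r x u) j k l = x ^ gap_deg j k l *: Fgap sigma u j k l.
Proof.
by move=> ld; rewrite /Fgap /gap_deg; do 2 case: ifP => _; rewrite Fflag_scl.
Qed.

Variables (p q : nat).

Definition top_deg g l : int := gap_deg (p + g %/ d.-1)%N%:Z (g %% d.-1).+1 l.

Local Notation bs := [seq sigma i%:Z == 1 | i <- iota p (q - p)].

Lemma betaE : beta d sigma p q = blocks d bs.
Proof. by rewrite /beta /blocks -map_comp. Qed.

Lemma size_rho b : size (rho_word d b) = d.-1.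
Proof. by rewrite /rho_word; case: b; rewrite ?size_rev size_iota. Qed.

Lemma nth_rho b k : (k < d.-1)%N ->
  nth 0%N (rho_word d b) k = if b then k.+1 else (d - k.+1)%N.
Proof.
move=> kd; rewrite /rho_word; case: b; first by rewrite nth_iota.
by rewrite nth_rev ?size_iota // nth_iota; lia.
Qed.

Lemma size_blocks (s : seq bool) : size (blocks d s) = (size s * d.-1)%N.
Proof. by elim: s => //= b s IH; rewrite /blocks /= size_cat size_rho IH mulSn. Qed.

Lemma nth_blocks (s : seq bool) m : (m < size (blocks d s))%N ->
  nth 0%N (blocks d s) m =
  nth 0%N (rho_word d (nth false s (m %/ d.-1))) (m %% d.-1).
Proof.
have d1 : (0 < d.-1)%N by lia.
elim: s m => //= b s IH m; rewrite /blocks /= size_cat size_rho nth_cat size_rho.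
case: (ltnP m d.-1) => md h; first by rewrite divn_small // modn_small.
have := IH (m - d.-1)%N; rewrite /blocks => IHm; rewrite IHm; last lia.
have mE : (m = (m - d.-1) + d.-1)%N by lia.
by rewrite [in RHS]mE divnDr ?dvdnn // divnn d1 addn1 modnDr.
Qed.

Lemma top_letter m : (m < size (beta d sigma p q))%N ->
  nth 0%N (beta d sigma p q) m =
  if sigma (p + m %/ d.-1)%N%:Z == 1 then (m %% d.-1).+1 else (d - (m %% d.-1).+1)%N.
Proof.
have d1 : (0 < d.-1)%N by lia.
rewrite betaE => h; rewrite nth_blocks // nth_rho ?ltn_pmod //.
have hm : (m %/ d.-1 < q - p)%N.
  by rewrite ltn_divLR //; move: h; rewrite size_blocks size_map size_iota.
by rewrite (nth_map 0%N) ?size_iota // nth_iota.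
Qed.

Lemma sigma_cases j : sigma j = 1 \/ (sigma j = -1 /\ (sigma j == 1) = false).
Proof. by have [_ /(_ j)[->|->] _] := hsigma; [left|right]. Qed.

Lemma next_gap m : (m %% d.-1).+1 = d.-1 /\ (m.+1 %/ d.-1 = (m %/ d.-1).+1)%N /\
    (m.+1 %% d.-1 = 0)%N \/
  [/\ ((m %% d.-1).+1 < d.-1)%N, (m.+1 %/ d.-1 = m %/ d.-1)%N &
    (m.+1 %% d.-1 = (m %% d.-1).+1)%N].
Proof.
have d1 : (0 < d.-1)%N by lia.
have lt := ltn_pmod m d1; have E := divn_eq m d.-1.
case: (eqVneq (m %% d.-1).+1 d.-1) => h; [left|right].
  have E1 : m.+1 = ((m %/ d.-1).+1 * d.-1)%N by rewrite {1}E mulSn; lia.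
  by rewrite E1 mulnK // modnMl.
have lt' : ((m %% d.-1).+1 < d.-1)%N by lia.
have E1 : m.+1 = (m %/ d.-1 * d.-1 + (m %% d.-1).+1)%N by lia.
split=> //; first by rewrite E1 divnMDl // (divn_small lt') addn0.
by rewrite E1 modnMDl (modn_small lt').
Qed.

Lemma flag_deg_ends j l : (l == 0)%N || (d <= l)%N -> flag_deg j l = 0.
Proof. by rewrite /flag_deg => h; rewrite (_ : (0 < l < d)%N = false) //; lia. Qed.

Lemma gap_deg_first j l : gap_deg j 1 l = flag_deg j l.
Proof.
rewrite /gap_deg; case: ifP => _; case: ifP => h //; rewrite !flag_deg_ends //; lia.
Qed.

Lemma top_same m l : (m < size (beta d sigma p q))%N ->
  l <> nth 0%N (beta d sigma p q) m -> top_deg m.+1 l = top_deg m l.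
Proof.
move=> mb; rewrite top_letter // /top_deg; have lt := @ltn_pmod m d.-1 (ltac:(lia)).
case: (next_gap m) => [[e1 [-> ->]]|[e1 -> ->]]; set k := (m %% d.-1).+1 in e1 *.
  rewrite gap_deg_first addnS /gap_deg e1.
  have -> : (p + m %/ d.-1).+1%N%:Z = (p + m %/ d.-1)%N%:Z + 1 by lia.
  set j := (p + m %/ d.-1)%N%:Z; case: ifP => sj hl; case: ifP => h //.
    by rewrite !flag_deg_ends //; lia.
  by rewrite !flag_deg_ends //; lia.
rewrite /gap_deg; case: ifP => sj hl.
  by rewrite (_ : (k < l)%N = (k <= l)%N) //; lia.
by rewrite (_ : (l <= d - k.+1)%N = (l <= d - k)%N) //; lia.
Qed.

(** The trace in degrees of a crossing value 1: by [flag_deg_up] or [flag_deg_down] the argument u_j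
    enters two components of F_j equally often, and the two contributions cancel. *)
Lemma top_unmarked m : (m < size (beta d sigma p q))%N -> ~~ marked d m ->
  edge_deg (beta d sigma p q) [::] (fun _ => top_deg) 0 m = 0.
Proof.
move=> mb; rewrite /marked /edge_deg /= => mk; rewrite [word_at _ _ _]/= top_letter //.
rewrite /top_deg; have lt := @ltn_pmod m d.-1 (ltac:(lia)).
case: (next_gap m) => [[e1 [e2 e3]]|[e1 -> ->]].
  by case/negP: mk; rewrite /dvdn e3.
set k := (m %% d.-1).+1 in e1 *; set j := (p + m %/ d.-1)%N%:Z.
rewrite /gap_deg; case: (sigma_cases j) => [sj|[sj sj1]].
  rewrite sj eqxx /= leqnn ltnn leqnSn (_ : (k <= k.-1)%N = false); last lia.
  rewrite flag_deg_up //; last lia.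
  have -> : flag_deg j k = (hit_row j)%:Z + flag_deg (j + 1) k.-1.
    by rewrite -flag_deg_up // prednK //; lia.
  ring.
rewrite sj1.
have -> : (d - k <= d - k)%N by [].
have -> : (d - k <= d - k.+1)%N = false by lia.
have -> : ((d - k).-1 <= d - k)%N by lia.
have -> : ((d - k).+1 <= d - k)%N = false by lia.
rewrite flag_deg_down //; last lia.
have -> : flag_deg j (d - k) = (hit_row j)%:Z + flag_deg (j + 1) (d - k).+1.
  by rewrite -flag_deg_down //; lia.
ring.
Qed.

Lemma first_hit_period j k : (k < d)%N ->
  first_hit d sigma (j + n%:Z) k = first_hit d sigma j k.
Proof.
move=> kd; have [_ _ per] := hsigma.
have hE k' t : hits d sigma (j + n%:Z) k' t = hits d sigma j k' t.
  rewrite /hits; congr (_ == _ %[mod d])%Z; apply: eq_bigr => i _.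
  by rewrite -(per (j + _)); congr sigma; lia.
have [h1 h2] := first_hitP j kd; apply: first_hit_uniq; rewrite ?hE //.
by move=> s hs; rewrite hE; apply/negP => /h2; lia.
Qed.

Lemma flag_deg_period j k : flag_deg (j + n%:Z) k = flag_deg j k.
Proof.
rewrite /flag_deg; case: ifP => // kd; rewrite first_hit_period; last lia.
congr Posz; apply: eq_bigr => i _; rewrite /hit_row.
by rewrite addrAC modzDr.
Qed.

End Top.

(** * Skew symmetry of the pairing and the outer regions of a weave *)

Section Skew.
Variables (b : word) (mk : pred nat) (w : seq move) (b' : word).
Hypothesis hw : is_weave b w b'.
Local Notation cyc := (Defs.cycle b mk w).

Lemma pairing_skew (c c' : cyc) : pairing c c' = - pairing c' c.
Proof.
rewrite /pairing -sumrN; apply: eq_bigr => t _; rewrite /local_pairing.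
have half (z : int) : ((z + z) %/ 2)%Z = z.
  by have -> : z + z = z * 2 by [ring]; rewrite mulzK.
have W c0 := @weight_six b mk w b' hw c0 t (ltn_ord t); move: W.
case: (move_at w t) => -[] m /= W; rewrite ?addn0 ?addn1 ?addn2; last 2 first.
- by rewrite oppr0.
- have [h1 h2 h3] := W c erefl; have [h1' h2' h3'] := W c' erefl.
  have -> : (weight c t.+1 m)%:Z = (weight c t m.+1)%:Z + (weight c t m.+2)%:Z - (weight c t.+1 m.+1)%:Z by lia.
  have -> : (weight c t.+1 m.+2)%:Z = (weight c t m)%:Z + (weight c t m.+1)%:Z - (weight c t.+1 m.+1)%:Z by lia.
  have -> : (weight c' t.+1 m)%:Z = (weight c' t m.+1)%:Z + (weight c' t m.+2)%:Z - (weight c' t.+1 m.+1)%:Z by lia.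
  have -> : (weight c' t.+1 m.+2)%:Z = (weight c' t m)%:Z + (weight c' t m.+1)%:Z - (weight c' t.+1 m.+1)%:Z by lia.
  by rewrite !D_sixvalent !half !DE; ring.
by rewrite !DE; ring.
Qed.

Lemma graded_leftmost A0 T dg A t i : graded (mk := mk) (w := w) (b := b) A0 T dg A ->
  (t <= T)%N -> A t 0%N i = A0 0%N i.
Proof.
move=> gA; elim: t => [|t IH] tT; first by rewrite (gr_top gA).
by rewrite (gr_left gA) // IH // ltnW.
Qed.

Lemma graded_rightmost A0 T dg A t i : graded (mk := mk) (w := w) (b := b) A0 T dg A ->
  (T <= size w)%N -> (t <= T)%N -> A t (size (word_at b w t)) i = A0 (size b) i.
Proof.
move=> gA Tw; elim: t => [|t IH] tT; first by rewrite (gr_top gA) word_at0.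
have tw : (t < size w)%N by lia.
have fit := vertex_fits hw tw; have sz := size_word_atS hw tw.
rewrite -IH; last lia.
have -> : size (word_at b w t.+1) = shift_edge (move_at w t).1 (size (word_at b w t)).
  by rewrite /shift_edge; lia.
by rewrite (gr_right gA).
Qed.

Section Ends.
Variables (F : numFieldType) (d : nat) (Fl : nat -> nat -> flag F d) (de : cyc -> F).
Hypothesis dFl : is_decoration Fl de.

Lemma leftmost t : (t <= size w)%N -> flag_eq (Fl t 0%N) (Fl 0%N 0%N).
Proof.
have [_ fL _ _] := dFl; elim: t => [|t IH] tw k kd //.
by rewrite (fL _ _ tw (leq0n _) k kd); apply: IH => //; exact: ltnW.
Qed.

Lemma rightmost t : (t <= size w)%N ->
  flag_eq (Fl t (size (word_at b w t))) (Fl 0%N (size b)).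
Proof.
have [_ _ fR _] := dFl; elim: t => [|t IH] tw k kd; first by rewrite word_at0.
rewrite -IH //; last exact: ltnW.
have fit := vertex_fits hw tw; have sz := size_word_atS hw tw.
have -> : size (word_at b w t.+1) = shift_edge (move_at w t).1 (size (word_at b w t)).
  by rewrite /shift_edge; lia.
move: fit (fR t (size (word_at b w t)) tw); rewrite /shift_edge.
by case: (move_at w t) => v m /= fit; apply=> //; rewrite fit leqnn.
Qed.

End Ends.
End Skew.

(** * The cluster variables of one weave *)

Section WeaveVariables.
Variables (F : numFieldType) (n d : nat) (sigma : int -> int).
Hypotheses (hd : (2 < d)%N) (hsigma : signature n sigma) (hadm : admissible d sigma).
Variables (p q : nat) (w : seq move) (b' : word).
Local Notation b := (beta d sigma p q).
Hypothesis hw : is_weave b w b'.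
Variable Delta : top_cycle d sigma p q w -> ratfun F n d.
Hypothesis cv : cluster_variables Delta.
Local Notation cyc := (Defs.cycle b (marked d) w).

Lemma letters_beta : all (letters d) b.
Proof. by rewrite betaE letters_blocks. Qed.

Lemma size_beta : size b = ((q - p) * d.-1)%N.
Proof. by rewrite betaE size_blocks // size_map size_iota. Qed.

Lemma cluster_variable_neq0 c : Delta c != 0.
Proof.
have [_ /generic_ex[u [de [Fl [h _ _]]]]] := cv.
by have [d0 hv] := h c; exact: has_value_neq0 hv d0.
Qed.

(** For generic [u] both [u] and its rescaling carry a decoration, and [decoration_scaled]
    identifies the combinatorial degrees with the exponents between them. *)
Lemma weave_graded r : exists dg A,
  graded (b := b) (mk := marked d) (w := w) (top_deg d sigma r p) (size w) dg A /\
  forall c, hom r (dg c) (Delta c).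
Proof.
have [|m l mb|dg [A gA]] := @graded_exists b (marked d) w b' d hw letters_beta (top_deg d sigma r p).
- move=> m mb mk; have := top_unmarked hd hsigma hadm r mb mk.
  by rewrite /edge_deg !word_at0.
- exact: top_same.
exists dg, A; split=> // c; apply: hom_value => x x0; have [_ gen] := cv.
apply: generic_imp (generic_and gen (generic_scl r x0 gen)) => u.
move=> [[de [Fl [hde top dFl]]] [de' [Fl' [hde' top' dFl']]]].
exists (de c); split; first by case: (hde c).
have -> : x ^ dg c * de c = de' c; last by case: (hde' c).
have [|||_] := decoration_scaled (ltac:(lia) : (1 < d)%N) hw letters_beta gA _ x0 _ dFl dFl' _ (leqnn (size w)).
- by move=> i id; rewrite /top_deg div0n mod0n gap_deg_first // flag_deg_ends //; lia.
- by move=> c'; case: (hde c').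
- by move=> g i gb id; rewrite (top g gb i id) (top' g gb i id) Fgap_scl.
by move/(_ c (level_le c)).
Qed.

Hypotheses (pq : (d < q - p)%N) (rb : reduced_word d b').

Lemma Fgap_first (u : 'M[F]_(n, d)) j k : (0 < k < d)%N -> Fgap sigma u j 1 k = Fflag sigma u j k.
Proof. by move=> kd; rewrite /Fgap; do 2 case: ifP => //; lia. Qed.

(** [gallery_det] is applied to the bottom level, whose outer flags are F_p and F_q. Of the edges
    crossing the threshold [k] only the one that exchanges [k] and [k + 1] has a nontrivial value,
    and only [gam k] passes through it. *)
Lemma bottom_value : exists gam : nat -> cyc,
  [/\ forall (c : cyc) e, (e < size b')%N -> weight c (size w) e =
         (vb b' e == (va b' e).+1) && (c == gam (va b' e)),
      forall (c : cyc) e, (e < size b')%N -> level c = 0%N -> weight c (size w) e = 0%N,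
      forall k, (0 < k < d)%N -> exists e, [/\ (e < size b')%N, va b' e = k & vb b' e = k.+1] &
      forall k, (0 < k < d)%N -> generically (fun u => has_value (Delta (gam k)) u
        (det (wedge (Fflag sigma u p%:Z k) (Fflag sigma u q%:Z (d - k)%N))))].
Proof.
pose bs := [seq sigma i%:Z == 1 | i <- iota p (q - p)].
have hbs : (d < size bs)%N by rewrite size_map size_iota.
have bE : b = blocks d bs by exact: betaE.
have [gam [h1 h2]] := @bottom_weights b (marked d) w b' hw d bs hd hbs bE rb.
exists gam; split=> //.
  by move=> c e eb l0; exact: (bottom_top hw hd hbs bE rb eb l0).
move=> k kd; have [_ gen] := cv; apply: generic_imp gen => u [de [Fl [hde top dFl]]].
have d1 : (1 < d)%N by lia.
have wb : word_at b w (size w) = b' by exact: word_at_bottom hw.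
have [fl1 _ _ cr] := dFl.
have asc' := asc_b' hw bE rb.
have sd : sortd d k (pure b' id).
  by rewrite -(asc_run asc') -wb (run_word_at hw) //; exact: (sortd_b hbs bE kd).
have := @gallery_det F d d1 b' (Fl (size w)) (edge_value (b := b) (mk := marked d) (w := w) de (size w)) k
  (letters_b' hw bE) asc' kd sd.
rewrite -{1 2 3 4 5}wb => H.
have {H} H := H (fun m => fl1 _ _ (leqnn _)) (fun m => cr _ _ (leqnn _)) (fun m _ => edge_value_neq0 (fun c => proj1 (hde c)) _ _).
have kd' : (0 < d - k < d)%N by lia.
move: H; rewrite !fl_mid // (leftmost dFl (leqnn _) kd) (rightmost hw dFl (leqnn _) kd').
rewrite (top _ (leq0n _) _ kd) (top _ (leqnn _) _ kd') div0n mod0n addn0 size_beta.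
rewrite mulnK ?modnMl; last lia.
rewrite subnKC; last lia.
rewrite !Fgap_first // => ->.
have [e [eb ea ev]] := h2 k kd.
rewrite (bigD1 (Ordinal eb)) //= ea ev leqnn ltnSn big1 ?mulr1.
  rewrite /edge_value (bigD1 (gam k)) //= big1 ?mulr1 => [|c nc].
    by rewrite /weight h1 // ea ev !eqxx expr1; case: (hde (gam k)).
  by rewrite /weight h1 // ea ev eqxx (negPf nc) expr0.
move=> [e' eb'] /= ne; case: ifP => // rng.
rewrite /edge_value big1 // => c _; rewrite /weight h1 //.
case: eqP => /= [v1|_]; last by rewrite expr0.
have ea' : va b' e' = k by lia.
case/negP: ne; apply/eqP/val_inj => /=; case: (ltngtP e' e) => // h; exfalso.
  by apply: (asc_uniq asc' h eb); lia.
by apply: (asc_uniq asc' h eb'); lia.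
Qed.

End WeaveVariables.

(** * Balanced seeds and mutation *)

Section Mutation.
Variables (F : numFieldType) (n d : nat) (sigma : int -> int).

(* The last condition makes the two monomials of every exchange relation
   have the same degree. *)
Definition balanced (I : finType) (S : seed (ratfun F n d) I) : Prop :=
  exists a : 'I_n -> I -> int,
    [/\ forall v, in_K sigma (var S v), forall r v, hom r (a r v) (var S v),
        forall v v', arrows S v v' = - arrows S v' v &
        forall r k, mutable S k -> \sum_v arrows S k v * a r v = 0].

Lemma pos_diff (x : int) : (pos x)%:Z - (pos (- x))%:Z = x.
Proof. by rewrite /pos; lia. Qed.

(** Balance at [k] gives both exchange monomials the degree [inn r]. At another mutable vertex [v]
    the added arrows contribute [arrows S v k * inn r]; the reversed arrow to the new variable of
    degree [inn r - a r k] cancels this and replaces the old term of [k]. *)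
Lemma balanced_mutate (I : finType) (S : seed (ratfun F n d) I) k :
  mutable S k -> balanced S -> balanced (mutate S k).
Proof.
move=> mk [a [SK Sh sk bal]].
pose out r := \sum_v a r v * (pos (arrows S k v))%:Z.
pose inn r := \sum_v a r v * (pos (arrows S v k))%:Z.
have oi r : out r = inn r.
  apply/eqP; rewrite -subr_eq0 -sumrB; apply/eqP; rewrite -[RHS](bal r k mk); apply: eq_bigr => v _.
  by rewrite -mulrBr (sk v k) pos_diff mulrC.
have kk : arrows S k k = 0 by have := sk k k; lia.
exists (fun r v => if v == k then inn r - a r k else a r v); split=> /=.
- move=> v; case: eqP => // _; apply: in_KM; last exact: in_KV.
  by apply: in_KD; apply: in_K_prod => v'; exact: in_KX.
- move=> r v; case: eqP => // _; apply: homM; last exact: homV.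
  by apply: homD; first rewrite /inn; last rewrite -oi /out;
    apply: hom_prod => v'; exact: homX.
- move=> v v'; rewrite orbC [arrows S v v']sk; case: ifP => _; ring.
move=> r v mv; case: (eqVneq v k) => [->|vk].
  under eq_bigr => v' _ do rewrite mulNr.
  rewrite sumrN; apply/eqP; rewrite oppr_eq0; apply/eqP; rewrite -[RHS](bal r k mk); apply: eq_bigr => v' _.
  by case: eqP => // ->; rewrite kk !mul0r.
rewrite (bigD1 k) //= eqxx.
have -> : \sum_(v' | v' != k)
      (if v' == k then - arrows S v v' else arrows S v v' +
         (pos (arrows S v k) * pos (arrows S k v'))%:Z -
         (pos (arrows S v' k) * pos (arrows S k v))%:Z) *
      (if v' == k then inn r - a r k else a r v') =
    \sum_v' arrows S v v' * a r v' - arrows S v k * a r k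
    + ((pos (arrows S v k))%:Z * out r - (pos (arrows S k v))%:Z * inn r).
  pose G v' := arrows S v v' * a r v' + (pos (arrows S v k))%:Z * (a r v' * (pos (arrows S k v'))%:Z)
    - (pos (arrows S k v))%:Z * (a r v' * (pos (arrows S v' k))%:Z).
  have -> : out r = \sum_v a r v * (pos (arrows S k v))%:Z by [].
  have -> : inn r = \sum_v a r v * (pos (arrows S v k))%:Z by [].
  rewrite !mulr_sumr addrAC addrA -big_split -sumrB /= -/(G _).
  rewrite [\sum_v' _ in RHS](bigD1 k) //= kk; have -> : pos 0 = 0%N by [].
  rewrite !mulr0 subr0 addr0 addrAC subrr add0r.
  by apply: eq_bigr => v' /negPf ->; rewrite !PoszM; ring.
rewrite bal // oi (sk k v); have := pos_diff (arrows S v k).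
by set x := (pos _)%:Z; set y := (pos _)%:Z => <-; ring.
Qed.

Lemma balanced_mutation_equiv (I : finType) (S0 S : seed (ratfun F n d) I) :
  mutation_equiv S0 S -> balanced S0 -> balanced S.
Proof. by elim=> // {}S k _ IH mk /IH; exact: balanced_mutate. Qed.

Lemma balanced_multihomogeneous (I : finType) (S : seed (ratfun F n d) I) v :
  balanced S -> multihomogeneous sigma (var S v).
Proof. by move=> [a [SK Sh _ _]]; apply: (hom_multihomogeneous (a := fun r => a r v)). Qed.

End Mutation.

(** * Gluing the two weaves of a cut *)

Section DetSym.
Variables (F : numFieldType) (d : nat).

(** The pairs counted by the two signs partition the product of A and B. *)
Lemma sgn_swap (A B : {set 'I_d}) : [disjoint A & B] ->
  sgn F A B = (-1) ^+ (#|A| * #|B|)%N * sgn F B A.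
Proof.
move=> dAB; rewrite /sgn.
set s := [set _ | _]; set t := [set ab : 'I_d * 'I_d | [&& ab.1 \in B, _ & _]].
have inj : injective (fun ab : 'I_d * 'I_d => (ab.2, ab.1)) by move=> [a b] [a' b'] [-> ->].
have -> : (#|A| * #|B| = #|s| + #|t|)%N.
  rewrite -cardsX -(card_imset (mem t) inj) -cardsUI.
  have -> : s :&: [set (ab.2, ab.1) | ab in t] = set0.
    apply/setP => -[a b]; rewrite !inE /=; apply/negP => /andP[/and3P[_ _ lt]].
    by move=> /imsetP[[a' b']]; rewrite inE /= => /and3P[_ _ lt'] [? ?]; subst; lia.
  rewrite cards0 addn0; apply: eq_card => -[a b]; rewrite !inE /=.
  apply/andP/idP => [[aA bB]|].
    case: (ltngtP b a) => ab; first by rewrite aA bB.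
      rewrite !andbF /=; apply/imsetP; exists (b, a) => //.
      by rewrite inE /= aA bB.
    by move/pred0P/(_ a): dAB; rewrite /= aA -(val_inj ab) bB.
  case/orP => [/and3P[]//|/imsetP[[a' b']]].
  by rewrite inE /= => /and3P[? ? _] [-> ->].
by rewrite exprD -mulrA -expr2 -exprM mulnC exprM sqrrN !expr1n mulr1.
Qed.

(** For odd d one of two complementary sets has even size, so all the signs of [sgn_swap] are 1. *)
Lemma det_wedge_odd (x y : ext F d) : odd d -> det (wedge x y) = det (wedge y x).
Proof.
move=> od; rewrite /det !ffunE [RHS](reindex_inj (@setC_inj _)) /=.
apply: eq_big => [A|A _]; first by rewrite !subsetT.
rewrite !setTD setCK sgn_swap; last by rewrite disjoints_subset setCK.
rewrite -signr_odd (_ : odd _ = false) ?expr0; first by ring.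
by have := congr1 odd (cardsC A); rewrite card_ord od oddM oddD; do 2 case: (odd _).
Qed.

End DetSym.

Section Amalgam.
Variables (F : numFieldType) (n d : nat) (sigma : int -> int).
Hypotheses (hd : (2 < d)%N) (od : odd d).
Hypotheses (hsigma : signature n sigma) (hadm : admissible d sigma).
Variables (p q : nat) (w1 w2 : seq move) (b' : word).
Hypothesis cut : valid_cut n d p q.
Local Notation b1 := (beta d sigma p q).
Local Notation b2 := (beta d sigma q (p + n)).
Hypotheses (hw1 : is_weave b1 w1 b') (rb1 : reduced_word d b').
Hypotheses (hw2 : is_weave b2 w2 (rev b')) (rb2 : reduced_word d (rev b')).
Local Notation cyc1 := (Defs.cycle b1 (marked d) w1).
Local Notation cyc2 := (Defs.cycle b2 (marked d) w2).
Variables (Delta1 : top_cycle d sigma p q w1 -> ratfun F n d)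
  (Delta2 : top_cycle d sigma q (p + n) w2 -> ratfun F n d).
Hypotheses (cv1 : cluster_variables Delta1) (cv2 : cluster_variables Delta2).

Lemma Fflag_period (u : 'M[F]_(n, d)) j k : (0 < k < d)%N ->
  Fflag sigma u (j + n%:Z) k = Fflag sigma u j k.
Proof.
move=> kd; rewrite /Fflag first_hit_period //; last lia.
have E t i : iter_mwedge (arg_ext sigma u) (i + n%:Z) t = iter_mwedge (arg_ext sigma u) i t.
  elim: t i => [|t IH] i /=; last rewrite addrAC IH.
    by rewrite /arg_ext /arg modzDr; have [_ _ ->] := hsigma.
  by rewrite /arg_ext /arg modzDr; have [_ _ ->] := hsigma.
by rewrite E.
Qed.

Lemma asc_b1 : asc b' id.
Proof. exact: (asc_b' hw1 (betaE d sigma p q) rb1). Qed.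

Lemma letters_b1 : all (letters d) b'.
Proof. exact: (letters_b' hw1 (betaE d sigma p q)). Qed.

Lemma sortd_b1 k : (0 < k < d)%N -> sortd d k (pure b' id).
Proof.
move=> kd; rewrite -(asc_run asc_b1) -(word_at_bottom hw1) (run_word_at hw1) //.
apply: (sortd_b _ (betaE d sigma p q) kd).
by rewrite size_map size_iota; case: cut => _ _ _; rewrite leq_min => /andP[].
Qed.

Local Notation N := (size b').
Local Notation simple e := (vb b' e == (va b' e).+1).

Lemma ends_range e : (e < N)%N -> (0 < va b' e < vb b' e)%N /\ (vb b' e <= d)%N.
Proof.
move=> eN; split; last exact: (vb_le letters_b1).
by rewrite (va_gt0 letters_b1) //=; exact: asc_nth asc_b1 eN.
Qed.

Lemma reverse_edge e : (e < N)%N ->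
  va (rev b') (N - e.+1) = (d.+1 - vb b' e)%N /\
  (vb (rev b') (N - e.+1) == (va (rev b') (N - e.+1)).+1) = simple e.
Proof.
move=> eN; have [h1 h2] := reverse_ends letters_b1 sortd_b1 eN.
by have [r1 r2] := ends_range eN; rewrite h1 h2; split=> //; lia.
Qed.

Variables (gam1 : nat -> cyc1) (gam2 : nat -> cyc2).
Hypotheses
  (W1 : forall (c : cyc1) e, (e < N)%N -> weight c (size w1) e =
     simple e && (c == gam1 (va b' e)))
  (W2 : forall (c : cyc2) e, (e < size (rev b'))%N -> weight c (size w2) e =
     (vb (rev b') e == (va (rev b') e).+1) && (c == gam2 (va (rev b') e)))
  (V1 : forall k, (0 < k < d)%N -> generically (fun u => has_value (Delta1 (gam1 k)) u
        (det (wedge (Fflag sigma u p%:Z k) (Fflag sigma u q%:Z (d - k)%N)))))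
  (V2 : forall k, (0 < k < d)%N -> generically (fun u => has_value (Delta2 (gam2 k)) u
        (det (wedge (Fflag sigma u q%:Z k) (Fflag sigma u (p + n)%N%:Z (d - k)%N))))).

(** The second weave sees F_q^(d-k) /\ F_(p+n)^k. Periodicity replaces F_(p+n) by F_p, and oddness
    of d lets the factors be exchanged. *)
Lemma shared_variable k : (0 < k < d)%N -> Delta1 (gam1 k) = Delta2 (gam2 (d - k)).
Proof.
move=> kd; have kd' : (0 < d - k < d)%N by lia.
apply: value_eq; apply: generic_imp (generic_and (V1 kd) (V2 kd')) => u [h1 h2].
exists (det (wedge (Fflag sigma u p%:Z k) (Fflag sigma u q%:Z (d - k)%N))); split=> //.
move: h2; rewrite PoszD Fflag_period; last lia.
by rewrite det_wedge_odd // (_ : (d - (d - k) = k)%N); last lia.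
Qed.

Lemma reverse_weight (c : cyc2) e : (e < N)%N -> weight c (size w2) (N - e.+1) =
  simple e && (c == gam2 (d - va b' e)).
Proof.
move=> eN; rewrite W2 ?size_rev; last lia.
have [-> ->] := reverse_edge eN; case: eqP => //= v1.
by congr (nat_of_bool (c == gam2 _)); lia.
Qed.

Section Row.
Variables (r : 'I_n) (dg1 : cyc1 -> int) (dg2 : cyc2 -> int).
Variables (A1 A2 : nat -> nat -> nat -> int).
Hypotheses (gA1 : graded (top_deg d sigma r p) (size w1) dg1 A1)
  (gA2 : graded (top_deg d sigma r q) (size w2) dg2 A2)
  (h1 : forall c, hom r (dg1 c) (Delta1 c)) (h2 : forall c, hom r (dg2 c) (Delta2 c)).

Lemma shared_degree k : (0 < k < d)%N -> dg1 (gam1 k) = dg2 (gam2 (d - k)).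
Proof.
move=> kd; apply: hom_uniq (cluster_variable_neq0 cv1 (gam1 k)) (h1 _) _.
by rewrite shared_variable.
Qed.

(** An edge exchanging [k] and [k + 1] carries [gam1 k], and its mirror image carries
    [gam2 (d - k)], of the same degree; on the other edges both totals are 0. *)
Lemma bottom_total e : (e < N)%N ->
  total_deg dg1 (size w1) e = total_deg dg2 (size w2) (N - e.+1).
Proof.
move=> eN; have [r1 r2] := ends_range eN; rewrite /total_deg.
transitivity (if simple e then dg1 (gam1 (va b' e)) else 0).
  case: ifP => se; last by rewrite big1 // => c _; rewrite W1 // se mul0r.
  rewrite (bigD1 (gam1 (va b' e))) //= W1 // se eqxx mul1r big1 ?addr0 // => c nc.
  by rewrite W1 // (negPf nc) andbF mul0r.
case: ifP => se; last by rewrite big1 // => c _; rewrite reverse_weight // se mul0r.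
rewrite shared_degree; last by move/eqP: se; lia.
rewrite (bigD1 (gam2 (d - va b' e))) //= reverse_weight // se eqxx mul1r big1 ?addr0 // => c nc.
by rewrite reverse_weight // (negPf nc) andbF mul0r.
Qed.

(** The two bottoms are read from opposite ends, starting at F_p and F_(p+n), whose degrees agree by
    periodicity. Each further region is determined by the previous one and by the degree of the edge
    between them. *)
Lemma bottom_gaps e l : (e <= N)%N -> A1 (size w1) e l = A2 (size w2) (N - e)%N l.
Proof.
have wb1 : word_at b1 w1 (size w1) = b' by exact: word_at_bottom hw1.
have wb2 : word_at b2 w2 (size w2) = rev b' by exact: word_at_bottom hw2.
elim: e l => [|e IH] l eN.
  have := graded_rightmost hw2 l gA2 (leqnn _) (leqnn _).
  rewrite (graded_leftmost _ gA1) // wb2 size_rev subn0 => ->.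
  rewrite size_beta // /top_deg mulnK ?modnMl; last lia.
  rewrite div0n mod0n !gap_deg_first // addn0 subnKC; last by case: cut; lia.
  by rewrite PoszD flag_deg_period.
have sE : (N - e = (N - e.+1).+1)%N by lia.
have lE : nth 0%N (rev b') (N - e.+1) = nth 0%N b' e.
  by rewrite nth_rev; [congr nth|]; lia.
have s1 l' : l' <> nth 0%N b' e -> A1 (size w1) e.+1 l' = A1 (size w1) e l'.
  by move=> h; rewrite (gr_same gA1) ?wb1.
have s2 l' : l' <> nth 0%N b' e ->
    A2 (size w2) (N - e.+1)%N l' = A2 (size w2) (N - e)%N l'.
  by move=> h; rewrite sE (gr_same gA2) ?wb2 ?lE ?size_rev //; lia.
case: (eqVneq l (nth 0%N b' e)) => [lb|/eqP nl]; last by rewrite s1 // s2 // IH // ltnW.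
have lpos : (0 < l)%N by rewrite lb; have /andP[] := allP letters_b1 _ (mem_nth 0%N eN).
have E1 := gr_edge gA1 (leqnn _) (ltac:(by rewrite wb1) : (e < size (word_at b1 w1 (size w1)))%N).
have E2 := gr_edge gA2 (leqnn _) (ltac:(rewrite wb2 size_rev; lia) : (N - e.+1 < size (word_at b2 w2 (size w2)))%N).
move: E1 E2; rewrite (bottom_total eN) /edge_deg wb1 wb2 lE -lb -sE => -> .
rewrite (s2 l.-1); last lia.
rewrite (s2 l.+1); last lia.
by rewrite -!IH //; lia.
Qed.

(** Mirror edges have equal weights, while left and right regions are interchanged, so the terms
    cancel in pairs. The hypothesis on [k] and [m] makes the weights match even before [gam1] and
    [gam2] are known to be injective. *)
Lemma shared_flux k :
  (forall m, (0 < m < d)%N -> (gam1 k == gam1 m) = (gam2 (d - k) == gam2 (d - m))) ->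
  flux A1 (gam1 k) (size w1) + flux A2 (gam2 (d - k)) (size w2) = 0.
Proof.
move=> inj; rewrite /flux.
have -> : word_at b1 w1 (size w1) = b' by exact: word_at_bottom hw1.
have -> : word_at b2 w2 (size w2) = rev b' by exact: word_at_bottom hw2.
rewrite !big_mkord size_rev [X in _ + X](reindex_inj rev_ord_inj) -big_split big1 // => -[e eN] _ /=.
rewrite W1 // reverse_weight // nth_rev; last lia.
rewrite (_ : (N - (N - e.+1).+1 = e)%N); last lia.
have [r1 r2] := ends_range eN; case: eqP => /= v1; last by rewrite !mul0r addr0.
rewrite inj; last lia.
rewrite !bottom_gaps //; last lia.
by rewrite (_ : (N - e.+1).+1 = (N - e)%N); [ring|lia].
Qed.

End Row.

Hypotheses
  (T1 : forall (c : cyc1) e, (e < N)%N -> level c = 0%N -> weight c (size w1) e = 0%N)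
  (T2 : forall (c : cyc2) e, (e < size (rev b'))%N -> level c = 0%N -> weight c (size w2) e = 0%N)
  (X1 : forall k, (0 < k < d)%N -> exists e, [/\ (e < N)%N, va b' e = k & vb b' e = k.+1]).

(** Top letters vanish at the bottom and these cycles do not, so they start at trivalent vertices;
    hence their flux at the top is 0. *)
Lemma shared_level k : (0 < k < d)%N ->
  (0 < level (gam1 k))%N /\ (0 < level (gam2 (d - k)))%N.
Proof.
move=> kd; have [e [eN ea eb]] := X1 kd.
split; rewrite lt0n; apply/eqP => /[dup] l0.
  by move/(T1 eN); rewrite W1 // ea eb !eqxx.
by move/(T2 (ltac:(rewrite size_rev; lia) : (N - e.+1 < size (rev b'))%N)); rewrite reverse_weight // ea eb !eqxx.
Qed.

End Amalgam.

Lemma big_fiber (I J : finType) (f : I -> J) (g : I -> int) (a : J -> int) :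
  \sum_v (\sum_(i | f i == v) g i) * a v = \sum_i g i * a (f i).
Proof.
under eq_bigr => v _ do rewrite mulr_suml.
rewrite (exchange_big_dep predT) //=; apply: eq_bigr => i _.
by rewrite (bigD1 (f i)) ?eqxx //= big1 ?addr0 // => v /andP[/eqP <-]; rewrite eqxx.
Qed.

Lemma frozenN b mk w (c : Defs.cycle b mk w) : ~~ frozen c ->
  (0 < level c)%N /\ forall e, weight c (size w) e = 0%N.
Proof.
rewrite /frozen negb_or /level => /andP[h /hasPn H]; split; first by case: (val c) h.
move=> e; case: (ltnP e (size (weights c (size w)))) => es; last exact: nth_default.
by apply/eqP; have := H _ (mem_nth 0%N es); rewrite negbK.
Qed.

(** * Balance of the initial seed *)

Section Initial.
Variables (F : numFieldType) (n d : nat) (sigma : int -> int).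
Hypotheses (hd : (2 < d)%N) (od : odd d).
Hypotheses (hsigma : signature n sigma) (hadm : admissible d sigma).

Lemma initial_balanced p q (I : finType) (S : seed (ratfun F n d) I) :
  valid_cut n d p q -> initial_seed sigma p q S -> balanced sigma S.
Proof.
move=> cut [w1 [w2 [b' [[hw1 rb1] [hw2 rb2] [Delta1 [Delta2 [cv1 cv2]]]]]]].
move=> [f1 [f2 [[inj1 inj2 cover glue] [var1 var2 arrS mutS]]]].
have [pq1 pq2] : (d < q - p)%N /\ (d < p + n - q)%N.
  by case: cut => ? ? ?; rewrite leq_min => /andP[]; lia.
have [gam1 [W1 T1 X1 V1]] := bottom_value hd hw1 cv1 pq1 rb1.
have [gam2 [W2 T2 _ V2]] := bottom_value hd hw2 cv2 pq2 rb2.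
have shared k : (0 < k < d)%N -> Delta1 (gam1 k) = Delta2 (gam2 (d - k)%N).
  exact: (shared_variable hd od hsigma hadm hw1 hw2 V1 V2).
have z0 k : (0 < k < d)%N -> in_z0 sigma p q (Delta1 (gam1 k)).
  by move=> kd; exists k => //; exact: V1.
have glued k : (0 < k < d)%N -> f1 (gam1 k) = f2 (gam2 (d - k)%N).
  by move=> kd; apply/glue; split; [exact: shared|exact: z0].
(* Gluing is decided by variables, not by cycles. A glued [i] has the variable of some [gam1 k], so
   [gam1 k] is glued to the same [j], and injectivity of [f1] gives [i = gam1 k]; similarly for
   [j]. *)
have glueP i j : f1 i = f2 j -> exists k, [/\ (0 < k < d)%N, i = gam1 k & j = gam2 (d - k)%N].
  move=> ij; have /glue[/= e [k kd Vi]] := ij; exists k.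
  have iE : Delta1 i = Delta1 (gam1 k).
    apply: value_eq; apply: generic_imp (generic_and Vi (V1 k kd)) => u h.
    by exists (det (wedge (Fflag sigma u p%:Z k) (Fflag sigma u q%:Z (d - k)%N))).
  have e1 : f1 (gam1 k) = f2 j by apply/glue; split; [rewrite /= -iE|exact: z0].
  split=> //; first by apply: inj1; rewrite e1.
  by apply: inj2; rewrite -glued.
have graded_hom r := (weave_graded hd hsigma hadm hw1 cv1 r, weave_graded hd hsigma hadm hw2 cv2 r).
(* Degrees are attached to the variables of the vertices, so a glued vertex has a single degree;
   [hom_uniq] then matches it with the degrees in both weaves. *)
have /choice[a ha] r : exists a : I -> int, forall v, hom r (a v) (var S v).
  have [[dg1 [A1 [_ h1]]] [dg2 [A2 [_ h2]]]] := graded_hom r.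
  have /choice[a ha] (v : I) : exists x : int, hom r x (var S v); last by exists a.
  have [[i ->]|[j ->]] := cover v; rewrite ?var1 ?var2.
    by exists (dg1 i); exact: h1.
  by exists (dg2 j); exact: h2.
exists a; split=> //.
- by move=> v; have [[i ->]|[j ->]] := cover v; rewrite ?var1 ?var2; [case: cv1|case: cv2].
- move=> v v'; rewrite !arrS opprD; congr (_ + _); rewrite exchange_big -sumrN.
    apply: eq_bigr => i _; rewrite -sumrN; apply: eq_bigr => i' _ /=; exact: pairing_skew hw1 _ _.
  apply: eq_bigr => i _; rewrite -sumrN; apply: eq_bigr => i' _ /=; exact: pairing_skew hw2 _ _.
move=> r v mv; have [[dg1 [A1 [gA1 h1]]] [dg2 [A2 [gA2 h2]]]] := graded_hom r.
have a1 i : a r (f1 i) = dg1 i.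
  by apply: hom_uniq (cluster_variable_neq0 cv1 i) _ (h1 i); have := ha r (f1 i); rewrite var1.
have a2 j : a r (f2 j) = dg2 j.
  by apply: hom_uniq (cluster_variable_neq0 cv2 j) _ (h2 j); have := ha r (f2 j); rewrite var2.
pose P1 (i : Defs.cycle (beta d sigma p q) (marked d) w1) := flux A1 i 0 - flux A1 i (size w1).
pose P2 (j : Defs.cycle (beta d sigma q (p + n)) (marked d) w2) := flux A2 j 0 - flux A2 j (size w2).
have -> : \sum_v' arrows S v v' * a r v' =
    \sum_(i | f1 i == v) P1 i + \sum_(j | f2 j == v) P2 j.
  under eq_bigr => v' _ do rewrite arrS mulrDl.
  rewrite big_split /=; congr (_ + _).
    under eq_bigr => v' _ do rewrite mulr_suml.
    rewrite exchange_big; apply: eq_bigr => i _ /=; rewrite big_fiber.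
    under eq_bigr => i' _ do rewrite a1.
    exact: (pairing_flux hw1 (letters_beta d sigma p q) gA1 (leqnn _)).
  under eq_bigr => v' _ do rewrite mulr_suml.
  rewrite exchange_big; apply: eq_bigr => i _ /=; rewrite big_fiber.
  under eq_bigr => i' _ do rewrite a2.
  exact: (pairing_flux hw2 (letters_beta d sigma q (p + n)) gA2 (leqnn _)).
have single1 i : f1 i = v -> \sum_(i | f1 i == v) P1 i = P1 i.
  by move=> iv; rewrite -iv (big_pred1 i) // => i'; rewrite (inj_eq inj1).
have single2 j : f2 j = v -> \sum_(j | f2 j == v) P2 j = P2 j.
  by move=> jv; rewrite -jv (big_pred1 j) // => j'; rewrite (inj_eq inj2).
have none1 : (forall i, f1 i <> v) -> \sum_(i | f1 i == v) P1 i = 0.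
  by move=> h; rewrite big1 // => i /eqP/h.
have none2 : (forall j, f2 j <> v) -> \sum_(j | f2 j == v) P2 j = 0.
  by move=> h; rewrite big1 // => j /eqP/h.
(* At a glued vertex the two bottom fluxes cancel. A mutable vertex of one weave alone comes from an
   unfrozen cycle, whose flux vanishes at both ends. *)
case: (pselect (exists i, f1 i = v)) => [[i iv]|n1];
  case: (pselect (exists j, f2 j = v)) => [[j jv]|n2].
- have [k [kd iE jE]] := glueP i j (etrans iv (esym jv)).
  rewrite (single1 i) // (single2 j) // /P1 /P2 iE jE.
  have [l1 l2] := shared_level hd od cut hw1 rb1 hw2 W1 W2 T1 T2 X1 kd.
  rewrite (flux_before A1 l1) (flux_before A2 l2) !sub0r -opprD.
  rewrite (shared_flux hd od hsigma hadm cut hw1 rb1 hw2 cv1 W1 W2 V1 V2 gA1 gA2 h1 h2) ?oppr0 //.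
  move=> m md; rewrite -(inj_eq inj1) -(inj_eq inj2) !glued //; lia.
- rewrite (single1 i) // none2 ?addr0; last by move=> j jv; apply: n2; exists j.
  have [l0 w0] : (0 < level i)%N /\ forall e, weight i (size w1) e = 0%N.
    apply: frozenN; move: mv; rewrite mutS => /or3P[/existsP[i' /andP[/eqP iv' ?]]| |].
    + by rewrite (inj1 i i') // iv iv'.
    + by case/existsP => j /andP[/eqP jv _]; case: n2; exists j.
    + by case/andP => _ /existsP[j /eqP jv]; case: n2; exists j.
  rewrite /P1 (flux_before A1 l0) /flux big1 ?subr0 // => e _; by rewrite w0 mul0r.
- rewrite (single2 j) // none1 ?add0r; last by move=> i iv; apply: n1; exists i.
  have [l0 w0] : (0 < level j)%N /\ forall e, weight j (size w2) e = 0%N.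
    apply: frozenN; move: mv; rewrite mutS => /or3P[| /existsP[j' /andP[/eqP jv' ?]]|].
    + by case/existsP => i /andP[/eqP iv _]; case: n1; exists i.
    + by rewrite (inj2 j j') // jv jv'.
    + by case/andP => /existsP[i /eqP iv] _; case: n1; exists i.
  rewrite /P2 (flux_before A2 l0) /flux big1 ?subr0 // => e _; by rewrite w0 mul0r.
by case: (cover v) => -[x xv]; [case: n1|case: n2]; exists x.
Qed.

End Initial.

Local Open Scope complex_scope.

Theorem proposition5p11 (R : realType) (d n : nat) (sigma : int -> int)
    (hd : (3 <= d)%N) (hodd : odd d) (hn : (d ^ 2 < n)%N)
    (hsigma : signature n sigma) (hadm : admissible d sigma)
    (z : ratfun R[i] n d) :
  cluster_or_frozen_variable sigma z -> multihomogeneous sigma z.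
Proof.
move=> [p [q [I [S0 [S [v [cut init eqv ->]]]]]]].
apply: balanced_multihomogeneous; apply: balanced_mutation_equiv eqv _.
exact: initial_balanced init.
Qed.
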